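(* Let $\theta\in[0,1]$ and $T>0$, and suppose that the vector-valued function $A^{2-\theta}f$ belongs to $L_2((0,T),H)$. Consider the initial value problem $$\frac{d^2u}{dt^2}+A^2u-\int_0^tK(t-s)A^{2\theta}u(s)\,ds=f(t),\qquad u(+0)=\varphi_0,\quad u^{(1)}(+0)=\varphi_1 .$$ 1) Suppose that $\sum_{k=1}^\infty \frac{c_k}{\gamma_k}<1$ and $\sum_{k=1}^\infty c_k<+\infty$, and that $\varphi_0\in H_2$, $\varphi_1\in H_1$ (with $\theta\in[0,1]$). Then the initial value problem has a unique solution $u$ in the Sobolev space $W_2^2((0,T),A^2)$, and this solution satisfies $$\|u\|_{W_2^2((0,T),A^2)}\le d(T)\left(\|A^{2-\theta}f\|_{L_2((0,T),H)}+\|A^2\varphi_0\|_H+\|A\varphi_1\|_H\right)$$ with a positive constant $d(T)$ that does not depend on $f$, $\varphi_0$, $\varphi_1$. 2) Suppose that $\sum_{k=1}^\infty \frac{c_k}{\gamma_k}<1$ but $\sum_{k=1}^\infty c_k=+\infty$, that $\theta\in(0,1]$, and that $\varphi_0\in H_{2+\theta}$, $\varphi_1\in H_{1+\theta}$. Then the initial value problem has a unique solution $u$ in $W_2^2((0,T),A^2)$, and this solution satisfies $$\|u\|_{W_2^2((0,T),A^2)}\le d(T)\left(\|A^{2-\theta}f\|_{L_2((0,T),H)}+\|A^{2+\theta}\varphi_0\|_H+\|A^{1+\theta}\varphi_1\|_H\right)$$ with a positive constant $d(T)$ that does not depend on $f$, $\varphi_0$, $\varphi_1$.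
   Context: $H$ is a separable Hilbert space and $A$ is a self-adjoint positive operator in $H$ with compact inverse. $\{e_n\}_{n\ge1}$ is the orthonormal basis of eigenvectors of $A$, $Ae_n=a_ne_n$, with $1\le a_1\le a_2\le\cdots$ (counted with multiplicity), $a_n\to+\infty$. For $s\ge 0$, $H_s=\operatorname{dom}(A^s)$. The scalar kernel is $K(t)=\sum_{k=1}^\infty c_k e^{-\gamma_k t}$ with $c_k>0$, $\gamma_{k+1}>\gamma_k>0$ for $k\in\mathbb N$, and $\gamma_k\to+\infty$. The Sobolev space $W_2^2((0,T),A^2)$ consists of $H$-valued functions $u$ on $(0,T)$ for which the norm $\|u\|_{W_2^2((0,T),A^2)}=\left(\int_0^T\left(\|u^{(2)}(t)\|_H^2+\|A^2u(t)\|_H^2\right)dt\right)^{1/2}$ is finite. A solution is a function $u\in W_2^2((0,T),A^2)$ that satisfies the equation almost everywhere on $(0,T)$ and satisfies the initial conditions. *)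

(* Defs.v *)
From HB Require Import structures.
From mathcomp Require Import all_boot all_order all_algebra.
From mathcomp Require Import complex.
From mathcomp Require Import all_classical all_reals all_analysis.

Set Implicit Arguments.
Unset Strict Implicit.
Unset Printing Implicit Defensive.

Import Order.TTheory GRing.Theory Num.Theory.
Import numFieldNormedType.Exports.

Local Open Scope classical_set_scope.
Local Open Scope ring_scope.

Section HilbertSpace.
Context {R : realType} {H : completeNormedModType R[i]}.

(* The norm of a normed module over R[i] has its values in R[i]. *)
Definition rnorm (x : H) : R := complex.Re `|x|.

Definition rscale (r : R) (x : H) : H := (r%:C)%C *: x.

(* A complete normed space is a Hilbert space for [dot] when [dot] is an inner
   product (linear in its first argument) that induces the norm. *)
Definition hilbert_dot (dot : {dot H for Num.conj}) : Prop :=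
  forall x : H, `|x| ^+ 2 = dot x x.

Definition separable_space : Prop :=
  exists S : set H, countable S /\ dense S.

Record unbounded_operator := UnboundedOperator {
  op_dom : set H ;
  op_fun :> H -> H ; (* the values outside [op_dom] are irrelevant *)
  op_dom0 : op_dom 0 ;
  op_dom_linear : forall (k : R[i]) x y, op_dom x -> op_dom y -> op_dom (k *: x + y) ;
  op_fun_linear : forall (k : R[i]) x y, op_dom x -> op_dom y ->
    op_fun (k *: x + y) = k *: op_fun x + op_fun y }.

(* The second conjunct says that the graph of A is the graph of its adjoint. *)
Definition self_adjoint (dot : {dot H for Num.conj}) (A : unbounded_operator) :=
  dense (op_dom A) /\
  forall y z : H,
    (forall x, op_dom A x -> dot (A x) y = dot x z) <-> (op_dom A y /\ A y = z).

Definition positive_operator (dot : {dot H for Num.conj})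
    (A : unbounded_operator) : Prop :=
  forall x, op_dom A x -> x != 0 -> 0 < dot (A x) x.

Definition has_compact_inverse (A : unbounded_operator) : Prop :=
  exists B : H -> H,
    [/\ forall x, op_dom A (B x) /\ A (B x) = x,
        forall x, op_dom A x -> B (A x) = x
      & forall S : set H, bounded_set S -> precompact (B @` S)].

Definition orthonormal_basis (dot : {dot H for Num.conj}) (e : nat -> H) : Prop :=
  (forall m n, dot (e m) (e n) = (m == n)%:R) /\
  forall x : H, series (fun n => dot x (e n) *: e n) @ \oo --> x.

(* Spectral theorem: when e is an orthonormal basis of eigenvectors of A, with
   eigenvalues a n >= 1, A^s is x |-> \sum_n (a n)^s <x, e n> e n on the domain
   where \sum_n (a n)^(2 s) |<x, e n>|^2 is finite. *)
Definition op_pow_dom (dot : {dot H for Num.conj}) (e : nat -> H) (a : nat -> R)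
    (s : R) : set H :=
  [set x | (\sum_(0 <= n <oo)
             (a n `^ (2 * s) * complex.Re `|dot x (e n)| ^+ 2)%:E < +oo)%E].

Definition op_pow (dot : {dot H for Num.conj}) (e : nat -> H) (a : nat -> R)
    (s : R) (x : H) : H :=
  limn (series (fun n => rscale (a n `^ s) (dot x (e n) *: e n))).

(* Borel measurability; as H is separable, this is strong measurability. *)
Definition vmeasurable (D : set R) (g : R -> H) : Prop :=
  measurable_fun D (g : R -> g_sigma_algebraType (@open H)).

Record simple_function := SimpleFunction {
  sf_size : nat ;
  sf_set : 'I_sf_size -> set R ;
  sf_val : 'I_sf_size -> H ;
  sf_measurable : forall i, measurable (sf_set i) ;
  sf_finite : forall i, (lebesgue_measure (sf_set i) < +oo)%E }.

Definition sf_fun (s : simple_function) (t : R) : H :=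
  \sum_(i < sf_size s) rscale (\1_(sf_set i) t) (sf_val i).

Definition sf_integral (D : set R) (s : simple_function) : H :=
  \sum_(i < sf_size s)
    rscale (fine (lebesgue_measure (D `&` sf_set i))) (sf_val i).

(* g is Bochner integrable on D, with integral y. *)
Definition bochner_integral (D : set R) (g : R -> H) (y : H) : Prop :=
  vmeasurable D g /\
  exists s : nat -> simple_function,
    (\int[lebesgue_measure]_(t in D) (rnorm (g t - sf_fun (s n) t))%:E
       @[n --> \oo] --> 0)%E /\
    sf_integral D (s n) @[n --> \oo] --> y.

(* The intervals (0, T) are open, and functions on them are functions on R
   whose values outside (0, T) are ignored. *)
Definition ae_on (T : R) (P : R -> Prop) : Prop :=
  {ae lebesgue_measure, forall t, t \in `]0, T[ -> P t}.

Definition in_L2 (T : R) (g : R -> H) : Prop :=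
  vmeasurable `]0, T[ g /\
  (\int[lebesgue_measure]_(t in `]0%R, T[) ((rnorm (g t)) ^+ 2)%:E < +oo)%E.

Definition norm_L2 (T : R) (g : R -> H) : R :=
  Num.sqrt (fine (\int[lebesgue_measure]_(t in `]0%R, T[)
    ((rnorm (g t)) ^+ 2)%:E)%E).

Definition test_function (T : R) (phi : R -> R) : Prop :=
  (forall n t, derivable (derive1n n phi) t 1) /\
  exists a b : R, [/\ 0 < a, b < T & forall t, ~~ (a <= t <= b) -> phi t = 0].

(* v is the n-th derivative of u on (0, T) in the sense of distributions. *)
Definition weak_derivative (T : R) (n : nat) (u v : R -> H) : Prop :=
  forall phi, test_function T phi ->
  exists y : H,
    bochner_integral `]0, T[ (fun t => rscale (derive1n n phi t) (u t)) y /\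
    bochner_integral `]0, T[ (fun t => rscale (phi t) (v t)) ((-1) ^+ n *: y).

(* A square-integrable representative of u^(n), when there is one. *)
Definition gderive (T : R) (n : nat) (u : R -> H) : R -> H :=
  get [set v | in_L2 T v /\ weak_derivative T n u v].

(* g(+0) = x for the class of g modulo a.e. equality on (0, T). *)
Definition initial_value (T : R) (g : R -> H) (x : H) : Prop :=
  exists h : R -> H, ae_on T (fun t => g t = h t) /\ h t @[t --> 0^'+] --> x.

Section Problem.
Variables (dot : {dot H for Num.conj}) (e : nat -> H) (a : nat -> R).

(* A^s g belongs to L_2((0, T), H); g itself need only take values in dom A^s
   almost everywhere. *)
Definition in_L2_pow (T s : R) (g : R -> H) : Prop :=
  ae_on T (fun t => op_pow_dom dot e a s (g t)) /\
  in_L2 T (fun t => op_pow dot e a s (g t)).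

Definition in_W22 (T : R) (u : R -> H) : Prop :=
  [/\ in_L2 T u, in_L2_pow T 2 u
    & exists v, in_L2 T v /\ weak_derivative T 2 u v].

Definition norm_W22 (T : R) (u : R -> H) : R :=
  Num.sqrt (fine (\int[lebesgue_measure]_(t in `]0%R, T[)
    ((rnorm (gderive T 2 u t)) ^+ 2 +
     (rnorm (op_pow dot e a 2 (u t))) ^+ 2)%:E)%E).

Definition exp_kernel (c gamma : nat -> R) (t : R) : R :=
  limn (series (fun k => c k * expR (- (gamma k * t)))).

Definition satisfies_equation (K : R -> R) (theta T : R) (f u : R -> H) : Prop :=
  ae_on T (fun t => exists I : H,
    bochner_integral `]0, t[
      (fun s => rscale (K (t - s)) (op_pow dot e a (2 * theta) (u s))) I /\
    gderive T 2 u t + op_pow dot e a 2 (u t) - I = f t).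

Definition is_solution (K : R -> R) (theta T : R) (f : R -> H)
    (phi0 phi1 : H) (u : R -> H) : Prop :=
  [/\ in_W22 T u, satisfies_equation K theta T f u,
      initial_value T u phi0 & initial_value T (gderive T 1 u) phi1].

End Problem.
End HilbertSpace.
Arguments unbounded_operator {R} H.
Arguments separable_space {R} H.

(* Main.v *)
(* In the coordinates of the eigenbasis (real and imaginary parts taken
   separately) the problem splits into scalar equations
     x'' + al^2 x - be (K * x) = g,  al >= 1,  0 <= be = al^(2 theta) <= al^2.
   As K is a sum of exponentials, K * x = Sum_k c_k z_k with
   z_k = e^{-gamma_k .} * x, and v_k = x - gamma_k z_k satisfies
   v_k' = x' - gamma_k v_k. With kap = Sum_k c_k / gamma_k < 1 this turns
     x'^2 + (al^2 - be kap) x^2 + be Sum_k (c_k / gamma_k) v_k^2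
   into an energy that grows only through the source g, so that al^4 x^2, x'^2
   and the L^2 norm of x'' are bounded by
     al^2 q^2 + al^4 p^2 + al^2 ||g||^2  (p = x(0), q = x'(0))
   up to a constant depending only on kap and T. For g = crd f one has
   al^2 ||g||^2 <= ||crd (A^{2 - theta} f)||^2, hence summing over the modes gives
   existence and the estimate. Conversely, testing the weak equation against
   smooth functions shows that the modes of any solution solve the scalar
   equations, whose solutions are unique. Both parts come from this estimate:
   as al >= 1, the data norms of the second part dominate those of the first. *)
Require Import Defs.
From HB Require Import structures.
From mathcomp Require Import all_boot all_order all_algebra.
From mathcomp Require Import complex.
From mathcomp Require Import all_classical all_reals all_analysis.
From mathcomp Require Import measurable_realfun.
From mathcomp Require Import ring lra.
Import Order.TTheory GRing.Theory Num.Theory.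
Import numFieldNormedType.Exports.
Local Open Scope classical_set_scope.
Local Open Scope ring_scope.
Set Implicit Arguments.
Unset Strict Implicit.
Unset Printing Implicit Defensive.

(** * Primitives of integrable functions *)

(** When [Sum_k c_k] diverges, [K] is unbounded near 0 and [K * x] cannot be differentiated through
    [K]. Each single [z_k] can, and the weights [c_k / gamma_k] are those for which the cross terms
    of the energy reproduce [c_k z_k]. The dissipation is dropped for its sign at every finite
    truncation, and only the resulting inequality passes to the limit in the number of terms. The
    source is merely integrable in time, so [x'] need not be differentiable everywhere. The calculus
    is therefore that of primitives of Lebesgue integrable functions, with a product rule that comes
    from Fubini. In the uniqueness half the obstacle is the second initial condition: membership in
    the Sobolev space speaks of [u] and [u''] only, and a square-integrable [u'] has to be produced
    before [u'(+0)] says anything about the modes. *)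

Definition prim {R : realType} (h : R -> R) (t : R) : R :=
  \int[lebesgue_measure]_(s in `]0, t[) h s.

Section Primitives.
Context {R : realType}.
Variable T : R.
Notation mu := (@lebesgue_measure R).
Implicit Types (x y h k : R -> R) (t s : R).

Definition L1 h : Prop := mu.-integrable `]0, T[ (EFin \o h).

Definition bdd_meas x : Prop :=
  measurable_fun `]0, T[ x /\ exists M, forall t, 0 < t < T -> `|x t| <= M.

Lemma ae_imp (P Q : R -> Prop) : (forall t, P t -> Q t) ->
  {ae mu, forall t, P t} -> {ae mu, forall t, Q t}.
Proof. by move=> PQ; apply: (@filterS _ _ (ae_filter_ringOfSetsType mu)). Qed.

Lemma ae_onW (P : R -> Prop) : (forall t, 0 < t < T -> P t) -> ae_on T P.
Proof. by move=> H; apply: aeW => t /=; rewrite in_itv/=; exact: H. Qed.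

Lemma ae_onS (P Q : R -> Prop) : (forall t, 0 < t < T -> P t -> Q t) ->
  ae_on T P -> ae_on T Q.
Proof. by move=> PQ; apply: ae_imp => t PT tT; apply: PQ (PT tT); move: tT; rewrite in_itv. Qed.

Lemma ae_onS2 (P Q S : R -> Prop) : (forall t, 0 < t < T -> P t -> Q t -> S t) ->
  ae_on T P -> ae_on T Q -> ae_on T S.
Proof.
move=> PQS; apply: (@filterS2 _ _ (ae_filter_ringOfSetsType mu)) => t PT QT tT.
by apply: PQS (PT tT) (QT tT); move: tT; rewrite in_itv.
Qed.

Lemma ae_on_all (P : nat -> R -> Prop) : (forall n, ae_on T (P n)) ->
  ae_on T (fun t => forall n, P n t).
Proof. by move=> /ae_foralln; apply: ae_imp => t H tT n; exact: H. Qed.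

Lemma itv_oo_meas (a b : R) : measurable (`]a, b[ : set R).
Proof. exact: measurable_itv. Qed.

Lemma mu_itvoo_lty (a b : R) : (mu `]a, b[ < +oo)%E.
Proof. by rewrite lebesgue_measure_itv/=; case: ifP => _; rewrite ?ltry. Qed.

Lemma mu_prim_itv t : 0 <= t -> fine (mu `]0, t[) = t.
Proof.
rewrite le_eqVlt => /predU1P[<-|t0]; first by rewrite set_itvoo0 measure0.
by rewrite lebesgue_measure_itv/= lte_fin t0 -EFinB/= subr0.
Qed.

Lemma L1_meas h : L1 h -> measurable_fun `]0, T[ h.
Proof. by move=> /integrableP[/measurable_EFinP]. Qed.

Lemma L1_sub h (a b : R) : 0 <= a -> b <= T -> L1 h -> mu.-integrable `]a, b[ (EFin \o h).
Proof.
move=> a0 bT; apply: integrableS => //.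
move=> x /=; rewrite !in_itv/= => /andP[ax xb].
by rewrite (le_lt_trans a0 ax) (lt_le_trans xb bT).
Qed.

Lemma L1_itv h t : t <= T -> L1 h -> mu.-integrable `]0, t[ (EFin \o h).
Proof. by move=> ?; apply: L1_sub. Qed.

Lemma bdd_meas_L1 x : bdd_meas x -> L1 x.
Proof.
move=> [mx [M xM]]; apply: measurable_bounded_integrable => //.
  exact: mu_itvoo_lty.
by exists M; split=> [|K MK t /=]; [exact: num_real|rewrite in_itv/= => /xM /le_trans; apply; exact: ltW].
Qed.

Lemma L1D h k : L1 h -> L1 k -> L1 (fun t => h t + k t).
Proof. by move=> ih ik; rewrite /L1; apply: eq_integrable (integrableD _ ih ik). Qed.

Lemma L1Z (c : R) h : L1 h -> L1 (fun t => c * h t).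
Proof. by move=> ih; rewrite /L1; apply: eq_integrable (integrableZl _ c ih). Qed.

Lemma L1B h k : L1 h -> L1 k -> L1 (fun t => h t - k t).
Proof. by move=> ih ik; rewrite /L1; apply: eq_integrable (integrableB _ ih ik). Qed.

Lemma L1_abs h : L1 h -> L1 (fun t => `|h t|).
Proof. by move=> ih; rewrite /L1; apply: eq_integrable (integrable_abse ih). Qed.

Lemma L1M x h : bdd_meas x -> L1 h -> L1 (fun t => x t * h t).
Proof.
move=> [mx [M xM]] ih; rewrite /L1.
have := @integrableMr _ _ _ mu _ _ x (EFin \o h) mx.
move=> /(_ (itv_oo_meas _ _)) H.
rewrite (_ : EFin \o _ = ((EFin \o x) \* (EFin \o h))%E); last by apply/funext.
apply: H ih.
by exists M; split=> [|K MK t /=]; [exact: num_real|rewrite in_itv/= => /xM /le_trans; apply; exact: ltW].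
Qed.

Lemma bdd_measD x y : bdd_meas x -> bdd_meas y -> bdd_meas (fun t => x t + y t).
Proof.
move=> [mx [M xM]] [my [N yN]]; split; first exact: measurable_funD.
by exists (M + N) => t tT; rewrite (le_trans (ler_normD _ _))// lerD// ?xM ?yN.
Qed.

Lemma bdd_measZ c x : bdd_meas x -> bdd_meas (fun t => c * x t).
Proof.
move=> [mx [M xM]]; split; first exact: measurable_funM.
by exists (`|c| * M) => t tT; rewrite normrM ler_wpM2l ?xM.
Qed.

Lemma bdd_measM x y : bdd_meas x -> bdd_meas y -> bdd_meas (fun t => x t * y t).
Proof.
move=> [mx [M xM]] [my [N yN]]; split; first exact: measurable_funM.
by exists (M * N) => t tT; rewrite normrM ler_pM// ?xM ?yN.
Qed.

Lemma bdd_meas_cst c : bdd_meas (fun=> c).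
Proof. by split; [exact: measurable_cst|exists `|c|]. Qed.

Lemma L1_cst c : L1 (fun=> c).
Proof. by apply: bdd_meas_L1; exact: bdd_meas_cst. Qed.

Lemma bdd_meas_sum n (z : nat -> R -> R) :
  (forall i, bdd_meas (z i)) -> bdd_meas (fun t => \sum_(0 <= i < n) z i t).
Proof.
move=> zb; elim: n => [|n ih].
  rewrite (_ : (fun _ => _) = fun=> 0); first exact: bdd_meas_cst.
  by apply/funext => t; rewrite big_geq.
rewrite (_ : (fun _ => _) = fun t => \sum_(0 <= i < n) z i t + z n t); first exact: bdd_measD.
by apply/funext => t; rewrite big_nat_recr.
Qed.

Lemma primD h k t : t <= T -> L1 h -> L1 k ->
  prim (fun s => h s + k s) t = prim h t + prim k t.
Proof. by move=> tT ih ik; apply: RintegralD => //; exact: L1_itv. Qed.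

Lemma primB h k t : t <= T -> L1 h -> L1 k ->
  prim (fun s => h s - k s) t = prim h t - prim k t.
Proof. by move=> tT ih ik; apply: RintegralB => //; exact: L1_itv. Qed.

Lemma primZ c h t : t <= T -> L1 h -> prim (fun s => c * h s) t = c * prim h t.
Proof. by move=> tT ih; apply: RintegralZl => //; exact: L1_itv. Qed.

Lemma prim_cst c t : 0 <= t -> prim (fun=> c) t = c * t.
Proof. by move=> t0; rewrite /prim Rintegral_cst// mu_prim_itv. Qed.

Lemma eq_prim h k t : (forall s, 0 < s < t -> h s = k s) -> prim h t = prim k t.
Proof. by move=> hk; apply: eq_Rintegral => s; rewrite inE/= in_itv/= => /hk. Qed.

Lemma le_prim h k t : t <= T -> L1 h -> L1 k ->
  (forall s, 0 < s < t -> h s <= k s) -> prim h t <= prim k t.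
Proof.
move=> tT ih ik hk; apply: le_Rintegral => //; exact: L1_itv.
Qed.

Lemma prim_ge0 h t : (forall s, 0 < s < t -> 0 <= h s) -> 0 <= prim h t.
Proof. by move=> hk; apply: Rintegral_ge0 => s /=; rewrite in_itv/= => /hk. Qed.

Lemma prim_norm_le h t : t <= T -> L1 h -> `|prim h t| <= prim (fun s => `|h s|) t.
Proof. by move=> tT ih; apply: le_normr_Rintegral => //; exact: L1_itv. Qed.

Lemma prim0 h t : t <= 0 -> prim h t = 0.
Proof. by move=> t0; rewrite /prim set_itv_ge ?Rintegral_set0// bnd_simp -leNgt. Qed.

Lemma primEFin h t : t <= T -> L1 h ->
  (\int[mu]_(s in `]0%R, t[) (h s)%:E = (prim h t)%:E)%E.
Proof.
by move=> tT /(L1_itv tT) ih; rewrite /prim /Rintegral fineK//; exact: integrable_fin_num.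
Qed.

Lemma prim_split h (s t : R) : 0 <= s -> s <= t -> t <= T -> L1 h ->
  prim h t - prim h s = \int[mu]_(r in `]s, t[) h r.
Proof.
move=> s0 st tT ih; rewrite /prim.
have [->|s_t] := eqVneq s t.
  by rewrite subrr set_itvoo0 Rintegral_set0.
have slt : s < t by rewrite lt_neqAle s_t.
have [->|s_0] := eqVneq s 0.
  by rewrite set_itvoo0 Rintegral_set0 subr0.
have s_gt0 : 0 < s by rewrite lt_neqAle eq_sym s_0.
have := @Rintegral_itvB _ h (BRight 0) (BLeft t) s (L1_itv tT ih).
rewrite !bnd_simp => /(_ s0 slt) <-; congr (_ - _).
by rewrite Rintegral_itv_bndo_bndc//; apply: L1_itv => //; exact: le_trans tT.
Qed.

Lemma prim_homo h (s t : R) : 0 <= s -> s <= t -> t <= T -> L1 h ->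
  (forall r, s < r < t -> 0 <= h r) -> prim h s <= prim h t.
Proof.
move=> s0 st tT ih h0; rewrite -subr_ge0 prim_split//.
by apply: Rintegral_ge0 => r /=; rewrite in_itv/= => /h0.
Qed.

Lemma prim_ae h k t : t <= T -> L1 h -> L1 k ->
  ae_on T (fun s => h s = k s) -> prim h t = prim k t.
Proof.
move=> tT ih ik hk; congr fine; apply: ae_eq_integral => //.
- by have /integrableP[] := L1_itv tT ih.
- by have /integrableP[] := L1_itv tT ik.
- have sub : `]0, t[%classic `<=` `]0, T[%classic by exact: subset_itvl.
  by apply: (ae_imp _ hk) => s /= + /sub st; move=> -> //; rewrite inE.
Qed.

(** Measurability comes from the continuity of an integral in its upper bound. That continuity is
    used on [[0, T]], so [h] is extended by 0 from []0, T[], and the endpoints, which are null, are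
    exchanged at the end. *)
Lemma prim_bdd_meas h : L1 h -> bdd_meas (prim h).
Proof.
move=> ih; split; last first.
  exists (prim (fun s => `|h s|) T) => t /andP[t0 tT].
  apply: (le_trans (prim_norm_le (ltW tT) ih)).
  by apply: prim_homo => //; [exact: ltW|exact: ltW|exact: L1_abs].
have [T0|T0] := leP T 0.
  by rewrite set_itv_ge ?bnd_simp -?leNgt//; exact: measurable_fun_set0.
have ih' : mu.-integrable `[0, T] (EFin \o (h \_ `]0, T[)).
  rewrite -restrict_EFin -integrable_restrict//=.
  by apply: integrableS ih => //; exact: measurableI.
have /subspace_continuous_measurable_fun := parameterized_integral_continuous (ltW T0) ih'.
move=> /(_ (measurable_itv _)) mp.
have {}mp : measurable_fun `]0, T[ (fun x : R => \int[mu]_(t in `[0, x]) (h \_ `]0, T[) t).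
  by apply: measurable_funS mp => //; exact: subset_itv_oo_cc.
apply: eq_measurable_fun mp => t; rewrite inE/= in_itv/= => /andP[t0 tT].
apply/esym.
rewrite /prim.
rewrite -Rintegral_itv_bndo_bndc; last first.
  by apply: integrableS ih' => //; apply: subset_itv; rewrite bnd_simp// ltW.
rewrite -Rintegral_itv_obnd_cbnd; last first.
  by apply: integrableS ih' => //; apply: subset_itv; rewrite bnd_simp// ltW.
apply: eq_Rintegral => s; rewrite inE/= in_itv/= => /andP[s0 st].
by rewrite patchE mem_set//= in_itv/= s0 (lt_trans st tT).
Qed.

End Primitives.

(** * Product rule, Cauchy-Schwarz and limits for primitives *)

Section PrimMul.
Context {R : realType}.
Variable T : R.
Notation mu := (@lebesgue_measure R).

(* Fubini on the square ]0, t[ x ]0, t[, cut along its diagonal. *)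
Lemma prim_mul (h k : R -> R) t : t <= T -> L1 T h -> L1 T k ->
  prim h t * prim k t = prim (fun s => h s * prim k s + prim h s * k s) t.
Proof.
move=> tT ih ik.
pose D : set R := `]0, t[%classic.
pose h' := h \_ D; pose k' := k \_ D.
have mD : measurable D by exact: measurable_itv.
have ih0 : mu.-integrable D (EFin \o h) by exact: L1_itv ih.
have ik0 : mu.-integrable D (EFin \o k) by exact: L1_itv ik.
have := (@integrable_mkcond _ _ _ mu D (EFin \o h) mD).1 ih0.
rewrite restrict_EFin -/h' => ih'.
have := (@integrable_mkcond _ _ _ mu D (EFin \o k) mD).1 ik0.
rewrite restrict_EFin -/k' => ik'.
have mh' : measurable_fun setT h' by move/integrableP : ih' => [/measurable_EFinP].
have mk' : measurable_fun setT k' by move/integrableP : ik' => [/measurable_EFinP].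
have sumE (f : R -> R) : (\int[mu]_r ((f \_ D) r)%:E = \int[mu]_(r in D) (f r)%:E)%E.
  by rewrite [RHS]integral_mkcond; apply: eq_integral => r _; rewrite !patchE; case: ifP.
pose F (z : R * R) := h' z.1 * k' z.2.
have mF : measurable_fun setT F.
  by apply: measurable_funM; apply: measurableT_comp.
(* The diagonal is left to the complement, so the inner interval is []0, r[] over [A1] and []0, r]]
   over its complement; the extra point carries no mass. *)
pose A1 : set (R * R) := [set z | 0 < z.1 - z.2].
have mA1 : measurable A1.
  have -> : A1 = setT `&` (fun z : R * R => z.1 - z.2) @^-1` `]0, +oo[%classic.
    by apply/seteqP; split=> z /=; rewrite in_itv/= andbT => // -[].
  have mf : measurable_fun setT (fun z : R * R => z.1 - z.2).
    by apply: measurable_funB.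
  by apply: mf => //; exact: measurable_itv.
pose G1 z := F z * \1_A1 z; pose G2 z := F z * \1_(~` A1) z.
have mG1 : measurable_fun setT G1 by apply: measurable_funM => //; exact: measurable_indic.
have mG2 : measurable_fun setT G2.
  by apply: measurable_funM => //; apply: measurable_indic; exact: measurableC.
have iF : (mu \x mu)%E.-integrable setT (EFin \o F).
  apply/integrable12ltyP; first exact/measurable_EFinP.
  have iah := integrable_abse ih'; have iak := integrable_abse ik'.
  apply: (@le_lt_trans _ _ (\int[mu]_r (`|(h' r)%:E| * \int[mu]_s `|(k' s)%:E|))%E).
    rewrite le_eqVlt; apply/orP; left; apply/eqP; apply: eq_integral => r _.
    rewrite -ge0_integralZl//; first by apply: eq_integral => s _; rewrite /= /F normrM EFinM.
    by apply/measurable_EFinP; exact: measurableT_comp.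
  have cE : (\int[mu]_s `|(k' s)%:E| = (fine (\int[mu]_s `|(k' s)%:E|))%:E)%E.
    by rewrite fineK//; exact: (integrable_fin_num _ iak).
  rewrite cE; apply: integrable_lty => //; exact: integrableZr iah.
have iG1 : (mu \x mu)%E.-integrable setT (EFin \o G1).
  apply: le_integrable iF => //; first exact/measurable_EFinP.
  move=> z _; rewrite /= lee_fin /G1 normrM ler_piMr// indicE.
  by case: (z \in A1); rewrite ?normr1 ?normr0 ?ler01.
have iG2 : (mu \x mu)%E.-integrable setT (EFin \o G2).
  apply: le_integrable iF => //; first exact/measurable_EFinP.
  move=> z _; rewrite /= lee_fin /G2 normrM ler_piMr// indicE.
  by case: (z \in _); rewrite ?normr1 ?normr0 ?ler01.
have EF : (\int[mu \x mu]_z (F z)%:E = (prim h t * prim k t)%:E)%E.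
  rewrite -(integral12_prod_meas1 iF) /fubini_F.
  transitivity (\int[mu]_r ((h' r)%:E * (prim k t)%:E))%E.
    apply: eq_integral => r _; rewrite -(primEFin tT ik) -/D -sumE -integralZl//.
  by rewrite integralZr// sumE (primEFin tT ih) EFinM.
have E1 : (\int[mu \x mu]_z (G1 z)%:E = (prim (fun s => h s * prim k s) t)%:E)%E.
  rewrite -(integral12_prod_meas1 iG1) /fubini_F.
  rewrite -(primEFin tT); last first.
    under eq_fun do rewrite mulrC.
    by apply: L1M => //; exact: prim_bdd_meas.
  rewrite -/D -sumE; apply: eq_integral => r _.
  rewrite patchE; case: ifPn => [|rD]; last first.
    rewrite integral0_eq// => s _.
    by rewrite /= /G1 /F /= /h' patchE (negPf rD) !mul0r.
  rewrite inE /D/= in_itv/= => /andP[r0 rt].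
  have rT : r <= T := le_trans (ltW rt) tT.
  rewrite EFinM -(primEFin rT ik) [in RHS]integral_mkcond -integralZl//; last first.
    exact: (@integrable_mkcond _ _ _ mu _ (EFin \o k) (measurable_itv `]0, r[)).1 (L1_itv rT ik).
  apply: eq_integral => s _; rewrite /= /G1 /F/= /h' /k' indicE !patchE.
  rewrite (mem_set (A := D)) /=; last by rewrite /D/= in_itv/= r0.
  have [s0|s0] := boolP (s \in `]0%R, r[%classic).
    move: s0; rewrite inE/= in_itv/= => /andP[s0 sr].
    rewrite (mem_set (A := D)) /=; last by rewrite /D/= in_itv/= s0 (lt_trans sr rt).
    by rewrite mem_set ?mulr1//= /A1/= subr_gt0.
  rewrite mule0; case: ifPn => sD; last by rewrite mulr0 mul0r.
  rewrite memNset ?mulr0//= /A1/= subr_gt0 => sr; move/negP: s0; apply.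
  by move: sD; rewrite !inE /D/= !in_itv/= => /andP[-> _].
have E2 : (\int[mu \x mu]_z (G2 z)%:E = (prim (fun s => prim h s * k s) t)%:E)%E.
  rewrite -(integral21_prod_meas1 iG2) /fubini_G.
  rewrite -(primEFin tT); last first.
    by apply: L1M => //; exact: prim_bdd_meas.
  rewrite -/D -sumE; apply: eq_integral => r _.
  rewrite patchE; case: ifPn => [|rD]; last first.
    rewrite integral0_eq// => s _.
    by rewrite /= /G2 /F /= /k' patchE (negPf rD) mulr0 mul0r.
  rewrite inE /D/= in_itv/= => /andP[r0 rt].
  have rT : r <= T := le_trans (ltW rt) tT.
  rewrite mulrC EFinM -(primEFin rT ih) integral_itv_bndo_bndc; last first.
    by have /integrableP[] := L1_itv rT ih.
  rewrite [in RHS]integral_mkcond -integralZl//; last first.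
    apply: (@integrable_mkcond _ _ _ mu _ (EFin \o h) (measurable_itv `]0, r])).1.
    apply: integrableS ih0 => //.
    by apply: subset_itvl; rewrite bnd_simp.
  apply: eq_integral => s _; rewrite /= /G2 /F/= /h' /k' indicE !patchE.
  rewrite (mem_set (A := D) (u := r)) /=; last by rewrite /D/= in_itv/= r0.
  have [s0|s0] := boolP (s \in `]0%R, r]%classic).
    move: s0; rewrite inE/= in_itv/= => /andP[s0 sr].
    rewrite (mem_set (A := D)) /=; last by rewrite /D/= in_itv/= s0 (le_lt_trans sr rt).
    by rewrite mem_set ?mulr1//= 1?mulrC// /A1/= subr_gt0; apply/negP; rewrite -leNgt.
  rewrite mule0; case: ifPn => sD; last by rewrite !mul0r.
  rewrite memNset ?mulr0//= /A1/= subr_gt0 => /negP; rewrite -leNgt => sr; move/negP: s0; apply.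
  by move: sD; rewrite !inE /D/= !in_itv/= => /andP[-> _].
apply: EFin_inj; rewrite -EF.
rewrite (primD tT)//; first last.
- by apply: L1M => //; exact: prim_bdd_meas.
- under eq_fun do rewrite mulrC.
  by apply: L1M => //; exact: prim_bdd_meas.
rewrite EFinD -E1 -E2 -integralD//; apply: eq_integral => z _.
rewrite /= -EFinD /G1 /G2 -mulrDr !indicE in_setC.
by case: (z \in A1); rewrite /= ?addr0 ?add0r mulr1.
Qed.

(** Integration by parts for absolutely continuous functions, written as a constant plus a
    primitive. The exponential convolutions, the energy identities and the pairing with test
    functions all go through it. *)
Lemma primM (h k : R -> R) (a b : R) t : t <= T -> L1 T h -> L1 T k -> 0 <= t ->
  (a + prim h t) * (b + prim k t) =
  a * b + prim (fun s => h s * (b + prim k s) + (a + prim h s) * k s) t.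
Proof.
move=> tT ih ik t0.
have bh := prim_bdd_meas ih; have bk := prim_bdd_meas ik.
have ihk : L1 T (fun s => h s * prim k s).
  by under eq_fun do rewrite mulrC; exact: L1M.
have ikh : L1 T (fun s => prim h s * k s) by exact: L1M.
have -> : (fun s => h s * (b + prim k s) + (a + prim h s) * k s) =
          (fun s => (b * h s + a * k s) + (h s * prim k s + prim h s * k s)).
  by apply/funext => s; ring.
rewrite (primD tT); [|by apply: L1D; exact: L1Z|exact: L1D].
rewrite -(prim_mul tT)// (primD tT); [|exact: L1Z|exact: L1Z].
by rewrite !(primZ _ tT)//; ring.
Qed.

Lemma prim_FTC (F f : R -> R) (t : R) : 0 <= t -> continuous f ->
  (forall x : R, is_derive x (1 : R) F (f x)) -> prim f t = F t - F 0.
Proof.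
rewrite le_eqVlt => /predU1P[<- _ _|t0 cf dF]; first by rewrite prim0// subrr.
have ic : mu.-integrable `[0, t] (EFin \o f).
  apply: continuous_compact_integrable; first exact: segment_compact.
  by apply: continuous_subspaceT.
have cF : continuous F.
  by move=> x; apply/differentiable_continuous/derivable1_diffP; apply: ex_derive.
have := @continuous_FTC2 R f F 0 t t0.
rewrite /prim Rintegral_itv_obnd_cbnd; last first.
  by apply: integrableS ic => //; apply: subset_itv; rewrite bnd_simp.
rewrite Rintegral_itv_bndo_bndc; last first.
  by apply: integrableS ic => //; apply: subset_itvl; rewrite bnd_simp.
rewrite /Rintegral => ->//.
- by apply: continuous_subspaceT.
- split; first by move=> x _; apply: ex_derive.
  + by apply: cvg_at_right_filter; exact: cF.
  + by apply: cvg_at_left_filter; exact: cF.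
- by move=> x _; rewrite derive1E; apply: derive_val.
Qed.

(** The integral of [(|h| - m)^2], with [m = I / t] the mean of [|h|], is nonnegative; expanded,
    this is Cauchy-Schwarz against the constant 1. *)
Lemma prim_CS (h : R -> R) (t : R) : 0 <= t -> t <= T -> L1 T h -> L1 T (fun s => h s ^+ 2) ->
  prim (fun s => `|h s|) t ^+ 2 <= t * prim (fun s => h s ^+ 2) t.
Proof.
rewrite le_eqVlt => /predU1P[<- _ _ _|t0 tT ih ih2]; first by rewrite !prim0// expr0n mul0r.
set I := prim _ t; set J := prim _ t.
pose m := I / t.
have ia := L1_abs ih.
have : 0 <= prim (fun s => (h s ^+ 2 - (2 * m) * `|h s|) + m ^+ 2) t.
  apply: prim_ge0 => s _.
  have -> : h s ^+ 2 - 2 * m * `|h s| + m ^+ 2 = (`|h s| - m) ^+ 2.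
    by rewrite sqrrB real_normK ?num_real// ; ring.
  exact: sqr_ge0.
rewrite (primD tT)//; last 2 first.
- by apply: L1B => //; exact: L1Z.
- exact: L1_cst.
rewrite (primB tT)//; last exact: L1Z.
rewrite (primZ _ tT)// prim_cst ?(ltW t0)// -/I -/J /m => H.
rewrite -subr_ge0.
have -> : t * J - I ^+ 2 = t * (J - 2 * (I / t) * I + (I / t) ^+ 2 * t).
  by field; rewrite gt_eqF.
by rewrite mulr_ge0// ltW.
Qed.

Lemma prim_cvg (h_ : nat -> R -> R) (h g : R -> R) t : t <= T ->
  (forall n, L1 T (h_ n)) -> measurable_fun `]0, T[ h -> L1 T g ->
  (forall s, 0 < s < t -> h_ n s @[n --> \oo] --> h s) ->
  (forall n s, 0 < s < t -> `|h_ n s| <= g s) ->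
  prim (h_ n) t @[n --> \oo] --> prim h t.
Proof.
move=> tT ih mh ig hc hg.
have sub : `]0, t[%classic `<=` `]0, T[%classic by exact: subset_itvl.
have mS (f : R -> R) : measurable_fun `]0, T[ f -> measurable_fun `]0, t[ (EFin \o f).
  by move=> mf; apply/measurable_EFinP; apply: measurable_funS mf.
have [] := @dominated_convergence _ _ R mu `]0, t[%classic (measurable_itv _)
  (fun n => EFin \o h_ n) (EFin \o h) (EFin \o g).
- by move=> n; apply: mS; exact: L1_meas.
- exact: mS.
- apply: aeW => s /=; rewrite in_itv/= => st.
  by apply: cvg_EFin; [exact: nearW|exact: hc].
- exact: L1_itv ig.
- by apply: aeW => s n /=; rewrite in_itv/= => st; rewrite lee_fin hg.
move=> ihl _ H.
have -> : (fun n => prim (h_ n) t) = fine \o (fun n => \int[mu]_(x in `]0%R, t[) (EFin \o h_ n) x)%E by [].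
by apply: fine_cvg; rewrite fineK//; exact: integrable_fin_num.
Qed.

End PrimMul.

(** * Convolution with a sum of exponentials *)

Section Series.
Context {R : realType}.

(** The Weierstrass test with its rate kept: at [n = 0] the rate bounds the whole sum, and for
    general [n] it bounds the remainders of the kernel series and of the Picard iteration. *)
Lemma majorized_series (u b : nat -> R) (M l : R) :
  (forall k, `|u k| <= M * b k) -> series b n @[n --> \oo] --> l ->
  exists s, series u n @[n --> \oo] --> s /\
    forall n, `|s - series u n| <= M * (l - series b n).
Proof.
move=> ub bl.
have cMb : cvgn (series (fun k => M * b k)).
  apply/cvg_ex; exists (M * l).
  rewrite (_ : series _ = fun n => M * series b n); first exact: cvgMl_tmp.
  by apply/funext => n; rewrite /series/= mulr_sumr.
have cu : cvgn (series u).
  apply: normed_cvg; apply: (@series_le_cvg _ _ (fun k => M * b k)) => //= k.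
  exact: le_trans (normr_ge0 _) (ub k).
exists (limn (series u)); split; first exact: cu.
move=> n.
have step m : (n <= m)%N -> `|series u m - series u n| <= M * (series b m - series b n).
  move=> nm; rewrite !sub_series_geq// mulr_sumr.
  by apply: (le_trans (ler_norm_sum _ _ _)); apply: ler_sum => k _; exact: ub.
have c1 : `|series u m - series u n| @[m --> \oo] --> `|limn (series u) - series u n|.
  by apply: cvg_norm; apply: cvgB; [exact: cu|exact: cvg_cst].
have c2 : M * (series b m - series b n) @[m --> \oo] --> M * (l - series b n).
  by apply: cvgMl_tmp; apply: cvgB; [exact: bl|exact: cvg_cst].
by apply: (ler_cvg_to c1 c2); exists n => // m; exact: step.
Qed.

End Series.

Section ExpPrim.
Context {R : realType}.
Variable T : R.

Lemma is_derive_expRM (a x : R) :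
  is_derive x (1 : R) (fun s : R => expR (a * s)) (a * expR (a * x)).
Proof.
have H1 : is_derive x (1 : R) (fun s : R => a * s) a.
  have := @is_deriveZ R R^o R^o id a x 1 1 (is_derive_id x 1).
  by rewrite /GRing.scale/= mulr1.
have := @is_derive1_comp R expR (fun s : R => a * s) x _ _ (is_derive_expR (a * x)) H1.
by rewrite mulrC.
Qed.

Lemma continuous_expRM (a : R) : continuous (fun s : R => expR (a * s)).
Proof.
move=> x; apply: (@continuous_comp _ _ _ (fun s : R => a * s) expR).
  exact: mulrl_continuous.
exact: continuous_expR.
Qed.

Lemma prim_expRM (a t : R) : 0 <= t -> prim (fun s => a * expR (a * s)) t = expR (a * t) - 1.
Proof.
move=> t0.
transitivity (expR (a * t) - expR (a * 0)); last by rewrite mulr0 expR0.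
apply: (@prim_FTC R (fun s => expR (a * s)) _ t t0).
- by move=> x; apply: cvgMl_tmp; exact: continuous_expRM.
- exact: is_derive_expRM.
Qed.

Lemma bdd_meas_expRM (a : R) : bdd_meas T (fun s => expR (a * s)).
Proof.
split.
  apply: measurable_funTS; apply: continuous_measurable_fun; exact: continuous_expRM.
exists (expR (`|a| * T)) => t /andP[t0 tT].
rewrite ger0_norm ?expR_ge0// ler_expR.
apply: (le_trans (ler_wpM2r (ltW t0) (ler_norm a))).
by rewrite ler_wpM2l// ltW.
Qed.

End ExpPrim.

(** This is [e^{-r .} * x] with the exponential taken out of the integral: a product of an
    exponential and a primitive, to which [primM] applies. *)
Definition exp_conv {R : realType} (r : R) (x : R -> R) (t : R) : R :=
  expR (- r * t) * prim (fun s => expR (r * s) * x s) t.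

Section ExpConv.
Context {R : realType}.
Variable T : R.
Implicit Types x : R -> R.

Lemma bdd_meas_exp_conv r x : bdd_meas T x -> bdd_meas T (exp_conv r x).
Proof.
move=> bx; apply: bdd_measM; first exact: bdd_meas_expRM.
by apply: prim_bdd_meas; apply: bdd_meas_L1; apply: bdd_measM => //; exact: bdd_meas_expRM.
Qed.

(** The product rule, with [e^{-r t}] itself written as 1 plus a primitive. This is the integrated
    form of [z' = x - r z], [z(0) = 0]. *)
Lemma exp_conv_prim r x t : 0 <= t <= T -> bdd_meas T x ->
  exp_conv r x t = prim (fun s => x s - r * exp_conv r x s) t.
Proof.
move=> /andP[t0 tT] bx.
have be a := @bdd_meas_expRM R T a.
have ie : L1 T (fun s => - r * expR (- r * s)) by apply: L1Z; exact: bdd_meas_L1.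
have iex : L1 T (fun s => expR (r * s) * x s) by apply: bdd_meas_L1; exact: bdd_measM.
have := @primM R T (fun s => - r * expR (- r * s)) _ 1 0 t tT ie iex t0.
rewrite prim_expRM// mulr0 !add0r (_ : 1 + (expR (- r * t) - 1) = expR (- r * t)); last by ring.
rewrite -/(exp_conv r x t) => ->.
apply: eq_prim => s /andP[s0 st].
rewrite prim_expRM ?ltW// add0r.
rewrite (_ : (1 + (expR (- r * s) - 1)) * (expR (r * s) * x s) =
   (expR (- r * s) * expR (r * s)) * x s); last by ring.
rewrite -expRD (_ : - r * s + r * s = 0) ?expR0; last by ring.
by rewrite /exp_conv; ring.
Qed.

Lemma exp_convB r x y t : t <= T -> bdd_meas T x -> bdd_meas T y ->
  exp_conv r (fun s => x s - y s) t = exp_conv r x t - exp_conv r y t.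
Proof.
move=> tT bx by_; rewrite /exp_conv -mulrBr -(primB tT); last 2 first.
- by apply: bdd_meas_L1; apply: bdd_measM => //; exact: bdd_meas_expRM.
- by apply: bdd_meas_L1; apply: bdd_measM => //; exact: bdd_meas_expRM.
by congr (_ * _); apply: eq_prim => s _; rewrite mulrBr.
Qed.

Lemma eq_exp_conv r x y t : (forall s, 0 < s < t -> x s = y s) ->
  exp_conv r x t = exp_conv r y t.
Proof. by move=> xy; rewrite /exp_conv; congr (_ * _); apply: eq_prim => s /xy ->. Qed.

(** Integrating [e^{(r + sg) s}] yields [1 / (r + sg)], weakened to [1 / r] so that multiplication
    by [c k] and summation give [kap]. The case [sg = 0] is a supremum bound; [sg > 0] serves the
    weighted norm of the Picard iteration. *)
Lemma exp_conv_le r x (M sg : R) t : 0 < r -> 0 <= sg -> 0 <= M -> 0 <= t <= T ->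
  bdd_meas T x -> (forall s, 0 < s < t -> `|x s| <= M * expR (sg * s)) ->
  `|exp_conv r x t| <= M * expR (sg * t) * r^-1.
Proof.
move=> r0 s0 M0 /andP[t0 tT] bx xM.
have be a := @bdd_meas_expRM R T a.
have rs0 : 0 < r + sg by rewrite ltr_wpDr.
have iex : L1 T (fun s => expR (r * s) * x s) by apply: bdd_meas_L1; exact: bdd_measM.
rewrite /exp_conv normrM ger0_norm ?expR_ge0//.
have H : `|prim (fun s => expR (r * s) * x s) t| <= M / (r + sg) * expR ((r + sg) * t).
  apply: (le_trans (prim_norm_le tT iex)).
  apply: (@le_trans _ _ (prim (fun s => M / (r + sg) * ((r + sg) * expR ((r + sg) * s))) t)).
    apply: (le_prim tT).
    - exact: L1_abs.
    - by apply: L1Z; apply: L1Z; exact: bdd_meas_L1.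
    - move=> s st; rewrite normrM ger0_norm ?expR_ge0// mulrA divfK ?gt_eqF//.
      rewrite mulrDl expRD mulrCA ler_wpM2l ?expR_ge0//.
      exact: xM.
  rewrite (primZ _ tT); last by apply: L1Z; exact: bdd_meas_L1.
  rewrite prim_expRM// ler_wpM2l//; first by rewrite divr_ge0// ltW.
  by rewrite lerBlDr lerDl.
apply: (le_trans (ler_wpM2l (expR_ge0 _) H)).
rewrite mulrCA -expRD (_ : - r * t + (r + sg) * t = sg * t); last by ring.
rewrite mulrAC ler_wpM2l//; first by rewrite mulr_ge0// expR_ge0.
by rewrite lef_pV2 ?posrE// lerDl.
Qed.

End ExpConv.

(** * Termwise convolution with the whole kernel *)

Section Kernel.
Context {R : realType}.
Variables (c gamma : nat -> R) (kap T : R).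
Hypothesis c_gt0 : forall k, 0 < c k.
Hypothesis gamma_gt0 : forall k, 0 < gamma k.
Hypothesis kap_cvg : series (fun k => c k / gamma k) n @[n --> \oo] --> kap.
Implicit Types x : R -> R.

(* The convolution K * x, taken termwise: Sum_k c_k may diverge, so that K(t)
   need not be bounded near t = 0. *)
Definition kconv x t : R := limn (series (fun k => c k * exp_conv (gamma k) x t)).

Let b k := c k / gamma k.

Lemma kap_ge n : series b n <= kap.
Proof.
have cb : cvgn (series b) by apply/cvg_ex; exists kap.
rewrite -(cvg_lim _ kap_cvg)//; apply: nondecreasing_cvgn_le => //.
by apply/nondecreasing_seqP => m; rewrite seriesSr lerDl divr_ge0// ltW.
Qed.

Lemma kap_ge0 : 0 <= kap.
Proof. by apply: le_trans (kap_ge 0); rewrite /series/= big_geq. Qed.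

Lemma kconvP x (M sg : R) t : 0 <= sg -> 0 <= M -> 0 <= t <= T ->
  bdd_meas T x -> (forall s, 0 < s < t -> `|x s| <= M * expR (sg * s)) ->
  series (fun k => c k * exp_conv (gamma k) x t) n @[n --> \oo] --> kconv x t /\
  forall n, `|kconv x t - series (fun k => c k * exp_conv (gamma k) x t) n| <=
    M * expR (sg * t) * (kap - series b n).
Proof.
move=> s0 M0 tT bx xM.
have [|s [sl sn]] := @majorized_series R (fun k => c k * exp_conv (gamma k) x t) b
  (M * expR (sg * t)) kap _ kap_cvg.
  move=> k; rewrite normrM gtr0_norm// /b mulrCA ler_pM2l//.
  exact: (exp_conv_le (gamma_gt0 k) s0 M0 tT bx xM).
have -> : kconv x t = s by exact: cvg_lim sl.
by [].
Qed.

Lemma kconv_cvg x t : 0 <= t <= T -> bdd_meas T x ->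
  series (fun k => c k * exp_conv (gamma k) x t) n @[n --> \oo] --> kconv x t.
Proof.
move=> tT bx; have [_ [M xM]] := bx.
have := @kconvP x `|M| 0 t (lexx _) (normr_ge0 _) tT bx.
move=> [|//] s /andP[s0 st]; rewrite mul0r expR0 mulr1 (le_trans _ (ler_norm _))// xM//.
by rewrite s0/=; case/andP: tT => _ /(lt_le_trans st).
Qed.

(** The remainder bound before the first term: convolution with [K] has norm at most [kap] for every
    weight [e^{sg t}]. *)
Lemma kconv_le x (M sg : R) t : 0 <= sg -> 0 <= M -> 0 <= t <= T ->
  bdd_meas T x -> (forall s, 0 < s < t -> `|x s| <= M * expR (sg * s)) ->
  `|kconv x t| <= kap * M * expR (sg * t).
Proof.
move=> s0 M0 tT bx xM.
have [_ /(_ 0%N)] := kconvP s0 M0 tT bx xM.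
by rewrite /series/= !big_geq// !subr0 => /le_trans; apply; rewrite mulrC mulrA.
Qed.

Lemma bdd_meas_kconv x : bdd_meas T x -> bdd_meas T (kconv x).
Proof.
move=> bx; split.
  apply: (@measurable_fun_cvg _ _ R `]0, T[ (fun n t => series (fun k => c k * exp_conv (gamma k) x t) n)).
    move=> n; have [] // := @bdd_meas_sum R T n (fun k t => c k * exp_conv (gamma k) x t).
    by move=> k; apply: bdd_measZ; exact: bdd_meas_exp_conv.
  move=> t /=; rewrite in_itv/= => /andP[t0 tT]; apply: kconv_cvg => //.
  by rewrite !ltW.
have [_ [M xM]] := bx; exists (kap * `|M|) => t /andP[t0 tT].
have := @kconv_le x `|M| 0 t (lexx _) (normr_ge0 _) _ bx; rewrite mul0r expR0 mulr1.
apply; first by rewrite !ltW.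
move=> s /andP[s0 st]; rewrite mul0r expR0 mulr1 (le_trans _ (ler_norm _))// xM//.
by rewrite s0/= (lt_trans st).
Qed.

Lemma kconvB x y t : 0 <= t <= T -> bdd_meas T x -> bdd_meas T y ->
  kconv (fun s => x s - y s) t = kconv x t - kconv y t.
Proof.
move=> tT bx by_; apply: cvg_lim => //.
rewrite (_ : series _ = (fun n => series (fun k => c k * exp_conv (gamma k) x t) n -
   series (fun k => c k * exp_conv (gamma k) y t) n)).
  by apply: cvgB; exact: kconv_cvg.
apply/funext => n; rewrite /series/= -sumrB; apply: eq_bigr => k _.
by rewrite (exp_convB _ _ bx by_) ?mulrBr//; case/andP: tT.
Qed.

Lemma eq_kconv x y t : (forall s, 0 < s < t -> x s = y s) -> kconv x t = kconv y t.
Proof.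
move=> xy; rewrite /kconv; congr (limn (series _)).
by apply/funext => k; rewrite (eq_exp_conv _ xy).
Qed.

End Kernel.

(** * The scalar integro-differential equation *)

Section ScalarEquation.
Context {R : realType}.
Variables (c gamma : nat -> R) (kap T : R).
Hypothesis c_gt0 : forall k, 0 < c k.
Hypothesis gamma_gt0 : forall k, 0 < gamma k.
Hypothesis kap_cvg : series (fun k => c k / gamma k) n @[n --> \oo] --> kap.
Hypothesis kap_lt1 : kap < 1.
Hypothesis T_gt0 : 0 < T.
Implicit Types x y g h : R -> R.

Let b k := c k / gamma k.
Let K := kconv c gamma.

Lemma eq_bdd_meas x y : (forall t, 0 < t < T -> x t = y t) -> bdd_meas T x -> bdd_meas T y.
Proof.
move=> xy [mx [M xM]]; split; last by exists M => t tT; rewrite -xy// xM.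
by apply: eq_measurable_fun mx => t; rewrite inE/= in_itv/=; exact: xy.
Qed.

Lemma L1_sum n (z : nat -> R -> R) :
  (forall i, L1 T (z i)) -> L1 T (fun t => \sum_(0 <= i < n) z i t).
Proof.
move=> zb; elim: n => [|n ih].
  rewrite (_ : (fun _ => _) = fun=> 0); first exact: L1_cst.
  by apply/funext => t; rewrite big_geq.
rewrite (_ : (fun _ => _) = fun t => \sum_(0 <= i < n) z i t + z n t); first exact: L1D.
by apply/funext => t; rewrite big_nat_recr.
Qed.

Lemma prim_sum n (z : nat -> R -> R) t : 0 <= t <= T ->
  (forall i, L1 T (z i)) -> prim (fun s => \sum_(0 <= i < n) z i s) t = \sum_(0 <= i < n) prim (z i) t.
Proof.
move=> /andP[t0 tT] zb; elim: n => [|n ih].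
  by rewrite big_geq//; transitivity (prim (fun=> 0 : R) t); [apply: eq_prim => s _; rewrite big_geq|rewrite prim_cst// mul0r].
rewrite big_nat_recr//= -ih -(primD tT)//; last exact: L1_sum.
by apply: eq_prim => s _; rewrite big_nat_recr.
Qed.

Lemma sqr_primE w0 (w h : R -> R) t : 0 <= t <= T -> L1 T h ->
  (forall s, 0 <= s <= T -> w s = w0 + prim h s) ->
  w t ^+ 2 = w0 ^+ 2 + prim (fun s => 2 * (w s * h s)) t.
Proof.
move=> /andP[t0 tT] ih wE; rewrite wE ?t0// expr2 (primM _ _ tT ih ih t0) -expr2; congr (_ + _).
apply: eq_prim => s /andP[s0 st]; rewrite (wE s); first by ring.
by rewrite (ltW s0)/= (le_trans (ltW st)).
Qed.

Lemma prim_expR_le h (C sg t : R) : 0 < sg -> 0 <= C -> 0 <= t <= T -> L1 T h ->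
  (forall s, 0 < s < t -> `|h s| <= C * expR (sg * s)) ->
  `|prim h t| <= C / sg * expR (sg * t).
Proof.
move=> s0 C0 /andP[t0 tT] ih hC; apply: (le_trans (prim_norm_le tT ih)).
have be := @bdd_meas_expRM R T sg.
apply: (@le_trans _ _ (prim (fun s => C / sg * (sg * expR (sg * s))) t)).
  apply: (le_prim tT); first exact: L1_abs.
    by apply: L1Z; apply: L1Z; exact: bdd_meas_L1.
  by move=> s st; rewrite mulrA divfK ?gt_eqF//; exact: hC.
rewrite (primZ _ tT); last by apply: L1Z; exact: bdd_meas_L1.
rewrite prim_expRM// ler_wpM2l//; first by rewrite divr_ge0// ltW.
by rewrite lerBlDr lerDl.
Qed.

Definition rhs (al be : R) g x t := g t - al ^+ 2 * x t + be * K x t.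

(* x'' = rhs with x(0) = p and x'(0) = q, in integrated form: y = x', h = x''. *)
Definition scalar_sol (al be p q : R) g x y h :=
  [/\ L1 T h, ae_on T (fun t => h t = rhs al be g x t),
      forall t, 0 <= t <= T -> x t = p + prim y t
    & forall t, 0 <= t <= T -> y t = q + prim h t].

(** With [D = q^2 + al^2 p^2], [Y] the supremum of [|y|] and [G] the integral of [|g|], the energy
    is at most [D + 2 Y G]. Absorbing [Y] gives [2 D + 4 G^2], and [G^2] is at most [T] times the
    integral of [g^2]. The factor [al^2] turns control of [al^2 x^2] into control of [al^4 x^2];
    [1 - kap] is the coefficient left in front of [al^2 x^2]. *)
Definition data_bound (al p q : R) g : R :=
  al ^+ 2 * (2 * q ^+ 2 + 2 * al ^+ 2 * p ^+ 2 + 4 * T * prim (fun s => g s ^+ 2) T) / (1 - kap).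

Lemma L1_rhs al be g x : L1 T g -> bdd_meas T x -> L1 T (rhs al be g x).
Proof.
move=> ig bx; apply: L1D; first by apply: L1B => //; apply: L1Z; exact: bdd_meas_L1.
by apply: L1Z; apply: bdd_meas_L1; exact: (bdd_meas_kconv _ _ kap_cvg).
Qed.

Lemma bdd_meas_prim2 (p q : R) h : L1 T h ->
  bdd_meas T (fun t => p + prim (fun s => q + prim h s) t).
Proof.
move=> ih; apply: bdd_measD; first exact: bdd_meas_cst.
apply: prim_bdd_meas; apply: bdd_meas_L1; apply: bdd_measD; first exact: bdd_meas_cst.
exact: prim_bdd_meas.
Qed.

Lemma scalar_sol_bdd al be p q g x y h : scalar_sol al be p q g x y h ->
  bdd_meas T x /\ bdd_meas T y.
Proof.
move=> [ih _ xE yE].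
have byy : bdd_meas T y.
  apply: (@eq_bdd_meas (fun t => q + prim h t)).
    by move=> t /andP[t0 tT]; rewrite yE// !ltW.
  by apply: bdd_measD; [exact: bdd_meas_cst|exact: prim_bdd_meas].
split=> //; apply: (@eq_bdd_meas (fun t => p + prim y t)).
  by move=> t /andP[t0 tT]; rewrite xE// !ltW.
by apply: bdd_measD; [exact: bdd_meas_cst|apply: prim_bdd_meas; exact: bdd_meas_L1].
Qed.

(** * Existence for the scalar equation by successive approximation *)

Section Picard.
Variables (al be p q : R) (g : R -> R).
Hypothesis be_ge0 : 0 <= be.
Hypothesis ig : L1 T g.

(** [N] is a Lipschitz constant of [rhs] in [x] for the weighted norm. Two integrations against
    [e^{sg s}] divide by [sg^2], and [sg = 1 + 2 N] makes [N / sg^2] at most [1 / 2]. *)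
Let N := al ^+ 2 + be * kap.
Let sg := 1 + 2 * N.
Let Phi x t := p + prim (fun s => q + prim (rhs al be g x) s) t.

Let N_ge0 : 0 <= N.
Proof. by rewrite addr_ge0// ?sqr_ge0// mulr_ge0// (kap_ge0 _ _ kap_cvg). Qed.

Let sg_gt0 : 0 < sg.
Proof. by rewrite ltr_pwDl// mulr_ge0. Qed.

(* Contraction for the weighted norm sup |x t| e^{- sg t}. *)
Lemma picard_contraction x x' (M : R) t : 0 <= M -> bdd_meas T x -> bdd_meas T x' ->
  (forall s, 0 < s < T -> `|x s - x' s| <= M * expR (sg * s)) -> 0 <= t <= T ->
  `|Phi x t - Phi x' t| <= M / 2 * expR (sg * t).
Proof.
move=> M0 bx bx' xM tT; have /andP[t0 tT'] := tT.
have ir := L1_rhs al be ig bx; have ir' := L1_rhs al be ig bx'.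
have ip z : L1 T z -> L1 T (fun s => q + prim z s).
  move=> iz; apply: bdd_meas_L1; apply: bdd_measD; first exact: bdd_meas_cst.
  exact: prim_bdd_meas.
rewrite /Phi opprD addrACA subrr add0r.
rewrite -(primB tT' (ip _ ir) (ip _ ir')).
have H s : 0 <= s <= T -> `|q + prim (rhs al be g x) s - (q + prim (rhs al be g x') s)| <=
    N * M / sg * expR (sg * s).
  move=> /andP[s0 sT].
  rewrite opprD addrACA subrr add0r.
  rewrite -(primB sT)//.
  apply: prim_expR_le => //; [exact: mulr_ge0|by rewrite s0|exact: L1B|].
  move=> r /andP[r0 rs].
  have rT : r < T := lt_le_trans rs sT.
  have r0T : 0 <= r <= T by rewrite !ltW.
  have -> : rhs al be g x r - rhs al be g x' r =
      - (al ^+ 2 * (x r - x' r)) + be * (K x r - K x' r).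
    by rewrite /rhs; ring.
  apply: (le_trans (ler_normD _ _)); rewrite normrN (normrM (al ^+ 2)) (normrM be) (ger0_norm be_ge0) (ger0_norm (sqr_ge0 _)).
  rewrite /N; have := sqr_ge0 al; move: (al ^+ 2) => A A0.
  rewrite mulrDl (mulrDl _ _ (expR _)) -!mulrA lerD//.
    by rewrite ler_wpM2l// xM// r0 rT.
  rewrite ler_wpM2l// /K -(kconvB c_gt0 gamma_gt0 kap_cvg r0T bx bx') mulrA.
  apply: (kconv_le c_gt0 gamma_gt0 kap_cvg (ltW sg_gt0) M0 r0T).
    by rewrite (_ : (fun _ => _) = (fun s => x s + (-1) * x' s));
      [apply: bdd_measD => //; exact: bdd_measZ|apply/funext => z; ring].
  by move=> z /andP[z0 zr]; apply: xM; rewrite z0 (lt_trans zr rT).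
apply: (@le_trans _ _ (N * M / sg / sg * expR (sg * t))).
  apply: prim_expR_le => //.
  - by rewrite divr_ge0// ?mulr_ge0// ltW.
  - by apply: L1B; exact: ip.
  - by move=> s /andP[s0 st]; apply: H; rewrite (ltW s0)/= (le_trans (ltW st) tT').
rewrite ler_wpM2r ?expR_ge0//.
rewrite -mulrA (mulrC N) -mulrA ler_wpM2l//.
rewrite -invfM ler_pdivrMr ?mulr_gt0//.
have -> : sg * sg = 1 + 4 * N + 4 * N ^+ 2 by rewrite /sg; ring.
by have := sqr_ge0 N; have := N_ge0; lra.
Qed.

Lemma scalar_sol_exists : exists x y h, scalar_sol al be p q g x y h.
Proof.
pose xs n := iter n Phi (fun=> 0).
have bxs n : bdd_meas T (xs n).
  elim: n => [|n ih]; first exact: bdd_meas_cst.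
  by rewrite /xs iterS; apply: bdd_meas_prim2; exact: L1_rhs.
have [_ [M0' M0b]] := bxs 1%N.
pose M0 : R := `|M0'|; have M00 : 0 <= M0 by exact: normr_ge0.
have dxs n t : 0 < t < T -> `|xs n.+1 t - xs n t| <= M0 * (1 / 2) ^+ n * expR (sg * t).
  elim: n t => [|n ih] t /andP[t0 tT].
    rewrite /= subr0 expr0 mulr1.
    apply: (@le_trans _ _ M0); first by rewrite (le_trans _ (ler_norm _))// M0b// t0.
    by rewrite ler_peMr ?normr_ge0// -expR0 ler_expR mulr_ge0// ltW.
  have := @picard_contraction (xs n.+1) (xs n) (M0 * (1 / 2) ^+ n) t _ (bxs _) (bxs _) ih.
  rewrite (_ : M0 * (1 / 2) ^+ n.+1 = M0 * (1 / 2) ^+ n / 2); last first.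
    by rewrite exprSr; set z := _ ^+ n; rewrite div1r mulrA.
  apply; last by rewrite !ltW.
  by rewrite mulr_ge0// exprn_ge0.
have half1 : `|1 / 2 : R| < 1 by rewrite ger0_norm; lra.
have cvb := @cvg_geometric_series R 1 (1 / 2) half1.
have lim t : 0 < t < T -> xs n t @[n --> \oo] --> limn (xs ^~ t) /\
    forall n, `|limn (xs ^~ t) - xs n t| <= 2 * M0 * (1 / 2) ^+ n * expR (sg * t).
  move=> tT.
  have [|s [sl sn]] := @majorized_series R (fun k => xs k.+1 t - xs k t) (geometric 1 (1 / 2))
     (M0 * expR (sg * t)) _ _ cvb.
    by move=> k; rewrite /= mul1r mulrAC; exact: dxs.
  have E n : series (fun k => xs k.+1 t - xs k t) n = xs n t.
    by rewrite /series/= telescope_sumr// subr0.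
  rewrite (_ : series _ = xs^~ t) in sl; last exact/funext.
  have -> : limn (xs ^~ t) = s by exact: cvg_lim sl.
  split=> // n; have := sn n; rewrite E => /le_trans; apply.
  rewrite geometric_seriesE; last by apply/eqP; lra.
  rewrite /= le_eqVlt; apply/orP; left; apply/eqP.
  by set z := _ ^+ n; field.
pose x t := limn (xs ^~ t).
have bx : bdd_meas T x.
  split.
    apply: (@measurable_fun_cvg _ _ R `]0, T[ xs) => [n|t /=]; first by have [] := bxs n.
    by rewrite in_itv/= => /lim[].
  exists (2 * M0 * expR (sg * T)) => t tT.
  have [_ /(_ 0%N)] := lim t tT; rewrite /xs/= subr0 expr0 mulr1 => /le_trans; apply.
  rewrite ler_wpM2l ?mulr_ge0// ler_expR ler_wpM2l// ltW//.
  by case/andP: tT.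
(* [Phi x] and [x] are both compared with the iterate [n + 1]: one half of the bound comes from the
   contraction, the other from the geometric tail. *)
have fix_x t : 0 < t < T -> Phi x t = x t.
  move=> tT; have /andP[t0 tT'] := tT.
  have H n : `|Phi x t - x t| <= 2 * M0 * expR (sg * t) * (1 / 2) ^+ n.
    have h1 : `|Phi x t - xs n.+1 t| <= 2 * M0 * (1 / 2) ^+ n / 2 * expR (sg * t).
      apply: picard_contraction => //.
      - by rewrite !mulr_ge0// exprn_ge0// divr_ge0.
      - by move=> s sT; have [_] := lim s sT; exact.
      - by rewrite !ltW.
    have [_ /(_ n.+1)] := lim t tT; rewrite -/(x t) distrC => h2.
    rewrite (_ : Phi x t - x t = (Phi x t - xs n.+1 t) + (xs n.+1 t - x t)); last by ring.
    apply: (le_trans (ler_normD _ _)); apply: (le_trans (lerD h1 h2)).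
    rewrite exprS le_eqVlt; apply/orP; left; apply/eqP.
    by set z := _ ^+ n; field.
  have c0 : 2 * M0 * expR (sg * t) * (1 / 2) ^+ n @[n --> \oo] --> (0 : R).
    exact: (cvg_geometric (2 * M0 * expR (sg * t)) half1).
  have : `|Phi x t - x t| <= 0 by apply: (cvgr_to_ge c0); exists 0%N => // n _; exact: H.
  by rewrite normr_le0 subr_eq0 => /eqP.
(* [Phi x] and not [x]: the limit is controlled on the open interval only, while [Phi x] is a
   primitive up to both endpoints. The right-hand side does not see the difference. *)
exists (Phi x), (fun s => q + prim (rhs al be g x) s), (rhs al be g x).
split=> //; first exact: L1_rhs.
apply: ae_onW => t tT; rewrite /rhs fix_x//; congr (_ + _ * _).
apply: eq_kconv => s /andP[s0 st]; rewrite fix_x// s0/=.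
by case/andP: tT => _; exact: lt_trans.
Qed.

End Picard.

(** * Energy estimate for the scalar equation *)

Section Energy.
Variables (al be p q : R) (g x y h : R -> R).
Hypothesis be_ge0 : 0 <= be.
Hypothesis be_le : be <= al ^+ 2.
Hypothesis ig : L1 T g.
Hypothesis sol : scalar_sol al be p q g x y h.

(* The energy y^2 + (al^2 - be kap) x^2 + be Sum_k (c_k/gamma_k) v_k^2 with
   v_k = x - gamma_k (e^{-gamma_k .} * x), truncated at k < N: since
   v_k' = y - gamma_k v_k, the memory terms only dissipate. *)
Lemma truncated_energy_le N t : 0 <= t <= T ->
  y t ^+ 2 + (al ^+ 2 - be * series b N) * x t ^+ 2 <=
  q ^+ 2 + al ^+ 2 * p ^+ 2 +
  2 * prim (fun s => y s * g s) t +
  2 * be * prim (fun s => y s * (K x s - series (fun k => c k * exp_conv (gamma k) x s) N)) t.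
Proof.
move=> tT; have /andP[t0 tT'] := tT.
have [ih hE xE yE] := sol.
have [bx byy] := scalar_sol_bdd sol.
have ix := bdd_meas_L1 bx; have iy := bdd_meas_L1 byy.
have bK := bdd_meas_kconv c_gt0 gamma_gt0 kap_cvg bx.
have bz k := bdd_meas_exp_conv (gamma k) bx.
pose v k s := x s - gamma k * exp_conv (gamma k) x s.
have bv k : bdd_meas T (v k).
  rewrite /v (_ : (fun _ => _) = (fun s => x s + (- gamma k) * exp_conv (gamma k) x s)).
    by apply: bdd_measD => //; exact: bdd_measZ.
  by apply/funext => s; ring.
have bv' k : bdd_meas T (fun s => y s - gamma k * v k s).
  rewrite (_ : (fun _ => _) = (fun s => y s + (- gamma k) * v k s)).
    by apply: bdd_measD => //; exact: bdd_measZ.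
  by apply/funext => s; ring.
have vE k s : 0 <= s <= T -> v k s = p + prim (fun r => y r - gamma k * v k r) s.
  move=> sT; have /andP[s0 sT'] := sT.
  rewrite (primB sT' iy); last by apply: L1Z; exact: bdd_meas_L1.
  rewrite (primZ _ sT'); last exact: bdd_meas_L1.
  by rewrite {1}/v (exp_conv_prim _ sT bx) (xE _ sT) addrA.
have Ey := sqr_primE tT ih yE.
have Ex := sqr_primE tT iy xE.
have Ev k := sqr_primE tT (bdd_meas_L1 (bv' k)) (vE k).
pose dv k s := b k * (2 * (v k s * (y s - gamma k * v k s))).
have bdv k : bdd_meas T (dv k).
  by apply: bdd_measZ; apply: bdd_measZ; apply: bdd_measM; [exact: bv|exact: bv'].
have b_ge0 k : 0 <= b k by rewrite divr_ge0// ltW.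
(* Every [v k] starts at [p], so at time 0 the memory part contributes [be * series b N * p ^+ 2],
   which restores the full [al ^+ 2 * p ^+ 2] in the initial energy. *)
have Es : \sum_(0 <= k < N) b k * v k t ^+ 2 =
    series b N * p ^+ 2 + prim (fun s => \sum_(0 <= k < N) dv k s) t.
  rewrite prim_sum//; last by move=> k; exact: bdd_meas_L1.
  rewrite /series/= mulr_suml -big_split/=; apply: eq_bigr => k _.
  rewrite Ev mulrDr; congr (_ + _).
  rewrite -(primZ _ tT')//; apply: bdd_meas_L1.
  by apply: bdd_measZ; apply: bdd_measM; [exact: bv|exact: bv'].
have hE' : prim (fun s => 2 * (y s * h s)) t = prim (fun s => 2 * (y s * rhs al be g x s)) t.
  apply: (prim_ae tT').
  - by apply: L1Z; exact: L1M.
  - by apply: L1Z; apply: L1M => //; exact: L1_rhs.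
  - by apply: ae_onS hE => s _ ->.
have S0 : 0 <= be * \sum_(0 <= k < N) b k * v k t ^+ 2.
  by rewrite mulr_ge0// sumr_ge0// => k _; rewrite mulr_ge0// sqr_ge0.
apply: (@le_trans _ _ (y t ^+ 2 + (al ^+ 2 - be * series b N) * x t ^+ 2 +
  be * \sum_(0 <= k < N) b k * v k t ^+ 2)); first by rewrite lerDl.
pose SN s := series (fun k => c k * exp_conv (gamma k) x s) N.
have bSN : bdd_meas T SN.
  by apply: (@bdd_meas_sum R T N (fun k s => c k * exp_conv (gamma k) x s)) => k; exact: bdd_measZ.
have bKS : bdd_meas T (fun s => K x s - SN s).
  rewrite (_ : (fun _ => _) = (fun s => K x s + (- 1) * SN s)).
    by apply: bdd_measD => //; exact: bdd_measZ.
  by apply/funext => s; ring.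
have ir : L1 T (rhs al be g x) by exact: L1_rhs.
have i1 : L1 T (fun s => 2 * (y s * rhs al be g x s)) by apply: L1Z; exact: L1M.
have i2 : L1 T (fun s => 2 * (x s * y s)) by apply: L1Z; exact: L1M.
have i3 : L1 T (fun s => \sum_(0 <= k < N) dv k s).
  by apply: bdd_meas_L1; exact: bdd_meas_sum.
have i4 : L1 T (fun s => y s * g s) by exact: L1M.
have i5 : L1 T (fun s => y s * (K x s - SN s)) by apply: bdd_meas_L1; exact: bdd_measM.
rewrite Ey hE' Ex Es.
(* Since [b k * gamma k = c k], the cross terms of the [v k] add up to a multiple of
   [series b N * x s - SN s]: the first part cancels the reduction of the potential term, the second
   turns [K x] into [K x - SN]. What remains between the two integrands is exactly
   [2 be Sum_k c_k v_k^2], which is nonnegative. *)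
have : prim (fun s => 2 * (y s * rhs al be g x s) +
      (al ^+ 2 - be * series b N) * (2 * (x s * y s)) + be * \sum_(0 <= k < N) dv k s) t <=
    prim (fun s => 2 * (y s * g s) + 2 * be * (y s * (K x s - SN s))) t.
  apply: (le_prim tT').
  - by apply: L1D; [apply: L1D => //|]; exact: L1Z.
  - by apply: L1D; exact: L1Z.
  move=> s _.
  have D0 : 0 <= be * \sum_(0 <= k < N) c k * v k s ^+ 2.
    by rewrite mulr_ge0// sumr_ge0// => k _; rewrite mulr_ge0 ?sqr_ge0// ltW.
  have -> : \sum_(0 <= k < N) dv k s = 2 * y s * (series b N * x s - SN s) -
      2 * \sum_(0 <= k < N) c k * v k s ^+ 2.
    rewrite /series /SN /series/= mulr_suml -sumrB !mulr_sumr -sumrB.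
    apply: eq_bigr => k _; rewrite /dv /v /b; field; exact: lt0r_neq0.
  rewrite /rhs -subr_ge0.
  move: D0; set D := \sum_(0 <= k < N) _ => D0.
  rewrite (_ : _ - _ = 2 * (be * D)); first by rewrite mulr_ge0.
  by ring.
rewrite (primD tT' (L1D i1 (L1Z _ i2)) (L1Z _ i3)) (primD tT' i1 (L1Z _ i2)).
rewrite (primZ _ tT' i2) (primZ _ tT' i3) (primD tT' (L1Z _ i4) (L1Z _ i5)).
rewrite (primZ _ tT' i4) (primZ _ tT' i5) -/SN.
set P1 := prim _ t; set P2 := prim _ t; set P3 := prim _ t; set P4 := prim _ t; set P5 := prim _ t.
set kN := series b N; set A := al ^+ 2; set Q := q ^+ 2; set P := p ^+ 2.
by move=> H; nra.
Qed.

(** Limit of the truncated inequality: the remainder of the kernel series tends to 0 pointwise and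
    is dominated by a bound of [x] times [kap], so its pairing with [y] disappears. *)
Lemma energy_le t : 0 <= t <= T ->
  y t ^+ 2 + (1 - kap) * al ^+ 2 * x t ^+ 2 <=
  q ^+ 2 + al ^+ 2 * p ^+ 2 + 2 * prim (fun s => y s * g s) t.
Proof.
move=> tT; have /andP[t0 tT'] := tT.
have [bx byy] := scalar_sol_bdd sol.
have bK := bdd_meas_kconv c_gt0 gamma_gt0 kap_cvg bx.
have bS N : bdd_meas T (fun s => series (fun k => c k * exp_conv (gamma k) x s) N).
  apply: (@bdd_meas_sum R T N (fun k s => c k * exp_conv (gamma k) x s)) => k.
  by apply: bdd_measZ; exact: bdd_meas_exp_conv.
have [_ [M xM]] := bx; have [_ [My yM]] := byy.
pose r_ N := prim (fun s => y s * (K x s - series (fun k => c k * exp_conv (gamma k) x s) N)) t.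
have r0 : r_ N @[N --> \oo] --> (0 : R).
  have -> : (0 : R) = prim (fun=> 0) t by rewrite prim_cst// mul0r.
  apply: (@prim_cvg R T (fun N s => y s * (K x s - series (fun k => c k * exp_conv (gamma k) x s) N))
    (fun=> 0) (fun=> `|My| * (`|M| * kap)) t tT').
  - move=> N; apply: L1M => //; apply: L1B; exact: bdd_meas_L1.
  - exact: measurable_cst.
  - exact: L1_cst.
  - move=> s /andP[s0 st].
    have sT : 0 <= s <= T by rewrite !ltW//= (lt_le_trans st).
    rewrite -(mulr0 (y s)); apply: cvgMl_tmp; rewrite -(subrr (K x s)).
    apply: cvgB; first exact: cvg_cst.
    exact: (kconv_cvg c_gt0 gamma_gt0 kap_cvg sT bx).
  - move=> N s /andP[s0 st].
    have sT : 0 < s < T by rewrite s0/= (lt_le_trans st).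
    have sT' : 0 <= s <= T by case/andP: sT => *; rewrite !ltW.
    rewrite normrM ler_pM//; first by rewrite (le_trans _ (ler_norm _))// yM.
    have [|_ /(_ N) H] := kconvP c_gt0 gamma_gt0 kap_cvg (lexx 0) (normr_ge0 M) sT' bx.
      move=> z /andP[z0 zs]; rewrite mul0r expR0 mulr1 (le_trans _ (ler_norm _))// xM//.
      by rewrite z0/=; case/andP: sT => _; exact: lt_trans.
    rewrite mul0r expR0 mulr1 in H; apply: (le_trans H); rewrite ler_wpM2l//.
    by rewrite gerBl sumr_ge0// => k _; rewrite divr_ge0// ltW.
have c1 : (1 - kap) * al ^+ 2 * x t ^+ 2 + y t ^+ 2 @[N --> \oo] -->
    (1 - kap) * al ^+ 2 * x t ^+ 2 + y t ^+ 2 by exact: cvg_cst.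
have c2 : q ^+ 2 + al ^+ 2 * p ^+ 2 + 2 * prim (fun s => y s * g s) t + 2 * be * r_ N @[N --> \oo] -->
    q ^+ 2 + al ^+ 2 * p ^+ 2 + 2 * prim (fun s => y s * g s) t + 2 * be * 0.
  by apply: cvgD; [exact: cvg_cst|exact: cvgMl_tmp].
rewrite mulr0 addr0 in c2.
rewrite addrC; apply: (ler_cvg_to c1 c2); exists 0%N => // N _.
apply: (le_trans _ (truncated_energy_le N tT)).
rewrite addrC lerD2l ler_wpM2r ?sqr_ge0//.
have := kap_ge c_gt0 gamma_gt0 kap_cvg N; have := kap_ge0 c_gt0 gamma_gt0 kap_cvg.
rewrite -/b; have := sqr_ge0 al; move: be_ge0 be_le.
set A := al ^+ 2; set kN := series b N => h1 h2 h3 h4 h5.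
(* Here [be <= al ^+ 2] enters: the memory uses up at most the fraction [kap] of the potential
   energy. *)
have : be * kN <= A * kap by rewrite ler_pM// sumr_ge0// => k _; rewrite divr_ge0// ltW.
lra.
Qed.

(** The energy controls [y^2] but is bounded by a term linear in [Y = sup |y|], so
    [Y^2 <= D + 2 Y G] closes on itself. No exponential in [T] appears, as there would be with a
    Gronwall argument. *)
Lemma scalar_sol_bound t : 1 <= al -> 0 <= t <= T -> L1 T (fun s => g s ^+ 2) ->
  al ^+ 4 * x t ^+ 2 <= data_bound al p q g /\ y t ^+ 2 <= data_bound al p q g.
Proof.
move=> al1 tT ig2; set B := data_bound al p q g.
have [bx byy] := scalar_sol_bdd sol.
have iag := L1_abs ig.
have ih := let: And4 a _ _ _ := sol in a.
have yE := let: And4 _ _ _ a := sol in a.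
have T0 := ltW T_gt0.
set G := prim (fun s => `|g s|) T.
have G0 : 0 <= G by exact: prim_ge0.
have G2 : G ^+ 2 <= T * prim (fun s => g s ^+ 2) T by exact: (prim_CS T0 (lexx T)).
set D := q ^+ 2 + al ^+ 2 * p ^+ 2.
have D0 : 0 <= D by rewrite addr_ge0 ?sqr_ge0// mulr_ge0 ?sqr_ge0.
pose S := [set r | exists2 s, 0 <= s <= T & r = `|y s|].
have Sub : has_sup S.
  split; first by exists `|y 0|, 0 => //; rewrite lexx.
  exists (`|q| + prim (fun s => `|h s|) T) => _ [s sT ->]; have /andP[s0 sT'] := sT.
  rewrite yE// (le_trans (ler_normD _ _))// lerD2l.
  apply: (le_trans (prim_norm_le sT' ih)); apply: (prim_homo s0 sT' (lexx T)) => //; exact: L1_abs.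
pose Y := sup S.
have yY s : 0 <= s <= T -> `|y s| <= Y.
  by move=> sT; apply: (sup_upper_bound Sub); exists s.
have Y0 : 0 <= Y by apply: (le_trans (normr_ge0 (y 0))); apply: yY; rewrite lexx.
have main s : 0 <= s <= T -> y s ^+ 2 + (1 - kap) * al ^+ 2 * x s ^+ 2 <= D + 2 * Y * G.
  move=> sT; have /andP[s0 sT'] := sT.
  apply: (le_trans (energy_le sT)); rewrite lerD2l -mulrA ler_wpM2l//.
  apply: (@le_trans _ _ (prim (fun r => Y * `|g r|) s)).
    apply: (le_prim sT'); [exact: L1M|exact: L1Z|].
    move=> r /andP[r0 rs]; rewrite (le_trans (ler_norm _))// normrM ler_wpM2r//.
    by apply: yY; rewrite (ltW r0)/= (le_trans (ltW rs)).
  rewrite (primZ _ sT' iag) ler_wpM2l//.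
  by apply: (prim_homo s0 sT' (lexx T)).
have kx s : 0 <= (1 - kap) * al ^+ 2 * x s ^+ 2.
  by apply: mulr_ge0; [apply: mulr_ge0; [rewrite subr_ge0 ltW|exact: sqr_ge0]|exact: sqr_ge0].
have Y2 : Y ^+ 2 <= D + 2 * Y * G.
  have DG : 0 <= D + 2 * Y * G by rewrite addr_ge0// !mulr_ge0.
  rewrite -(sqr_sqrtr DG) ler_pXn2r ?nnegrE ?sqrtr_ge0//.
  apply: (sup_le_ub (proj1 Sub)) => _ [s sT ->].
  rewrite -(ler_pXn2r (n := 2)) ?nnegrE ?sqrtr_ge0// sqr_sqrtr// real_normK ?num_real//.
  by apply: le_trans (main s sT); rewrite lerDl.
(* By [2 Y G <= Y^2 / 2 + 2 G^2] and [Y2]. *)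
have Y2' : D + 2 * Y * G <= 2 * D + 4 * G ^+ 2.
  by have := sqr_ge0 (Y / 2 - G); have := sqr_ge0 (Y - 2 * G); nra.
have key := le_trans (main t tT) Y2'.
have k1 : 0 < 1 - kap by rewrite subr_gt0.
have al2 : 1 <= al ^+ 2 by rewrite -[1](expr1n _ 2) ler_pXn2r ?nnegrE// (le_trans ler01).
have E0 : 2 * D + 4 * G ^+ 2 <= 2 * q ^+ 2 + 2 * al ^+ 2 * p ^+ 2 + 4 * T * prim (fun s => g s ^+ 2) T.
  by rewrite /D; nra.
have key2 := le_trans key E0.
rewrite /B /data_bound; move: key2 (sqr_ge0 (y t)) (kx t) al2; rewrite -/D.
set E := 2 * q ^+ 2 + _ + _ => key2 y2 x2 al2.
have E00 : 0 <= E by apply: le_trans key2; rewrite addr_ge0.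
have kap0 := kap_ge0 c_gt0 gamma_gt0 kap_cvg.
split; rewrite ler_pdivlMr//.
- rewrite (_ : _ * (1 - kap) = al ^+ 2 * ((1 - kap) * al ^+ 2 * x t ^+ 2)); last by ring.
  by rewrite ler_wpM2l ?sqr_ge0//; apply: le_trans key2; rewrite lerDr.
- apply: (@le_trans _ _ (1 * E)); last by rewrite ler_wpM2r.
  rewrite mul1r; apply: le_trans key2.
  apply: (@le_trans _ _ (y t ^+ 2)); last by rewrite lerDl.
  by rewrite ler_piMr//; lra.
Qed.

End Energy.
(** Both [al^2 x] and [be (K * x)] are at most [sqrt B] in absolute value, the second because
    [be <= al^2] and [kap < 1]. Then [(s + 2 b)^2 <= 2 s^2 + 8 b^2]. *)
Lemma scalar_rhs_bound (al be p q : R) g x y h (t : R) : 0 <= be -> be <= al ^+ 2 -> L1 T g ->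
  scalar_sol al be p q g x y h ->
  1 <= al -> 0 <= t <= T -> L1 T (fun s => g s ^+ 2) ->
  rhs al be g x t ^+ 2 <= 2 * g t ^+ 2 + 8 * data_bound al p q g.
Proof.
move=> be0 beal ig sol al1 tT ig2; set B := data_bound al p q g.
have [bx byy] := scalar_sol_bdd sol.
have xB s : 0 <= s <= T -> al ^+ 4 * x s ^+ 2 <= B.
  by move=> sT; have [] := scalar_sol_bound be0 beal ig sol al1 sT ig2.
have B0 : 0 <= B.
  apply: le_trans (xB t tT); apply: mulr_ge0; last exact: sqr_ge0.
  by rewrite exprn_ge0// (le_trans ler01).
have al2 : 0 < al ^+ 2 by rewrite exprn_gt0// (lt_le_trans ltr01).
pose M := Num.sqrt B / al ^+ 2.
have M0 : 0 <= M by rewrite divr_ge0 ?sqrtr_ge0// ltW.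
have xM s : 0 <= s <= T -> `|x s| <= M.
  move=> sT; rewrite /M ler_pdivlMr// -(ler_pXn2r (n := 2)) ?nnegrE ?sqrtr_ge0//; last first.
    by rewrite mulr_ge0// ltW.
  rewrite sqr_sqrtr// exprMn real_normK ?num_real// mulrC -exprM; exact: xB.
have KM : `|K x t| <= kap * M.
  have := @kconv_le R c gamma kap T c_gt0 gamma_gt0 kap_cvg x M 0 t (lexx 0) M0 tT bx.
  rewrite mul0r expR0 mulr1; apply => s /andP[s0 st].
  rewrite mul0r expR0 mulr1; apply: xM; rewrite (ltW s0)/=.
  by case/andP: tT => _; apply: le_trans; exact: ltW.
have kap0 := kap_ge0 c_gt0 gamma_gt0 kap_cvg.
have E1 : `|rhs al be g x t| <= `|g t| + 2 * Num.sqrt B.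
  rewrite /rhs (le_trans (ler_normD _ _))//.
  have h1 := ler_normB (g t) (al ^+ 2 * x t).
  have h2 : `|al ^+ 2 * x t| <= Num.sqrt B.
    by rewrite normrM (gtr0_norm al2) mulrC -ler_pdivlMr//; exact: xM.
  have h3 : `|be * K x t| <= Num.sqrt B.
    rewrite normrM (ger0_norm be0); apply: (@le_trans _ _ (al ^+ 2 * (1 * M))).
      apply: ler_pM => //; apply: (le_trans KM); rewrite ler_wpM2r// ltW//.
    by rewrite mul1r /M mulrCA divff ?mulr1// gt_eqF.
  lra.
have s0 := sqrtr_ge0 B; have sB := sqr_sqrtr B0.
have gE := real_normK (num_real (g t)); have rE := real_normK (num_real (rhs al be g x t)).
rewrite -rE -gE -sB.
apply: (@le_trans _ _ ((`|g t| + 2 * Num.sqrt B) ^+ 2)).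
  by rewrite ler_pXn2r ?nnegrE ?addr_ge0 ?mulr_ge0.
rewrite -subr_ge0 (_ : _ - _ = (`|g t| - 2 * Num.sqrt B) ^+ 2); first exact: sqr_ge0.
by ring.
Qed.

(** By linearity the difference of two solutions has zero data and zero source, hence zero energy,
    and [kap < 1] makes the potential part of the energy definite. *)
Lemma scalar_sol_unique (al be p q : R) g x y h x' y' h' : 0 <= be -> be <= al ^+ 2 -> 0 < al ->
  L1 T g -> scalar_sol al be p q g x y h -> scalar_sol al be p q g x' y' h' ->
  forall t, 0 <= t <= T -> x t = x' t.
Proof.
move=> be0 beal al0 ig s1 s2 t tT.
have [bx byy] := scalar_sol_bdd s1; have [bx' byy'] := scalar_sol_bdd s2.
have [ih hE xE yE] := s1; have [ih' hE' xE' yE'] := s2.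
have ig0 : L1 T (fun=> 0 : R) by exact: L1_cst.
have s : scalar_sol al be 0 0 (fun=> 0) (fun s => x s - x' s) (fun s => y s - y' s)
    (fun s => h s - h' s).
  split.
  - exact: L1B.
  - apply: ae_onS2 hE hE' => s /andP[s0 sT] -> ->; rewrite /rhs.
    rewrite /K (kconvB c_gt0 gamma_gt0 kap_cvg _ bx bx'); first by ring.
    by rewrite !ltW.
  - move=> s sT; have /andP[s0 sT'] := sT.
    rewrite xE// xE'// (primB sT' (bdd_meas_L1 byy) (bdd_meas_L1 byy')).
    by rewrite opprD addrACA subrr.
  - move=> s sT; have /andP[s0 sT'] := sT.
    by rewrite yE// yE'// (primB sT' ih ih') opprD addrACA subrr.
have := energy_le be0 beal ig0 s tT.
rewrite expr0n/= mulr0 !add0r (_ : prim _ t = 0); last first.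
  transitivity (prim (fun=> 0 : R) t); first by apply: eq_prim => r _; rewrite mulr0.
  by rewrite prim_cst ?mul0r//; case/andP: tT.
rewrite mulr0 => H.
have k1 : 0 < (1 - kap) * al ^+ 2 by rewrite mulr_gt0 ?subr_gt0// exprn_gt0.
have : (1 - kap) * al ^+ 2 * (x t - x' t) ^+ 2 <= 0.
  by apply: le_trans H; rewrite lerDr sqr_ge0.
rewrite pmulr_rle0// => H2; apply/eqP; rewrite -subr_eq0 -sqrf_eq0; apply/eqP.
by apply/le_anti; rewrite H2 sqr_ge0.
Qed.

End ScalarEquation.

(** * Test functions and the du Bois-Reymond lemma *)

Section Smooth.
Context {R : realType}.
Implicit Types f g : R -> R.

(** Successive derivatives are given as witnesses: in this form closure under sums, products and
    affine changes is a plain induction, and [smoothP] links it to the iterated [derive1n]. *)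
Fixpoint Ck (n : nat) f : Prop :=
  if n is m.+1 then
    exists f' : R -> R, (forall x : R, is_derive x (1 : R) f (f' x)) /\ Ck m f'
  else True.

Lemma CkS n f : Ck n.+1 f -> Ck n f.
Proof.
elim: n f => // n ih f [f' [df cf']]; exists f'; split=> //; exact: ih.
Qed.

Lemma CkD n f g : Ck n f -> Ck n g -> Ck n (fun x => f x + g x).
Proof.
elim: n f g => // n ih f g [f' [df cf']] [g' [dg cg']].
exists (fun x => f' x + g' x); split; last exact: ih.
by move=> x; apply: is_deriveD.
Qed.

Lemma CkZ n (a : R) f : Ck n f -> Ck n (fun x => a * f x).
Proof.
elim: n f => // n ih f [f' [df cf']].
exists (fun x => a * f' x); split; last exact: ih.
by move=> x; apply: (@is_deriveZ R R^o R^o f a x 1 (f' x)).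
Qed.

Lemma CkM n f g : Ck n f -> Ck n g -> Ck n (fun x => f x * g x).
Proof.
elim: n f g => // n ih f g cf cg.
have := CkS cf; have := CkS cg; move: cf cg => [f' [df cf']] [g' [dg cg']] cg cf.
exists (fun x => f x * g' x + g x * f' x); split; last by apply: CkD; exact: ih.
by move=> x; apply: (@is_deriveM R R^o f g x 1 (f' x) (g' x)).
Qed.

Lemma is_derive_affine (a b x : R) : is_derive x (1 : R) (fun t : R => a * t + b) a.
Proof.
rewrite -[X in is_derive _ _ _ X]addr0; apply: is_deriveD.
have := @is_deriveZ R R^o R^o id a x 1 1 (is_derive_id x 1).
by rewrite /GRing.scale/= mulr1.
Qed.

Lemma Ck_affine n (a b : R) f : Ck n f -> Ck n (fun x => f (a * x + b)).
Proof.
elim: n f => // n ih f [f' [df cf']].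
exists (fun x => a * f' (a * x + b)); split; last by apply: CkZ; exact: ih.
move=> x; rewrite mulrC.
exact: (@is_derive1_comp R f (fun t => a * t + b) x _ _ (df _) (is_derive_affine _ _ _)).
Qed.

Definition smooth f : Prop := forall n, Ck n f.

Lemma smoothP f : smooth f <->
  forall n (t : R), derivable (derive1n n f) t 1.
Proof.
split=> [sf n|df].
  elim: n f sf => [|n ih] f sf t.
    by have [f' [df _]] := sf 1%N; case: (df t).
  rewrite derive1Sn; apply: ih => m.
  have [f' [df cf']] := sf m.+1.
  have -> : f^`()%classic = f' by apply/funext => x; rewrite derive1E; case: (df x).
  exact: cf'.
suff H n : (forall m (t : R), derivable (derive1n m f) t 1) -> Ck n f by move=> n; exact: H.
elim: n f {df} => // n ih f df.
exists (f^`())%classic; split; last first.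
  by apply: ih => m t; rewrite -derive1Sn; exact: df.
by move=> x; rewrite derive1E; apply: derivableP; exact: (df 0%N).
Qed.

Lemma smooth_derive f : smooth f -> smooth (f^`())%classic.
Proof. by move=> /smoothP df; apply/smoothP => n t; rewrite -derive1Sn; exact: df. Qed.

Lemma smooth_is_derive f (x : R) : smooth f -> is_derive x (1 : R) f ((f^`())%classic x).
Proof. by move=> /smoothP /(_ 0%N x) df; rewrite derive1E; apply: derivableP. Qed.

Lemma smooth_continuous f : smooth f -> continuous f.
Proof.
move=> sf x; apply/differentiable_continuous/derivable1_diffP.
by have [] := smooth_is_derive x sf.
Qed.

End Smooth.

(** * Smooth bumps *)

Section Bump.
Context {R : realType}.

(* t^-k e^(-1/t) for t > 0: a family closed under differentiation, up to
   linear combinations. *)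
Definition flat (k : nat) (t : R) : R :=
  if 0 < t then t^-1 ^+ k * expR (- t^-1) else 0.

Lemma flat_ge0 k t : 0 <= flat k t.
Proof.
by rewrite /flat; case: ifP => // t0; rewrite mulr_ge0 ?expR_ge0// exprn_ge0// invr_ge0 ltW.
Qed.

(** With [u = 1 / t], the exponential series gives [u^(k+2) <= (k+2)! e^u]. The quadratic order at 0
    is what makes the derivative vanish there. *)
Lemma flat_le k t : flat k t <= (k.+2`!)%:R * t ^+ 2.
Proof.
rewrite /flat; case: ifPn => [t0|_]; last by rewrite mulr_ge0// sqr_ge0.
have u0 : 0 < t^-1 by rewrite invr_gt0.
have H := expR_ge1Dxn k.+1 (ltW u0).
have tE : t = (t^-1)^-1 by rewrite invrK.
rewrite [X in X ^+ 2]tE; move: (t^-1) u0 H => u u0 H.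
rewrite expRN ler_pdivrMr ?expR_gt0// exprVn mulrAC.
rewrite ler_pdivlMr ?exprn_gt0// -exprD addn2.
have f0 : 0 < (k.+2`!)%:R :> R by rewrite ltr0n fact_gt0.
by rewrite mulrC -ler_pdivrMr// (le_trans _ H)// lerDr.
Qed.

Lemma is_derive_quadratic (f : R -> R) (C : R) :
  (forall t, `|f t| <= C * t ^+ 2) -> is_derive (0 : R) (1 : R) f 0.
Proof.
move=> fC.
have f0 : f 0 = 0.
  by have := fC 0; rewrite expr0n/= mulr0 normr_le0 => /eqP.
have H : (fun h : R => h^-1 *: ((f \o shift (0 : R)) (h *: (1 : R)) - f 0)) @ 0^' --> (0 : R).
  apply: (@cvg_to_0_linear _ _ C 1) => // r /andP[r0 _].
  rewrite /= f0 subr0 addr0 /GRing.scale/= mulr1 normrM normfV ler_pdivrMl//.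
  by apply: (le_trans (fC r)); rewrite -[r ^+ 2]real_normK ?num_real// expr2 mulrCA mulrA.
apply: DeriveDef; first by apply/cvg_ex; exists 0.
exact: cvg_lim H.
Qed.

Lemma is_derive_flat k (t : R) :
  is_derive t (1 : R) (flat k) (- k%:R * flat k.+1 t + flat k.+2 t).
Proof.
have [t0|t0|->] := ltgtP t 0.
- rewrite {2 3}/flat (lt_gtF t0) mulr0 addr0.
  have d0 : is_derive t (1 : R) (cst (0 : R) : R -> R) (0 : R) by exact: is_derive_cst.
  apply: (near_eq_is_derive _ d0).
  by near=> s; rewrite /flat ifF//; apply/lt_gtF; near: s; exact: lt_nbhsl.
- rewrite {2 3}/flat t0.
  suff H : is_derive t (1 : R) (fun t : R => t^-1 ^+ k * expR (- t^-1))
      (- k%:R * (t^-1 ^+ k.+1 * expR (- t^-1)) + t^-1 ^+ k.+2 * expR (- t^-1)).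
    apply: (near_eq_is_derive _ H).
    by near=> s; rewrite /flat ifT//; near: s; exact: lt_nbhsr.
  have dV : is_derive t (1 : R) (fun s : R => s^-1) (- t ^- 2).
    have := @is_deriveV R id t 1 1 (lt0r_neq0 t0) (is_derive_id t 1).
    by rewrite /GRing.scale/= mulr1.
  have dN : is_derive t (1 : R) (fun s : R => - s^-1) (t ^- 2).
    by have := is_deriveN dV; rewrite opprK.
  have dE := @is_derive1_comp R expR (fun s => - s^-1) t _ _ (is_derive_expR (- t^-1)) dN.
  have dX := @is_deriveX R R^o (fun s : R => s^-1) k t 1 _ dV.
  have pE (n : nat) (s : R) : (GRing.exp (fun s : R => s^-1) n : R -> R) s = s^-1 ^+ n.
    by elim: n => [|n ih]; rewrite ?expr0// !exprS -ih.
  have := is_deriveM dX dE; rewrite pE /GRing.scale/=.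
  rewrite (_ : _ * _ = (fun s : R => s^-1 ^+ k * expR (- s^-1))); last first.
    by apply/funext => s; rewrite -pE.
  rewrite [X in is_derive _ _ _ X -> _](_ : _ =
     (- k%:R * (t^-1 ^+ k.+1 * expR (- t^-1)) + t^-1 ^+ k.+2 * expR (- t^-1)))//.
  rewrite -exprVn; set E := expR _; set u := t^-1.
  case: k {dX} => [|k].
    by rewrite expr0 !mul0r oppr0 mul0r add0r; ring.
  by rewrite /= !exprS; ring.
- apply: is_derive_eq; first apply: (@is_derive_quadratic _ (k.+2`!)%:R).
    by move=> s; rewrite ger0_norm ?flat_ge0//; exact: flat_le.
  by rewrite /flat ltxx mulr0 addr0.
Unshelve. all: by end_near. Qed.

Lemma smooth_flat k : smooth (flat k).
Proof.
move=> n; elim: n k => // n ih k.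
exists (fun t => - k%:R * flat k.+1 t + flat k.+2 t); split; first exact: is_derive_flat.
by apply: CkD => //; exact: CkZ.
Qed.

(** Positive exactly on []a, b[], with values in [[0, 1]]. Dilating the profile by [j + 1] drives it
    to the indicator of []a, b[] without moving the support. *)
Definition bump (j : nat) (a b t : R) : R :=
  flat 0 (j.+1%:R * (t - a)) * flat 0 (j.+1%:R * (b - t)).

Lemma smooth_bump j a b : smooth (bump j a b).
Proof.
move=> n; apply: CkM.
  rewrite (_ : (fun _ => _) = (fun t => flat 0 (j.+1%:R * t + - j.+1%:R * a))).
    by apply: (@Ck_affine _ n _ _ (flat 0)); exact: smooth_flat.
  by apply/funext => t; rewrite mulrBr mulNr.
rewrite (_ : (fun _ => _) = (fun t => flat 0 (- j.+1%:R * t + j.+1%:R * b))).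
  by apply: (@Ck_affine _ n _ _ (flat 0)); exact: smooth_flat.
by apply/funext => t; rewrite mulrBr mulNr addrC.
Qed.

Lemma flat0_le1 t : flat 0 t <= 1.
Proof.
rewrite /flat; case: ifPn => // t0; rewrite expr0 mul1r -expR0 ler_expR oppr_le0 invr_ge0.
exact: ltW.
Qed.

Lemma bump_ge0 j a b t : 0 <= bump j a b t.
Proof. by rewrite mulr_ge0// flat_ge0. Qed.

Lemma bump_le1 j a b t : bump j a b t <= 1.
Proof. by rewrite -[leRHS]mulr1 ler_pM ?flat_ge0 ?flat0_le1. Qed.

Lemma bump_out j a b t : ~~ (a < t < b) -> bump j a b t = 0.
Proof.
rewrite /bump /flat !pmulr_rgt0// !subr_gt0.
by case: (a < t) => /=; [case: (t < b) => //|]; rewrite ?mulr0 ?mul0r.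
Qed.

Lemma bump_gt0 j a b t : a < t < b -> 0 < bump j a b t.
Proof.
move=> /andP[at_ tb]; rewrite /bump; apply: mulr_gt0.
  by rewrite /flat pmulr_rgt0// subr_gt0 at_ expr0 mul1r expR_gt0.
by rewrite /flat pmulr_rgt0// subr_gt0 tb expr0 mul1r expR_gt0.
Qed.

Lemma flat0_cvg (s : R) : 0 < s -> flat 0 (j.+1%:R * s) @[j --> \oo] --> (1 : R).
Proof.
move=> s0.
have -> : (fun j : nat => flat 0 (j.+1%:R * s)) = (fun j => expR (- (s^-1 * harmonic j))).
  apply/funext => j; rewrite /flat pmulr_rgt0// s0 expr0 mul1r.
  by rewrite /harmonic/= -invfM mulrC.
rewrite -expR0 -oppr0 -(mulr0 s^-1).
apply: continuous_cvg; first exact: continuous_expR.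
by apply: cvgN; apply: cvgMl_tmp; exact: cvg_harmonic.
Qed.

Lemma bump_cvg a b t : bump j a b t @[j --> \oo] --> ((\1_(`]a, b[%classic) t) : R).
Proof.
rewrite indicE; case: (boolP (t \in _)) => [|tab].
  rewrite inE/= in_itv/= => /andP[at_ tb].
  by rewrite -[X in _ --> X](mulr1 (1 : R)); apply: cvgM; apply: flat0_cvg; rewrite subr_gt0.
rewrite (_ : (fun j => bump j a b t) = fun=> 0); first exact: cvg_cst.
apply/funext => j; apply: bump_out; apply: contra tab => tab.
by rewrite inE/= in_itv.
Qed.

End Bump.

Section TestFunctions.
Context {R : realType}.
Variable T : R.
Hypothesis T_gt0 : 0 < T.
Notation mu := (@lebesgue_measure R).
Implicit Types phi chi r : R -> R.

Lemma test_smooth phi : test_function T phi -> smooth phi.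
Proof. by move=> [/smoothP]. Qed.

Lemma test_bump j (a b : R) : 0 < a -> b < T -> test_function T (bump j a b).
Proof.
move=> a0 bT; split; first exact/smoothP/smooth_bump.
exists a, b; split=> // t tab; apply: bump_out; apply: contra tab => /andP[? ?].
by rewrite !ltW.
Qed.

Lemma testD phi chi : test_function T phi -> test_function T chi ->
  test_function T (fun t => phi t + chi t).
Proof.
move=> [/smoothP s1 [a [b [a0 bT ab]]]] [/smoothP s2 [a' [b' [a0' bT' ab']]]].
split; first by apply/smoothP => n; exact: CkD.
exists (Num.min a a'), (Num.max b b'); split.
- by rewrite lt_min a0.
- by rewrite gt_max bT.
move=> t; rewrite ge_min le_max => H; rewrite ab ?ab' ?addr0//;
  by apply: contra H => /andP[-> ->]; rewrite ?orbT.
Qed.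

Lemma testZ (c : R) phi : test_function T phi -> test_function T (fun t => c * phi t).
Proof.
move=> [/smoothP s1 [a [b [a0 bT ab]]]].
split; first by apply/smoothP => n; exact: CkZ.
by exists a, b; split=> // t /ab ->; rewrite mulr0.
Qed.

Lemma test_derive phi : test_function T phi -> test_function T (phi^`())%classic.
Proof.
move=> [/smoothP s1 [a [b [a0 bT ab]]]].
split; first exact/smoothP/smooth_derive.
exists a, b; split=> // t tab; rewrite derive1E.
rewrite (@near_eq_derive _ _ _ _ (cst (0 : R))) ?derive_cst//.
move: tab; rewrite negb_and -!ltNge => /orP[ta|bt].
  by near=> s; apply: ab; rewrite negb_and -!ltNge; apply/orP; left; near: s; exact: lt_nbhsl.
by near=> s; apply: ab; rewrite negb_and -!ltNge; apply/orP; right; near: s; exact: lt_nbhsr.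
Unshelve. all: by end_near. Qed.

Lemma test_deriven n phi : test_function T phi -> test_function T (derive1n n phi).
Proof. by elim: n => // n ih tphi; rewrite derive1nS; apply: test_derive; exact: ih. Qed.

Lemma smooth_bdd_meas phi : smooth phi -> bdd_meas T phi.
Proof.
move=> sphi; have cphi := smooth_continuous sphi; split.
  by apply: measurable_funTS; exact: continuous_measurable_fun.
have [|c _ cM] := @EVT_max R (fun t => `|phi t|) 0 T (ltW T_gt0).
  apply: continuous_subspaceT => x; apply: continuous_comp; [exact: cphi|exact: norm_continuous].
exists `|phi c| => t /andP[t0 tT]; apply: cM; by rewrite in_itv/= !ltW.
Qed.

Lemma test_bdd_meas phi : test_function T phi -> bdd_meas T phi.
Proof. by move=> /test_smooth; exact: smooth_bdd_meas. Qed.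

Lemma test_out phi t : test_function T phi -> ~~ (0 < t < T) -> phi t = 0.
Proof.
move=> [_ [a [b [a0 bT ab]]]] tT; apply: ab; apply: contra tT => /andP[at_ tb].
by rewrite (lt_le_trans a0 at_) (le_lt_trans tb bT).
Qed.

Lemma prim_derive phi t : smooth phi -> 0 <= t -> prim (phi^`())%classic t = phi t - phi 0.
Proof.
move=> sphi t0; apply: prim_FTC => //.
  exact/smooth_continuous/smooth_derive.
by move=> x; exact: smooth_is_derive.
Qed.

Lemma prim_test_parts phi (p : R) (x y : R -> R) : test_function T phi -> L1 T y ->
  (forall t, 0 <= t <= T -> x t = p + prim y t) ->
  prim (fun t => (phi^`())%classic t * x t) T = - prim (fun t => phi t * y t) T.
Proof.
move=> tphi iy xE; have sphi := test_smooth tphi.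
have T0 := ltW T_gt0.
have p0 : phi 0 = 0 by apply: (test_out tphi); rewrite ltxx.
have pT : phi T = 0 by apply: (test_out tphi); rewrite ltxx andbF.
have bphi := test_bdd_meas tphi; have bphi' := test_bdd_meas (test_derive tphi).
have := @primM R T _ y 0 p T (lexx T) (bdd_meas_L1 bphi') iy T0.
rewrite (prim_derive sphi T0) pT p0 subrr addr0 !mul0r add0r => /esym.
have bx : bdd_meas T (fun s => p + prim y s).
  by apply: bdd_measD; [exact: bdd_meas_cst|exact: prim_bdd_meas].
have -> : prim (fun s => (phi^`())%classic s * (p + prim y s) +
    (0 + prim (phi^`())%classic s) * y s) T =
    prim (fun s => (phi^`())%classic s * (p + prim y s) + phi s * y s) T.
  apply: eq_prim => s /andP[s0 _]; congr (_ + _ * _).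
  by rewrite (prim_derive sphi (ltW s0)) p0 subr0 add0r.
rewrite (primD (lexx T)); [|by apply: bdd_meas_L1; exact: bdd_measM|exact: L1M].
move=> /eqP; rewrite addr_eq0 => /eqP <-.
by apply: eq_prim => s /andP[s0 sT]; rewrite xE// !ltW.
Qed.

(** The primitive is taken from minus infinity, so that it is differentiable at every real point,
    those below 0 included. It vanishes below the support of [chi], and above it because the total
    mass is 0. *)
Lemma test_primitive chi : test_function T chi -> prim chi T = 0 ->
  exists phi, test_function T phi /\ (phi^`())%classic = chi.
Proof.
move=> tchi chi0; have schi := test_smooth tchi.
have [_ [a [b [a0 bT ab]]]] := tchi.
have ic : mu.-integrable setT (EFin \o chi).
  have ic0 : mu.-integrable `]0, T[ (EFin \o chi) by exact/bdd_meas_L1/test_bdd_meas.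
  have := (@integrable_mkcond _ _ _ mu _ (EFin \o chi) (measurable_itv `]0, T[)).1 ic0.
  apply: eq_integrable => // t _; rewrite patchE; case: ifPn => // tT.
  rewrite /= (test_out tchi)//; apply: contra tT => tT.
  by rewrite inE/= in_itv.
pose phi (x : R) : R := \int[mu]_(t in `]-oo, x]) chi t.
have dphi (x : R) : is_derive x (1 : R) phi (chi x).
  have ix : mu.-integrable `]-oo, (x + 1)] (EFin \o chi) by apply: integrableS ic.
  have xx : x < x + 1 by rewrite ltrDl.
  have ox : (-oo%O < BRight x)%E by rewrite ltNyr.
  have [] := @continuous_FTC1 R chi -oo%O x (x + 1) xx ix ox (@smooth_continuous R chi schi x).
  by rewrite derive1E => d1 d2; apply: DeriveDef.
have dphiE : (phi^`())%classic = chi.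
  by apply/funext => x; rewrite derive1E; case: (dphi x).
exists phi; split=> //; split.
  apply/smoothP; case=> // n; exists chi; split=> //; exact: schi.
exists a, b; split=> // t; rewrite negb_and -!ltNge => /orP[ta|bt].
  rewrite /phi; transitivity (\int[mu]_(s in `]-oo, t]) (0 : R)).
    apply: eq_Rintegral => s; rewrite inE/= in_itv/= => st.
    by rewrite ab// negb_and -ltNge (le_lt_trans st ta).
  by rewrite Rintegral_cst// mul0r.
rewrite -chi0 /phi /prim Rintegral_mkcond [RHS]Rintegral_mkcond.
apply: eq_Rintegral => s _; rewrite !patchE.
case: (boolP (a <= s <= b)) => [/andP[as_ sb]|sab].
  rewrite !mem_set//= in_itv/=; first by rewrite (lt_le_trans a0 as_) (le_lt_trans sb bT).
  by rewrite (le_trans sb)// ltW.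
by rewrite ab// !if_same.
Qed.

(** Lebesgue differentiation: at almost every point the primitive of [r] has derivative [r], and
    here the primitive is locally constant. *)
Lemma prim_const_ae r (C : R) : L1 T r -> (forall t, 0 < t < T -> prim r t = C) ->
  ae_on T (fun t => r t = 0).
Proof.
move=> ir rC.
pose r' := r \_ `]0, T[%classic.
have := (@integrable_mkcond _ _ _ mu _ (EFin \o r) (measurable_itv `]0, T[)).1 ir.
rewrite restrict_EFin -/r' => ir'.
have ir'y (y : R) : mu.-integrable [set` Interval (BRight 0) (BRight y)] (EFin \o r').
  by apply: integrableS ir'.
have lr' : locally_integrable [set: R] r' by exact: integrable_locally.
have := FTC1 ir'y lr'; apply: ae_imp => x H; rewrite in_itv/= => /andP[x0 xT].
have := H; rewrite /= lte_fin => /(_ x0)[_ Fx].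
have : r' x = 0.
  rewrite -Fx derive1E (@near_eq_derive _ _ _ _ (cst C)) ?derive_cst//.
  have : \forall y \near x, 0 < y < T.
    by near=> y; apply/andP; split; near: y; [exact: lt_nbhsr|exact: lt_nbhsl].
  apply: filterS => y /andP[y0 yT]; rewrite /cst -(rC y) ?y0//.
  rewrite /prim Rintegral_itv_bndo_bndc; last by exact: (L1_itv (ltW yT) ir).
  apply: eq_Rintegral => s; rewrite inE/= in_itv/= => /andP[s0 sy].
  by rewrite /r' patchE mem_set//= in_itv/= s0 (le_lt_trans sy).
by rewrite /r' patchE mem_set//= in_itv/= x0.
Unshelve. all: by end_near. Qed.

(** Bumps converge boundedly to the indicator of []c, d[], so [r] has zero integral over every such
    interval and its primitive is constant inside []0, T[]. *)
Lemma fundamental_lemma r : L1 T r ->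
  (forall phi, test_function T phi -> prim (fun t => phi t * r t) T = 0) ->
  ae_on T (fun t => r t = 0).
Proof.
move=> ir H.
have T0 := ltW T_gt0.
have Hcd (c d : R) : 0 < c -> c <= d -> d < T -> prim r d = prim r c.
  move=> c0 cd dT; apply/eqP; rewrite -subr_eq0.
  have /andP[c0' d0] : (0 <= c) && (0 <= d) by rewrite !ltW//= (lt_le_trans c0).
  have mI : measurable_fun `]0, T[ (\1_(`]c, d[%classic) : R -> R).
    exact: measurable_indic.
  have -> : prim r d - prim r c = prim (fun t => \1_(`]c, d[%classic) t * r t) T.
    rewrite (prim_split c0' cd (ltW dT) ir) /prim Rintegral_mkcond [RHS]Rintegral_mkcond.
    apply: eq_Rintegral => s _; rewrite !patchE indicE.
    case: (boolP (s \in `]c, d[%classic)) => scd; last by rewrite mul0r if_same.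
    rewrite mem_set ?mul1r//; move: scd; rewrite inE/= !in_itv/= => /andP[cs sd].
    by rewrite (lt_trans c0 cs) (lt_trans sd dT).
  have cv : prim (fun t => bump j c d t * r t) T @[j --> \oo] -->
      prim (fun t => \1_(`]c, d[%classic) t * r t) T.
    apply: (@prim_cvg R T (fun j t => bump j c d t * r t) _ (fun t => `|r t|)) => //.
    - by move=> j; apply: L1M => //; exact/test_bdd_meas/test_bump.
    - by apply: measurable_funM => //; exact: L1_meas.
    - exact: L1_abs.
    - by move=> s _; apply: cvgMr_tmp; exact: bump_cvg.
    - move=> j s _; rewrite normrM ger0_norm ?bump_ge0// ler_piMl//; exact: bump_le1.
  have c0v : prim (fun t => bump j c d t * r t) T @[j --> \oo] --> (0 : R).
    rewrite (_ : (fun j => _) = fun=> 0); first exact: cvg_cst.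
    by apply/funext => j; apply: H; exact: test_bump.
  by apply/eqP; exact: (cvg_unique _ cv c0v).
(* The bumps require [0 < c], so the primitive is compared with its value at an interior point. *)
have Hr t : 0 < t < T -> prim r t = prim r (T / 2).
  move=> /andP[t0 tT]; have [tT2|tT2] := leP t (T / 2).
    by apply/esym; apply: Hcd => //; lra.
  by apply: Hcd; lra.
exact: prim_const_ae Hr.
Qed.

(** Were the integral of the bump zero, its primitive, which is nonnegative and nondecreasing, would
    vanish on []0, T[]; the bump would then be 0 almost everywhere, against its positivity on an
    interval of length [T / 3]. *)
Lemma test_unit_mass : exists chi, test_function T chi /\ prim chi T = 1.
Proof.
have h1 : 0 < T / 3 by rewrite divr_gt0.
have h2 : 2 * T / 3 < T by move: T_gt0; lra.
have T0 := ltW T_gt0.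
pose chi := bump 0 (T / 3) (2 * T / 3) : R -> R.
have tchi : test_function T chi by exact: test_bump.
have I0 : 0 <= prim chi T by apply: prim_ge0 => s _; exact: bump_ge0.
have [I_eq0|I_neq0] := eqVneq (prim chi T) 0; last first.
  exists (fun t => (prim chi T)^-1 * chi t); split; first exact: testZ.
  rewrite (primZ _ (lexx T)) ?mulVf//; exact/bdd_meas_L1/test_bdd_meas.
have ichi : L1 T chi by exact/bdd_meas_L1/test_bdd_meas.
have chi0 t : 0 < t < T -> prim chi t = 0.
  move=> /andP[t0 tT]; apply/eqP; rewrite eq_le prim_ge0 ?andbT; last first.
    by move=> s _; exact: bump_ge0.
  rewrite -I_eq0; apply: (prim_homo (ltW t0) (ltW tT) (lexx T) ichi) => s _.
  exact: bump_ge0.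
have [A [mA A0 AP]] := prim_const_ae ichi chi0.
pose I : set R := `]T / 3, (2 * T / 3)[%classic.
have : (mu I <= mu A)%E.
  apply: le_measure; rewrite ?inE//=; first exact: measurable_itv.
  move=> t /=; rewrite /I/= in_itv/= => tT; apply: AP => /= H.
  have t0T : 0 < (t : R) < T.
    by case/andP: tT => h3 h4; apply/andP; split; move: T_gt0 h1 h2 h3 h4; lra.
  by have := bump_gt0 0 tT; rewrite -/(chi t) H ?ltxx// in_itv.
rewrite A0 /I lebesgue_measure_itv/= lte_fin ifT; last by move: T_gt0; lra.
by rewrite -EFinB lee_fin => H; exfalso; move: T_gt0 H; lra.
Qed.

(** Subtracting from a test function its mass times [chi0] leaves one of zero mass, that is, a
    derivative [phi']. Hence [r] pairs with test functions as the constant [C], its pairing with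
    [chi0], does. *)
Lemma dubois_reymond r : L1 T r ->
  (forall phi, test_function T phi -> prim (fun t => (phi^`())%classic t * r t) T = 0) ->
  exists C : R, ae_on T (fun t => r t = C).
Proof.
move=> ir H.
have [chi0 [tchi0 m0]] := test_unit_mass.
pose C := prim (fun t => chi0 t * r t) T.
have iC : L1 T (fun=> C) by exact: L1_cst.
exists C.
suff : ae_on T (fun t => r t - C = 0) by apply: ae_onS => t _ /eqP; rewrite subr_eq0 => /eqP.
apply: fundamental_lemma; first exact: L1B.
move=> chi tchi.
pose chi1 t := chi t + (- prim chi T) * chi0 t.
have tchi1 : test_function T chi1 by apply: testD => //; exact: testZ.
have ichi : L1 T chi by exact/bdd_meas_L1/test_bdd_meas.
have ichi0 : L1 T chi0 by exact/bdd_meas_L1/test_bdd_meas.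
have i1 : L1 T (fun t => chi t * r t) by apply: L1M => //; exact: test_bdd_meas.
have i2 : L1 T (fun t => chi0 t * r t) by apply: L1M => //; exact: test_bdd_meas.
have [|phi [tphi phiE]] := test_primitive tchi1.
  rewrite (primD (lexx T)) ?(primZ _ (lexx T))//; last exact: L1Z.
  by rewrite m0 mulr1 subrr.
have := H _ tphi; rewrite phiE.
have -> : (fun t => chi1 t * r t) = (fun t => chi t * r t + (- prim chi T) * (chi0 t * r t)).
  by apply/funext => t; rewrite /chi1; ring.
rewrite (primD (lexx T)) ?(primZ _ (lexx T))//; last exact: L1Z.
rewrite -/C => E.
rewrite (_ : (fun t => chi t * (r t - C)) = (fun t => chi t * r t + (- C) * chi t)); last first.
  by apply/funext => t; ring.
rewrite (primD (lexx T)) ?(primZ _ (lexx T))//; last exact: L1Z.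
by rewrite mulNr mulrC -mulNr.
Qed.

(** Reduction to first order. When [psi] minus its mass times [chi0] is written as [phi'], the
    hypothesis says that [psi'] pairs with [r] to [L] times the mass of [psi]; by parts, [psi']
    pairs with [L * t] to the opposite. So [r + L t] falls under [dubois_reymond]. *)
Lemma dubois_reymond2 r : L1 T r ->
  (forall phi, test_function T phi -> prim (fun t => derive1n 2 phi t * r t) T = 0) ->
  exists C Q : R, ae_on T (fun t => r t = C + Q * t).
Proof.
move=> ir H.
have [chi0 [tchi0 m0]] := test_unit_mass.
pose L := prim (fun t => (chi0^`())%classic t * r t) T.
have T0 := ltW T_gt0.
have blin : bdd_meas T (fun t => L * t).
  apply: bdd_measZ; split; first exact: measurable_id.
  by exists T => t /andP[t0 tT]; rewrite ger0_norm ltW.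
have irL : L1 T (fun t => r t + L * t) by apply: L1D => //; exact: bdd_meas_L1.
suff [C HC] : exists C : R, ae_on T (fun t => r t + L * t = C).
  by exists C, (- L); apply: ae_onS HC => t _ <-; ring.
apply: dubois_reymond => // psi tpsi.
have bpsi' := test_bdd_meas (test_derive tpsi).
have bchi0' := test_bdd_meas (test_derive tchi0).
pose psi1 t := psi t + (- prim psi T) * chi0 t.
have tpsi1 : test_function T psi1 by apply: testD => //; exact: testZ.
have ipsi : L1 T psi by exact/bdd_meas_L1/test_bdd_meas.
have ichi0 : L1 T chi0 by exact/bdd_meas_L1/test_bdd_meas.
have [|phi [tphi phiE]] := test_primitive tpsi1.
  rewrite (primD (lexx T)) ?(primZ _ (lexx T))//; last exact: L1Z.
  by rewrite m0 mulr1 subrr.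
have := H _ tphi; rewrite /derive1n/= phiE.
have -> : (psi1^`())%classic = (fun t => (psi^`())%classic t + (- prim psi T) * (chi0^`())%classic t).
  apply/funext => t.
  have d1 := smooth_is_derive t (test_smooth tpsi).
  have d2 := smooth_is_derive t (test_smooth tchi0).
  have d3 := @is_deriveZ R R^o R^o chi0 (- prim psi T) t 1 _ d2.
  by rewrite derive1E; have [_ ->] := is_deriveD d1 d3.
have i1 : L1 T (fun t => (psi^`())%classic t * r t) by exact: L1M.
have i2 : L1 T (fun t => (chi0^`())%classic t * r t) by exact: L1M.
have -> : (fun t => ((psi^`())%classic t + (- prim psi T) * (chi0^`())%classic t) * r t) =
   (fun t => (psi^`())%classic t * r t + (- prim psi T) * ((chi0^`())%classic t * r t)).
  by apply/funext => t; ring.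
rewrite (primD (lexx T)) ?(primZ _ (lexx T))//; last exact: L1Z.
rewrite -/L => E.
have -> : (fun t => (psi^`())%classic t * (r t + L * t)) =
   (fun t => (psi^`())%classic t * r t + L * ((psi^`())%classic t * t)).
  by apply/funext => t; ring.
have bt : bdd_meas T (fun t => t).
  split; first exact: measurable_id.
  by exists T => t /andP[t0 tT]; rewrite ger0_norm ltW.
have i3 : L1 T (fun t => (psi^`())%classic t * t) by apply: L1M => //; exact: bdd_meas_L1.
rewrite (primD (lexx T)) ?(primZ _ (lexx T))//; last exact: L1Z.
rewrite (@prim_test_parts psi 0 (fun t => t) (fun=> 1) tpsi); last 2 first.
- exact: L1_cst.
- by move=> t /andP[t0 _]; rewrite prim_cst// add0r mul1r.
rewrite (_ : prim (fun t => psi t * 1) T = prim psi T); last by apply: eq_prim => s _; rewrite mulr1.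
by rewrite mulrN mulrC -mulNr.
Qed.

End TestFunctions.

(** * Real coordinates in a complex Hilbert space *)

Section RealInnerProduct.
Context {R : realType} {H : completeNormedModType R[i]}.
Variable dot : {dot H for Num.conj}.
Hypothesis hdot : hilbert_dot dot.
Implicit Types (x y z : H) (r : R).

(** The real part makes [H] a real Hilbert space with the same norm, in which the equation has real
    modes. *)
Definition rdot x y : R := complex.Re (dot x y).

Lemma ReD (u v : R[i]) : complex.Re (u + v) = complex.Re u + complex.Re v.
Proof. by case: u v => [? ?] [? ?]. Qed.

Lemma ReM_real r (u : R[i]) : complex.Re (r%:C%C * u) = r * complex.Re u.
Proof. by case: u => [a b]; rewrite /= mul0r subr0. Qed.

Lemma dot_conj x y : dot x y = (dot y x)^*.
Proof. by rewrite (@hermC _ false Num.conj) expr0 mul1r. Qed.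

Lemma dotDl x y z : dot (x + y) z = dot x z + dot y z.
Proof. exact: linearDl. Qed.

Lemma dotZl (c : R[i]) x z : dot (c *: x) z = c * dot x z.
Proof. exact: linearZl_LR. Qed.

Lemma rdotC x y : rdot x y = rdot y x.
Proof. by rewrite /rdot dot_conj; case: (dot y x). Qed.

Lemma rdotDl x y z : rdot (x + y) z = rdot x z + rdot y z.
Proof. by rewrite /rdot dotDl ReD. Qed.

Lemma rdotZl r x z : rdot (rscale r x) z = r * rdot x z.
Proof. by rewrite /rdot /rscale dotZl ReM_real. Qed.

Lemma rscaleN1 x : rscale (-1) x = - x.
Proof. by rewrite /rscale rmorphN rmorph1 scaleN1r. Qed.

Lemma rdotNl x z : rdot (- x) z = - rdot x z.
Proof. by rewrite -rscaleN1 rdotZl mulN1r. Qed.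

Lemma rdotBl x y z : rdot (x - y) z = rdot x z - rdot y z.
Proof. by rewrite rdotDl rdotNl. Qed.

Lemma rdot0l z : rdot 0 z = 0.
Proof. by rewrite -(subrr z) rdotBl subrr. Qed.

Lemma rdotZr r x z : rdot x (rscale r z) = r * rdot x z.
Proof. by rewrite rdotC rdotZl rdotC. Qed.

Lemma rdotBr x y z : rdot x (y - z) = rdot x y - rdot x z.
Proof. by rewrite rdotC rdotBl !(rdotC x). Qed.

Lemma rdot_suml (I : Type) (s : seq I) (F : I -> H) z :
  rdot (\sum_(i <- s) F i) z = \sum_(i <- s) rdot (F i) z.
Proof.
elim: s => [|i s ih]; first by rewrite !big_nil rdot0l.
by rewrite !big_cons rdotDl ih.
Qed.

Lemma norm_rnorm x : `|x| = (rnorm x)%:C%C.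
Proof. by rewrite /rnorm RRe_real// ger0_real. Qed.

Lemma rnorm_ge0 x : 0 <= rnorm x.
Proof. by rewrite -ler0c -norm_rnorm. Qed.

Lemma rnorm_sqr x : rnorm x ^+ 2 = rdot x x.
Proof.
have := hdot x; rewrite norm_rnorm /rdot => <-.
by rewrite !expr2 ReM_real.
Qed.

Lemma rnormD x y : rnorm (x + y) <= rnorm x + rnorm y.
Proof. by rewrite -lecR rmorphD/= -!norm_rnorm ler_normD. Qed.

Lemma rnormN x : rnorm (- x) = rnorm x.
Proof. by rewrite /rnorm normrN. Qed.

Lemma rnormB x y : rnorm (x - y) = rnorm (y - x).
Proof. by rewrite -rnormN opprB. Qed.

Lemma rnorm0 : rnorm (0 : H) = 0.
Proof. by rewrite /rnorm normr0. Qed.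

Lemma rnorm_eq0 x : rnorm x = 0 -> x = 0.
Proof. by move=> x0; apply/eqP; rewrite -normr_eq0 norm_rnorm x0. Qed.

Lemma rnormZ r x : rnorm (rscale r x) = `|r| * rnorm x.
Proof.
rewrite /rnorm /rscale normrZ (_ : `|r%:C%C| = (`|r|)%:C%C) ?ReM_real//.
by rewrite normc_def/= expr0n/= addr0 sqrtr_sqr.
Qed.

Lemma rnorm_sum (I : Type) (s : seq I) (F : I -> H) :
  rnorm (\sum_(i <- s) F i) <= \sum_(i <- s) rnorm (F i).
Proof.
elim: s => [|i s ih]; first by rewrite !big_nil rnorm0.
by rewrite !big_cons (le_trans (rnormD _ _))// lerD2l.
Qed.

(** The squared norm of [x] minus its projection on [y] is nonnegative; [q] is the coefficient of
    that projection. *)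
Lemma rdot_le x y : `|rdot x y| <= rnorm x * rnorm y.
Proof.
have [y0|y0] := eqVneq (rnorm y) 0.
  by rewrite (rnorm_eq0 y0) rdotC rdot0l rnorm0 normr0 mulr0.
have yp : 0 < rnorm y by rewrite lt_neqAle eq_sym y0 rnorm_ge0.
rewrite -(ler_pXn2r (n := 2)) ?nnegrE ?mulr_ge0 ?rnorm_ge0// real_normK ?num_real// exprMn.
set q := rdot x y / rnorm y ^+ 2.
have := sqr_ge0 (rnorm (x - rscale q y)).
rewrite (rnorm_sqr (x - _)) rdotBl !rdotBr !rdotZl !rdotZr -!rnorm_sqr (rdotC y x) /q.
set d := rdot x y; set b := rnorm y ^+ 2; set a := rnorm x ^+ 2.
have b0 : 0 < b by rewrite exprn_gt0.
rewrite (_ : _ - _ = (a * b - d ^+ 2) / b); last by field; rewrite gt_eqF.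
by rewrite pmulr_lge0 ?invr_gt0// subr_ge0.
Qed.

Lemma cvg_rnormP (I : Type) (F : set_system I) {FF : Filter F} (u : I -> H) x :
  u i @[i --> F] --> x <-> rnorm (x - u i) @[i --> F] --> (0 : R).
Proof.
split=> [/cvgrPdist_lt ux|ux].
  apply/cvgr0Pnorm_lt => e e0.
  have := ux e%:C%C; rewrite ltcR => /(_ e0); apply: filterS => i.
  by rewrite norm_rnorm ltcR ger0_norm ?rnorm_ge0.
apply/cvgrPdist_lt => e e0.
(* A positive element of [R[i]] is real, so the radii of the [R[i]]-valued norm reduce to real
   ones. *)
have eE : e = (complex.Re e)%:C%C by rewrite RRe_real// gtr0_real.
rewrite eE ltcR in e0 *.
move/cvgr0Pnorm_lt : ux => /(_ _ e0); apply: filterS => i.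
by rewrite norm_rnorm ltcR ger0_norm ?rnorm_ge0.
Qed.

End RealInnerProduct.

(** * Real orthonormal basis, Parseval and Riesz-Fischer *)

Section RealBasis.
Context {R : realType} {H : completeNormedModType R[i]}.
Variable dot : {dot H for Num.conj}.
Hypothesis hdot : hilbert_dot dot.
Variable e : nat -> H.
Hypothesis he : orthonormal_basis dot e.
Implicit Types (x y z : H) (r : R).
Notation rdot := (rdot dot).

(* Real orthonormal basis e_0, i e_0, e_1, i e_1, ... *)
Definition rbasis (m : nat) : H := if odd m then 'i%C *: e m./2 else e m./2.

Definition crd (m : nat) x : R := rdot x (rbasis m).

Lemma dotZr (c : R[i]) x z : dot x (c *: z) = c^* * dot x z.
Proof. by rewrite dot_conj dotZl rmorphM/= -dot_conj. Qed.

Lemma crd_even n x : crd n.*2 x = complex.Re (dot x (e n)).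
Proof. by rewrite /crd /rbasis odd_double doubleK. Qed.

Lemma crd_odd n x : crd n.*2.+1 x = complex.Im (dot x (e n)).
Proof.
rewrite /crd /rbasis /= odd_double/= uphalf_double /rdot dotZr.
by case: (dot x (e n)) => a b; rewrite /= mul0r sub0r mulN1r opprK.
Qed.

Lemma half_cases m : exists n, m = n.*2 \/ m = n.*2.+1.
Proof.
by exists m./2; have := odd_double_half m; case: odd => /= E; [right|left]; rewrite -[LHS]E.
Qed.

Lemma rbasisE m n : rdot (rbasis m) (rbasis n) = (m == n)%:R.
Proof.
have [on _] := he.
rewrite -/(crd n (rbasis m)).
have par (k l : nat) : (l.*2.+1 == k.*2) = false.
  by apply/negbTE/eqP => /(congr1 odd); rewrite /= !odd_double.
have [k [->|->]] := half_cases n; have [l [->|->]] := half_cases m.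
- by rewrite crd_even /rbasis odd_double doubleK on (inj_eq double_inj); case: (l == k).
- rewrite crd_even /rbasis /= odd_double/= uphalf_double dotZl on.
  by rewrite par; case: (l == k) => /=; rewrite ?mul0r ?mulr0 ?subrr.
- rewrite crd_odd /rbasis odd_double doubleK on.
  by rewrite (eq_sym l.*2) par; case: (l == k).
- rewrite crd_odd /rbasis /= odd_double/= uphalf_double dotZl on.
  by rewrite eqSS (inj_eq double_inj); case: (l == k) => /=; rewrite ?mul0r ?mulr0 ?mulr1 ?mul1r ?addr0 ?add0r.
Qed.

Lemma crdD m x y : crd m (x + y) = crd m x + crd m y.
Proof. exact: rdotDl. Qed.

Lemma crdB m x y : crd m (x - y) = crd m x - crd m y.
Proof. exact: rdotBl. Qed.

Lemma crdZ m r x : crd m (rscale r x) = r * crd m x.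
Proof. exact: rdotZl. Qed.

Lemma rnorm_rbasis m : rnorm (rbasis m) = 1.
Proof.
apply/eqP; rewrite -(eqrXn2 (n := 2))// ?rnorm_ge0//.
by rewrite (rnorm_sqr hdot) rbasisE eqxx expr1n.
Qed.

Lemma crd_le m x : `|crd m x| <= rnorm x.
Proof. by rewrite (le_trans (rdot_le hdot _ _))// rnorm_rbasis mulr1. Qed.

Definition rpartial (xi : nat -> R) (n : nat) : H := \sum_(0 <= m < n) rscale (xi m) (rbasis m).

Lemma crd_rpartial xi n m : crd m (rpartial xi n) = if (m < n)%N then xi m else 0.
Proof.
rewrite /rpartial /crd rdot_suml.
under eq_bigr do rewrite rdotZl rbasisE.
rewrite big_mkord; case: ifPn => [mn|nm].
  rewrite (bigD1 (Ordinal mn))//= eqxx mulr1 big1 ?addr0// => i.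
  by rewrite -val_eqE/= => /negPf ->; rewrite mulr0.
rewrite big1// => i _; rewrite (_ : (i == m :> nat) = false) ?mulr0//.
by apply/negbTE/eqP => im; move: nm; rewrite -im ltn_ord.
Qed.

Lemma rdot_rpartial xi n x : rdot x (rpartial xi n) = \sum_(0 <= m < n) xi m * crd m x.
Proof.
rewrite rdotC /rpartial rdot_suml; apply: eq_bigr => m _.
by rewrite rdotZl rdotC.
Qed.

Lemma rnorm_rpartial xi n : rnorm (rpartial xi n) ^+ 2 = \sum_(0 <= m < n) xi m ^+ 2.
Proof.
rewrite (rnorm_sqr hdot) rdot_rpartial; apply: eq_big_nat => m /andP[_ mn].
by rewrite crd_rpartial mn expr2.
Qed.

Lemma rnorm_sub_rpartial x n :
  rnorm (x - rpartial (crd^~ x) n) ^+ 2 = rnorm x ^+ 2 - \sum_(0 <= m < n) crd m x ^+ 2.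
Proof.
rewrite !(rnorm_sqr hdot) rdotBl !rdotBr (rdotC dot _ x).
rewrite -(rnorm_sqr hdot (rpartial _ _)) rnorm_rpartial.
have -> : rdot x (rpartial (crd^~ x) n) = \sum_(0 <= m < n) crd m x ^+ 2.
  by rewrite rdot_rpartial; apply: eq_bigr => m _; rewrite expr2.
by rewrite subrr subr0.
Qed.

(** The real terms along [e n] and [i e n] recombine into one complex term, which makes the basis
    hypothesis usable along even indices. *)
Lemma rpartial_double x n : rpartial (crd^~ x) n.*2 = series (fun n => dot x (e n) *: e n) n.
Proof.
elim: n => [|n ih]; first by rewrite /rpartial /series/= !big_geq.
rewrite doubleS /rpartial !big_nat_recr//= -/(rpartial _ _) ih /series/= big_nat_recr//=.
rewrite -addrA crd_even crd_odd; congr (_ + _).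
rewrite /rbasis odd_double doubleK /= odd_double/= uphalf_double /rscale scalerA -scalerDl.
by congr (_ *: _); rewrite [RHS]complexE [_ * 'i%C]mulrC.
Qed.

Lemma bessel x n : \sum_(0 <= m < n) crd m x ^+ 2 <= rnorm x ^+ 2.
Proof. by rewrite -subr_ge0 -rnorm_sub_rpartial sqr_ge0. Qed.

(** Bessel's inequality makes the whole monotone series converge. Its limit is then read off along
    even indices, where the defect is the squared tail of the complex expansion. *)
Lemma parseval x : series (fun m => crd m x ^+ 2) n @[n --> \oo] --> rnorm x ^+ 2.
Proof.
have [_ /(_ x)/cvg_rnormP cx] := he.
have nd : nondecreasing_seq (series (fun m => crd m x ^+ 2)).
  by apply/nondecreasing_seqP => n; rewrite seriesSr lerDl sqr_ge0.
have cs : cvgn (series (fun m => crd m x ^+ 2)).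
  apply: nondecreasing_is_cvgn => //; exists (rnorm x ^+ 2) => _ [n _ <-]; exact: bessel.
suff <- : limn (series (fun m => crd m x ^+ 2)) = rnorm x ^+ 2 by exact: cs.
have c1 : series (fun m => crd m x ^+ 2) n.*2 @[n --> \oo] --> limn (series (fun m => crd m x ^+ 2)).
  apply: (@cvg_comp _ _ _ double (series (fun m => crd m x ^+ 2)) \oo \oo) => //.
  by move=> A [N _ NA]; exists N => // n /= Nn; apply: NA; rewrite /= -addnn (leq_trans Nn)// leq_addr.
have c2 : series (fun m => crd m x ^+ 2) n.*2 @[n --> \oo] --> rnorm x ^+ 2.
  have -> : (fun n => series (fun m => crd m x ^+ 2) n.*2) =
     (fun n => rnorm x ^+ 2 - rnorm (x - series (fun n => dot x (e n) *: e n) n) ^+ 2).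
    apply/funext => n; rewrite -rpartial_double rnorm_sub_rpartial.
    by rewrite /series/=; ring.
  rewrite -[X in _ --> X]subr0; apply: cvgB; first exact: cvg_cst.
  rewrite -(mulr0 (0 : R)).
  by rewrite (_ : (fun n => _ ^+ 2) = (fun n => rnorm (x - series (fun n => dot x (e n) *: e n) n) *
     rnorm (x - series (fun n => dot x (e n) *: e n) n)));
    [exact: cvgM|apply/funext => n; rewrite expr2].
exact: (cvg_unique _ c1 c2).
Qed.

Lemma crd_inj x y : (forall m, crd m x = crd m y) -> x = y.
Proof.
move=> xy; apply/eqP; rewrite -subr_eq0; apply/eqP/rnorm_eq0.
have : rnorm (x - y) ^+ 2 = 0.
  have c2 : series (fun m => crd m (x - y) ^+ 2) n @[n --> \oo] --> (0 : R).
    rewrite (_ : series _ = fun=> 0); first exact: cvg_cst.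
    apply/funext => n; rewrite /series/= big1// => m _.
    by rewrite crdB xy subrr expr0n.
  by rewrite -(cvg_lim (@Rhausdorff R) (@parseval (x - y))) (cvg_lim (@Rhausdorff R) c2).
by move=> /eqP; rewrite expf_eq0/= => /eqP.
Qed.

Lemma crd_cvg (I : Type) (F : set_system I) {FF : Filter F} (u : I -> H) x m :
  u i @[i --> F] --> x -> crd m (u i) @[i --> F] --> crd m x.
Proof.
move=> /cvg_rnormP ux; apply/cvgrPdist_lt => eps eps0.
move/cvgr0Pnorm_lt : ux => /(_ _ eps0); apply: filterS => i.
rewrite ger0_norm ?rnorm_ge0// => /(le_lt_trans _); apply.
by rewrite -crdB; exact: crd_le.
Qed.

(** Riesz-Fischer: by orthonormality the blocks of the vector series are as small as those of the
    series of [xi m ^+ 2], and [H] is complete. *)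
Lemma synth_exists (xi : nat -> R) : cvgn (series (fun m => xi m ^+ 2)) ->
  exists x, rpartial xi n @[n --> \oo] --> x /\ forall m, crd m x = xi m.
Proof.
move=> cxi.
have : cauchy (series (fun m => rscale (xi m) (rbasis m)) @ \oo).
  apply/cauchy_seriesP => eps eps0.
  have eE : eps = (complex.Re eps)%:C%C by rewrite RRe_real// gtr0_real.
  rewrite eE ltcR in eps0 *.
  have /cauchy_cvgP/cauchy_seriesP/(_ (complex.Re eps ^+ 2)) := cxi.
  rewrite exprn_gt0// => /(_ isT); apply: filterS => -[n1 n2] /=.
  rewrite norm_rnorm ltcR => H1.
  rewrite -(ltr_pXn2r (n := 2))// ?nnegrE ?rnorm_ge0 ?(ltW eps0)//.
  apply: le_lt_trans H1.
  have [n12|n12] := leqP n1 n2; last by rewrite !big_geq ?rnorm0 ?expr0n/= ?normr0// ltnW.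
  rewrite (le_trans _ (ler_norm _))//.
  (* The block is a partial sum of the sequence set to 0 below [n1], which brings it under
     [rnorm_rpartial]. *)
  have E : \sum_(n1 <= k < n2) rscale (xi k) (rbasis k) =
      rpartial (fun k => if (n1 <= k)%N then xi k else 0) n2.
    rewrite /rpartial [RHS](big_cat_nat (leq0n n1) n12)//= [X in _ = X + _](_ : _ = 0) ?add0r; last first.
      rewrite big_nat_cond big1// => i /andP[/andP[_ i1] _].
      by rewrite leqNgt i1/= /rscale scale0r.
    by apply: eq_big_nat => i /andP[-> _].
  rewrite E rnorm_rpartial (big_cat_nat (leq0n n1) n12)//= [X in X + _ <= _](_ : _ = 0) ?add0r; last first.
    by rewrite big_nat_cond big1// => i /andP[/andP[_ i1] _]; rewrite leqNgt i1/= expr0n.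
  by rewrite le_eqVlt; apply/orP; left; apply/eqP; apply: eq_big_nat => i /andP[-> _].
move=> /cauchy_cvgP cx; exists (limn (series (fun m => rscale (xi m) (rbasis m)))).
split=> [|m]; first exact: cx.
have c1 := @crd_cvg nat \oo eventually_filter (series (fun m => rscale (xi m) (rbasis m))) _ m cx.
rewrite -(cvg_lim (@Rhausdorff R) c1); apply: cvg_lim => //.
apply: cvg_near_cst; exists m.+1 => // n /= mn.
by rewrite -/(rpartial xi n) crd_rpartial mn.
Qed.

End RealBasis.

(** * Series of nonnegative reals *)

Section RealSeries.
Context {R : realType}.
Implicit Types u w : nat -> R.

Lemma nondecreasing_series_ge0 u : (forall k, 0 <= u k) -> nondecreasing_seq (series u).
Proof. by move=> u0; apply/nondecreasing_seqP => n; rewrite seriesSr lerDl. Qed.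

Lemma nneseries_lim u : (forall k, 0 <= u k) -> cvgn (series u) ->
  (\sum_(0 <= k <oo) (u k)%:E = (limn (series u))%:E)%E.
Proof.
move=> u0 cu; rewrite -EFin_lim//; apply/congr_lim/funext => n.
by rewrite /= sumEFin.
Qed.

Lemma nneseries_ltyP u : (forall k, 0 <= u k) ->
  (\sum_(0 <= k <oo) (u k)%:E < +oo)%E <-> cvgn (series u).
Proof.
move=> u0; split=> [H|cu]; last by rewrite nneseries_lim// ltry.
apply: nondecreasing_is_cvgn; first exact: nondecreasing_series_ge0.
have S0 : (0 <= \sum_(0 <= k <oo) (u k)%:E)%E by apply: nneseries_ge0 => k _ _; rewrite lee_fin.
exists (fine (\sum_(0 <= k <oo) (u k)%:E)%E) => _ [n _ <-].
rewrite -lee_fin fineK ?ge0_fin_numE// -sumEFin.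
by apply: (@nneseries_lim_ge R (fun k => (u k)%:E) xpredT 0 n) => k _ _; rewrite lee_fin.
Qed.

Lemma series_le_lim u n : (forall k, 0 <= u k) -> cvgn (series u) -> series u n <= limn (series u).
Proof. by move=> u0 cu; apply: nondecreasing_cvgn_le => //; exact: nondecreasing_series_ge0. Qed.

Lemma le_cvg_series u w : (forall k, 0 <= u k <= w k) -> cvgn (series w) -> cvgn (series u).
Proof.
move=> uw; apply: series_le_cvg => k; have /andP[u0 u1] := uw k => //.
exact: le_trans u1.
Qed.

Lemma le_lim_series u w : (forall k, 0 <= u k <= w k) -> cvgn (series w) ->
  limn (series u) <= limn (series w).
Proof.
move=> uw cw; apply: ler_lim => //; first exact: le_cvg_series cw.
by exists 0%N => // n _; apply: ler_sum => k _; case/andP: (uw k).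
Qed.

Lemma pair_series u n : series (fun k => u k.*2 + u k.*2.+1) n = series u n.*2.
Proof.
elim: n => [|n ih]; first by rewrite /series/= !big_geq.
by rewrite doubleS !seriesSr ih addrA.
Qed.

Lemma cvg_pair_series u : (forall k, 0 <= u k) ->
  cvgn (series (fun k => u k.*2 + u k.*2.+1)) <-> cvgn (series u).
Proof.
move=> u0; split=> cu; apply: nondecreasing_is_cvgn.
- exact: nondecreasing_series_ge0.
- exists (limn (series (fun k => u k.*2 + u k.*2.+1))) => _ [n _ <-].
  apply: (@le_trans _ _ (series u n.*2)).
    by apply: nondecreasing_series_ge0 => //; rewrite -addnn leq_addr.
  by rewrite -pair_series; apply: series_le_lim => // k; rewrite addr_ge0.
- by apply: nondecreasing_series_ge0 => k; rewrite addr_ge0.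
- by exists (limn (series u)) => _ [n _ <-]; rewrite pair_series; exact: series_le_lim.
Qed.

Lemma cvg_double (E : topologicalType) (v : nat -> E) (l : E) : v n @[n --> \oo] --> l ->
  v n.*2 @[n --> \oo] --> l.
Proof.
move=> vl; apply: (@cvg_comp _ _ _ double v \oo \oo) => //.
by move=> A [N _ NA]; exists N => // n /= Nn; apply: NA; rewrite /= -addnn (leq_trans Nn)// leq_addr.
Qed.

End RealSeries.

(** * Powers of the operator in real coordinates *)

Section PowerCoordinates.
Context {R : realType} {H : completeNormedModType R[i]}.
Variable dot : {dot H for Num.conj}.
Hypothesis hdot : hilbert_dot dot.
Variable e : nat -> H.
Hypothesis he : orthonormal_basis dot e.
Variable a : nat -> R.
Hypothesis a_ge1 : forall n, 1 <= a n.
Implicit Types (x y z : H) (r s : R).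
Notation crd := (crd dot e).
Notation rpartial := (rpartial e).

(* A multiplies rbasis e m by a m./2. *)
Definition reig (m : nat) : R := a m./2.

Lemma reig_ge1 m : 1 <= reig m. Proof. exact: a_ge1. Qed.

Lemma reig_pow_gt0 s m : 0 < reig m `^ s.
Proof. by rewrite powR_gt0// (lt_le_trans ltr01 (reig_ge1 m)). Qed.

(** As a bare limit it has the coordinates [xi] only when [xi] is square summable, so it is read
    through [crd_synth]. *)
Definition synth (xi : nat -> R) : H := limn (rpartial xi).

Lemma crd_synth (xi : nat -> R) m : cvgn (series (fun m => xi m ^+ 2)) -> crd m (synth xi) = xi m.
Proof.
move=> cxi; have [x [xl xE]] := synth_exists hdot he cxi.
suff -> : synth xi = x by [].
exact: (cvg_lim _ xl).
Qed.

Lemma rnorm_sqrE x : rnorm x ^+ 2 = limn (series (fun m => crd m x ^+ 2)).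
Proof. by apply/esym; apply: cvg_lim => //; exact: (parseval hdot he). Qed.

Lemma cvg_crd x : cvgn (series (fun m => crd m x ^+ 2)).
Proof. by apply/cvg_ex; eexists; exact: (parseval hdot he). Qed.

Lemma rnorm_sqr_esum x : ((rnorm x ^+ 2)%:E = \sum_(0 <= m <oo) (crd m x ^+ 2)%:E)%E.
Proof. by rewrite nneseries_lim ?rnorm_sqrE// => [m|]; [exact: sqr_ge0|exact: cvg_crd]. Qed.

(** Coordinates [2 n] and [2 n + 1] share an eigenvalue and their squares add up to the squared
    modulus of [dot x (e n)]; pairing nonnegative terms does not affect summability. *)
Lemma op_pow_domP s x : op_pow_dom dot e a s x <->
  cvgn (series (fun m => (reig m `^ s * crd m x) ^+ 2)).
Proof.
rewrite -cvg_pair_series; last by move=> k; exact: sqr_ge0.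
rewrite /op_pow_dom/= -nneseries_ltyP; last first.
  by move=> k; rewrite addr_ge0 ?sqr_ge0.
rewrite (@eq_eseriesr _ (fun n => (a n `^ (2 * s) * complex.Re `|dot x (e n)| ^+ 2)%:E)
  (fun n => ((reig n.*2 `^ s * crd n.*2 x) ^+ 2 + (reig n.*2.+1 `^ s * crd n.*2.+1 x) ^+ 2)%:E))//.
have E n : a n `^ (2 * s) = (a n `^ s) ^+ 2.
  by rewrite mulrC powRrM -powR_mulrn ?powR_ge0.
move=> n _; congr (_%:E).
rewrite /reig /= uphalf_double doubleK crd_even crd_odd !exprMn -mulrDr E; congr (_ * _).
by case: (dot x (e n)) => u v /=; rewrite sqr_sqrtr// addr_ge0 ?sqr_ge0.
Qed.

Lemma op_powE s x m : op_pow_dom dot e a s x -> crd m (op_pow dot e a s x) = reig m `^ s * crd m x.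
Proof.
move=> /op_pow_domP cx.
have [y [yl yE]] := synth_exists hdot he cx.
suff -> : op_pow dot e a s x = y by rewrite yE.
apply: cvg_lim => //.
rewrite (_ : series _ = (fun n => rpartial (fun m => reig m `^ s * crd m x) n.*2)).
  exact: cvg_double yl.
apply/funext; elim=> [|n ih]; first by rewrite /rpartial /series/= !big_geq.
rewrite doubleS /rpartial !big_nat_recr//= -/(rpartial _ _) -ih seriesSr -addrA; congr (_ + _).
rewrite crd_even crd_odd /reig /= uphalf_double doubleK.
rewrite /rbasis odd_double doubleK /= odd_double/= uphalf_double /rscale !scalerA -scalerDl.
congr (_ *: _); rewrite !rmorphM/= -!mulrA -mulrDr; congr (_ * _).
by rewrite [LHS]complexE [_ * 'i%C]mulrC.
Qed.

(** Eigenvalues are at least 1, so their powers increase with the exponent. This is what puts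
    [A^{2 theta} u] under the control of [A^2 u]. *)
Lemma op_pow_dom_le s s' x : s <= s' -> op_pow_dom dot e a s' x -> op_pow_dom dot e a s x.
Proof.
move=> ss' /op_pow_domP cx; apply/op_pow_domP; apply: le_cvg_series cx => m.
rewrite sqr_ge0/= !exprMn ler_wpM2r ?sqr_ge0// ler_pXn2r ?nnegrE ?powR_ge0//.
by rewrite ler_powR// reig_ge1.
Qed.

Lemma rnorm_op_pow_le s s' x : s <= s' -> op_pow_dom dot e a s' x ->
  rnorm (op_pow dot e a s x) <= rnorm (op_pow dot e a s' x).
Proof.
move=> ss' dx; have dx' := op_pow_dom_le ss' dx.
rewrite -(ler_pXn2r (n := 2)) ?nnegrE ?rnorm_ge0// !rnorm_sqrE.
apply: le_lim_series; last exact: cvg_crd.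
move=> m; rewrite sqr_ge0/= !op_powE// !exprMn ler_wpM2r ?sqr_ge0// ler_pXn2r ?nnegrE ?powR_ge0//.
by rewrite ler_powR// reig_ge1.
Qed.

End PowerCoordinates.

(** * Borel measurability through coordinates *)

Section VectorMeasurability.
Context {R : realType} {H : completeNormedModType R[i]}.
Variable dot : {dot H for Num.conj}.
Hypothesis hdot : hilbert_dot dot.
Variable e : nat -> H.
Hypothesis he : orthonormal_basis dot e.
Hypothesis hsep : separable_space H.
Notation crd := (crd dot e).

Lemma open_rnormP (U : set H) x : open U -> U x ->
  exists r : R, 0 < r /\ forall y, rnorm (y - x) < r -> U y.
Proof.
move=> oU Ux.
have : nbhs x U by exact: open_nbhs_nbhs.
move=> /nbhs_ballP[eps /= eps0 sub].
have eE : eps = (complex.Re eps)%:C%C by rewrite RRe_real// gtr0_real.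
rewrite eE ltcR in eps0.
exists (complex.Re eps); split=> // y yx; apply: sub.
by rewrite -ball_normE/= eE norm_rnorm ltcR rnormB.
Qed.

Lemma rnorm_ball_open x (r : R) : open [set y : H | rnorm (y - x) < r].
Proof.
rewrite (_ : [set _ | _] = ball x (r%:C)%C); first exact: ball_open.
by apply/seteqP; split=> y; rewrite -ball_normE/= norm_rnorm ltcR rnormB.
Qed.

Lemma vmeasurable_crd (D : set R) (g : R -> H) m : measurable D -> vmeasurable D g ->
  measurable_fun D (crd m \o g).
Proof.
move=> mD mg; apply: (measurability _ (RGenOpens.measurableE R)).
move=> _ [_ [x [y ->]] <-].
rewrite comp_preimage; apply: mg => //.
apply: sub_sigma_algebra; apply: open_comp; last exact: interval_open.
by move=> z _ A; apply: (@crd_cvg _ _ _ hdot e he _ _ _ id z m).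
Qed.

Lemma rnorm_measurable (D : set R) (g : R -> H) : measurable D ->
  (forall m, measurable_fun D (crd m \o g)) -> measurable_fun D (fun t => rnorm (g t) ^+ 2).
Proof.
move=> mD mg.
apply: (@measurable_fun_cvg _ _ R D (fun n t => series (fun m => crd m (g t) ^+ 2) n)).
  move=> n; elim: n => [|n ih].
    rewrite (_ : (fun _ => _) = cst 0); first exact: measurable_cst.
    by apply/funext => t; rewrite /series/= big_geq.
  rewrite (_ : (fun _ => _) = (fun t => series (fun m => crd m (g t) ^+ 2) n + crd n (g t) * crd n (g t))).
    by apply: measurable_funD => //; apply: measurable_funM; exact: mg.
  by apply/funext => t; rewrite seriesSr expr2.
by move=> t _; exact: (parseval hdot he).
Qed.

(** Pettis: by separability an open set is a countable union of balls centred in a dense set, and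
    the preimage of a ball is measurable because the squared distance is a Parseval series. *)
Lemma vmeasurableP (D : set R) (g : R -> H) : measurable D ->
  vmeasurable D g <-> forall m, measurable_fun D (crd m \o g).
Proof.
move=> mD; split=> [mg m|mg]; first exact: vmeasurable_crd.
apply: (@measurability _ _ _ (g_sigma_algebraType (@open H)) D g (@open H)) => //.
move=> _ [U oU <-].
have [S [/countable_injP[f finj] dS]] := hsep.
(* [p.1] is the code of a centre [q] in [S] and [p.2] encodes the radius [1 / (p.2 + 1)]; only balls
   inside [U] are kept. *)
pose F (p : nat * nat) : set R := [set t | D t /\ exists q, [/\ S q, f q = p.1,
   (forall y, rnorm (y - q) < p.2.+1%:R^-1 -> U y) & rnorm (g t - q) < p.2.+1%:R^-1]].
have -> : D `&` g @^-1` U = \bigcup_p F p.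
  apply/seteqP; split=> [t [Dt Ut]|t [p _ [Dt [q [_ _ qU tq]]]]]; last first.
    by split=> //; exact: qU.
  have [r [r0 rU]] := open_rnormP oU Ut.
  (* Half of [r], so that the ball around a centre this close to [g t] stays inside [U]. *)
  have [j jr] : exists j : nat, j.+1%:R^-1 < r / 2.
    exists (Num.truncn (r / 2)^-1); rewrite invf_plt ?posrE ?divr_gt0//.
    exact: truncnS_gt.
  have ne : [set y : H | rnorm (y - g t) < j.+1%:R^-1] !=set0.
    by exists (g t); rewrite /= subrr rnorm0 invr_gt0.
  have [q [/= tq Sq]] := dS _ ne (@rnorm_ball_open _ _).
  exists (f q, j) => //; split=> //; exists q; split=> //=; last by rewrite rnormB.
  move=> y yq; apply: rU.
  rewrite (_ : y - g t = (y - q) + (q - g t)); last by rewrite addrA subrK.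
  apply: (le_lt_trans (rnormD _ _)); apply: (lt_trans (ltrD yq tq)).
  by move: jr; set z := _^-1; lra.
apply: countable_bigcupT_measurable => // -[k j].
have [[q [Sq fq qU]]|noq] := pselect (exists q, [/\ S q, f q = k &
    forall y, rnorm (y - q) < j.+1%:R^-1 -> U y]); last first.
  rewrite (_ : F _ = set0)//; apply/seteqP; split=> // t [_ [q [Sq fq qU _]]].
  by apply: noq; exists q.
have mr : measurable_fun D (fun t => rnorm (g t - q) ^+ 2).
  apply: rnorm_measurable => // m.
  rewrite (_ : _ \o _ = (fun t => crd m (g t) - crd m q)).
    by apply: measurable_funB => //; exact: mg.
  by apply/funext => t; rewrite /= crdB.
rewrite (_ : F _ = D `&` (fun t => rnorm (g t - q) ^+ 2) @^-1` `]-oo, (j.+1%:R^-1 ^+ 2)[%classic).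
  by apply: mr => //; exact: measurable_itv.
apply/seteqP; split=> t [Dt]/=.
  move=> [q' [Sq' fq' _ tq']].
  have -> : q = q' by apply: finj; rewrite ?inE// fq fq'.
  by split=> //; rewrite in_itv/= ltr_pXn2r// ?nnegrE ?rnorm_ge0.
rewrite in_itv/= ltr_pXn2r// ?nnegrE ?rnorm_ge0// => tq.
by split=> //; exists q.
Qed.

End VectorMeasurability.

(** * Bochner integrals in coordinates *)

Section Bochner.
Import HBSimple.
Context {R : realType} {H : completeNormedModType R[i]}.
Variable dot : {dot H for Num.conj}.
Hypothesis hdot : hilbert_dot dot.
Variable e : nat -> H.
Hypothesis he : orthonormal_basis dot e.
Hypothesis hsep : separable_space H.
Notation crd := (crd dot e).
Notation rdot := (rdot dot).
Notation mu := (@lebesgue_measure R).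
Variable D : set R.
Hypothesis mD : measurable D.
Hypothesis D_fin : (mu D < +oo)%E.
Implicit Types (g : R -> H) (s : @simple_function R H) (z : H).

Lemma measurable_rnorm g : (forall m, measurable_fun D (crd m \o g)) ->
  measurable_fun D (fun t => rnorm (g t)).
Proof.
move=> mg; have mr := rnorm_measurable hdot he mD mg.
rewrite (_ : (fun _ => _) = (fun x : R => x `^ (2^-1)) \o (fun t => rnorm (g t) ^+ 2)).
  by apply: measurableT_comp => //; exact: measurable_powR.
by apply/funext => t; rewrite /= powR12_sqrt ?sqr_ge0// sqrtr_sqr ger0_norm// rnorm_ge0.
Qed.

Lemma integrable_ge0_fin (h : R -> R) : measurable_fun D h -> (forall t, D t -> 0 <= h t) ->
  (\int[mu]_(t in D) (h t)%:E < +oo)%E -> mu.-integrable D (EFin \o h).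
Proof.
move=> mh h0 ih; apply/integrableP; split; first exact/measurable_EFinP.
apply: le_lt_trans ih; apply: ge0_le_integral => //=.
- by apply/measurable_EFinP; apply: measurableT_comp.
- exact/measurable_EFinP.
- by move=> t Dt; rewrite lee_fin ger0_norm ?h0.
Qed.

Lemma integrable_on_add (f g : R -> R) : mu.-integrable D (EFin \o f) ->
  mu.-integrable D (EFin \o g) -> mu.-integrable D (EFin \o (fun t => f t + g t)).
Proof. by move=> fi gi; apply: eq_integrable (integrableD _ fi gi). Qed.

Lemma integrable_on_sub (f g : R -> R) : mu.-integrable D (EFin \o f) ->
  mu.-integrable D (EFin \o g) -> mu.-integrable D (EFin \o (fun t => f t - g t)).
Proof. by move=> fi gi; apply: eq_integrable (integrableB _ fi gi). Qed.

Lemma integrable_on_scale (c : R) (f : R -> R) : mu.-integrable D (EFin \o f) ->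
  mu.-integrable D (EFin \o (fun t => f t * c)).
Proof.
by move=> fi; apply: eq_integrable (integrableZr _ c fi).
Qed.

Lemma sf_rdotE s z t : rdot (sf_fun s t) z = \sum_(i < sf_size s) \1_(sf_set i) t * rdot (sf_val i) z.
Proof. by rewrite /sf_fun rdot_suml; apply: eq_bigr => i _; rewrite rdotZl. Qed.

Lemma integrable_indicM (A : set R) (c : R) : measurable A ->
  mu.-integrable D (EFin \o (fun t => \1_A t * c)).
Proof.
move=> mA; apply: measurable_bounded_integrable => //.
  by apply: measurable_funM => //; exact: measurable_indic.
exists `|c|; split; first exact: num_real.
move=> M cM t _ /=; rewrite normrM (le_trans _ (ltW cM))// ler_piMl// indicE.
by case: (_ \in _); rewrite ?normr1 ?normr0.
Qed.

Lemma integrable_sf_rdot s z : mu.-integrable D (EFin \o (fun t => rdot (sf_fun s t) z)).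
Proof.
rewrite (_ : _ \o _ = fun t => (\sum_(i < sf_size s) (\1_(sf_set i) t * rdot (sf_val i) z)%:E)%E).
  apply: integrable_sum => // i _; apply: integrable_indicM; exact: sf_measurable.
by apply/funext => t; rewrite /= sf_rdotE sumEFin.
Qed.

Lemma sf_rdot_integral s z :
  rdot (sf_integral D s) z = \int[mu]_(t in D) rdot (sf_fun s t) z.
Proof.
have ii (i : 'I_(sf_size s)) : mu.-integrable D (fun t => (\1_(sf_set i) t * rdot (sf_val i) z)%:E).
  by apply: integrable_indicM; exact: sf_measurable.
have -> : \int[mu]_(t in D) rdot (sf_fun s t) z =
    fine (\int[mu]_(t in D) \sum_(i < sf_size s) (\1_(sf_set i) t * rdot (sf_val i) z)%:E)%E.
  by congr fine; apply: eq_integral => t _; rewrite sf_rdotE sumEFin.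
have -> : (\int[mu]_(t in D) \sum_(i < sf_size s) (\1_(sf_set i) t * rdot (sf_val i) z)%:E =
    \sum_(i < sf_size s) \int[mu]_(t in D) (\1_(sf_set i) t * rdot (sf_val i) z)%:E)%E.
  by apply: integral_sum.
rewrite /sf_integral rdot_suml.
have E (i : 'I_(sf_size s)) : (\int[mu]_(t in D) (\1_(sf_set i) t * rdot (sf_val i) z)%:E =
    (fine (mu (D `&` sf_set i)) * rdot (sf_val i) z)%:E)%E.
  have mA := @sf_measurable R H s i.
  under eq_integral do rewrite mulrC EFinM.
  rewrite integralZl//; last first.
    apply: eq_integrable (integrable_indicM 1 mA) => // t _.
    by rewrite /= mulr1.
  rewrite integral_indic// setIC [RHS]EFinM muleC fineK// ge0_fin_numE//.
  apply: le_lt_trans D_fin; apply: le_measure; rewrite ?inE//; exact: measurableI.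
rewrite (eq_bigr (fun i => (fine (mu (D `&` sf_set i)) * rdot (sf_val i) z)%:E)); last by move=> i _; exact: E.
by rewrite sumEFin/=; apply: eq_bigr => i _; rewrite rdotZl.
Qed.

Lemma measurable_sf_crd s m : measurable_fun D (crd m \o sf_fun s).
Proof. by have /integrableP[/measurable_EFinP] := integrable_sf_rdot s (rbasis e m). Qed.

Lemma measurable_sub_sf g s : (forall m, measurable_fun D (crd m \o g)) ->
  forall m, measurable_fun D (crd m \o (fun t => g t - sf_fun s t)).
Proof.
move=> mg m; rewrite (_ : _ \o _ = (fun t => crd m (g t) - crd m (sf_fun s t))).
  by apply: measurable_funB; [exact: mg|exact: measurable_sf_crd].
by apply/funext => t; rewrite /= crdB.
Qed.

(** A coordinate is a linear form of norm 1: it commutes with the integral of simple functions, and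
    both sides pass to the limit. *)
Lemma bochner_crd g y m : bochner_integral D g y ->
  mu.-integrable D (EFin \o (fun t => crd m (g t))) /\
  crd m y = \int[mu]_(t in D) crd m (g t).
Proof.
move=> [mg [s [s0 sy]]].
have mcg k := vmeasurable_crd hdot he k mD mg.
(* Convergence to 0 in the extended reals makes the errors finite only from some rank on;
   integrability of the coordinate is drawn from the approximant of that rank. *)
have [N _ sN] : \forall n \near \oo, (\int[mu]_(t in D) (rnorm (g t - sf_fun (s n) t))%:E < +oo)%E.
  have /fine_cvgP[+ _] := s0; apply: filterS => n.
  by rewrite fin_numElt => /andP[].
have mrn n : measurable_fun D (fun t => rnorm (g t - sf_fun (s n) t)).
  by apply: measurable_rnorm; exact: measurable_sub_sf.
have irn n : (N <= n)%N -> mu.-integrable D (EFin \o (fun t => rnorm (g t - sf_fun (s n) t))).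
  by move=> Nn; apply: integrable_ge0_fin (sN n Nn) => // t _; exact: rnorm_ge0.
have icd n : (N <= n)%N -> mu.-integrable D (EFin \o (fun t => crd m (g t) - crd m (sf_fun (s n) t))).
  move=> Nn; apply: le_integrable (irn n Nn) => //.
    by apply/measurable_EFinP; apply: measurable_funB; [exact: mcg|exact: measurable_sf_crd].
  move=> t _; rewrite /= lee_fin -crdB (le_trans (crd_le hdot he _ _))// (ger0_norm (rnorm_ge0 _))//.
have isf n : mu.-integrable D (EFin \o (fun t => crd m (sf_fun (s n) t))).
  exact: integrable_sf_rdot.
have ig : mu.-integrable D (EFin \o (fun t => crd m (g t))).
  apply: eq_integrable (integrable_on_add (icd N (leqnn N)) (isf N)) => // t _.
  by rewrite /= subrK.
split=> //.
have c1 : crd m (sf_integral D (s n)) @[n --> \oo] --> crd m y.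
  by apply: (crd_cvg hdot he).
have c2 : crd m (sf_integral D (s n)) @[n --> \oo] --> \int[mu]_(t in D) crd m (g t).
  apply/cvgrPdist_le => eps eps0.
  have /fine_cvgP[_ /cvgrPdist_le/(_ _ eps0)[N' _ H']] := s0.
  exists (maxn N N') => // n /= ; rewrite geq_max => /andP[Nn N'n].
  have -> : \int[mu]_(t in D) crd m (g t) - crd m (sf_integral D (s n)) =
      \int[mu]_(t in D) (crd m (g t) - crd m (sf_fun (s n) t)).
    rewrite /crd sf_rdot_integral; apply/esym; apply: RintegralB => //.
    exact: isf.
  have H2 := H' n N'n.
  rewrite sub0r normrN in H2.
  apply: (le_trans (le_normr_Rintegral _ (icd n Nn))) => //.
  apply: le_trans (le_trans (ler_norm _) H2).
  apply: le_Rintegral => //.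
  - exact: integrable_norm (icd n Nn).
  - exact: irn.
  - by move=> t _; rewrite -crdB; exact: crd_le.
by rewrite -(cvg_lim (@Rhausdorff R) c1) (cvg_lim (@Rhausdorff R) c2).
Qed.

(** Agreement is asked on [D] only: the pieces of a [simple_function] need finite measure, so
    indicators are cut down to [D]. *)
Let simple (g : R -> H) := exists s : @simple_function R H, forall t, D t -> sf_fun s t = g t.

Lemma simple0 : simple (fun=> 0).
Proof.
pose s0 : @simple_function R H := @SimpleFunction R H 0%N (fun=> set0) (fun=> 0) (fun=> measurable0)
  (fun=> eq_ind_r (fun x => (x < +oo)%E) (ltry 0) (measure0 mu)).
by exists s0 => t _; rewrite /sf_fun big_ord0.
Qed.

Lemma simpleD g1 g2 : simple g1 -> simple g2 -> simple (fun t => g1 t + g2 t).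
Proof.
move=> [s1 h1] [s2 h2].
pose S (i : 'I_(sf_size s1 + sf_size s2)) : set R :=
  match fintype.split i with inl j => sf_set j | inr j => sf_set j end.
pose V (i : 'I_(sf_size s1 + sf_size s2)) : H :=
  match fintype.split i with inl j => sf_val j | inr j => sf_val j end.
have mS i : measurable (S i) by rewrite /S; case: fintype.split => j; exact: sf_measurable.
have fS i : (mu (S i) < +oo)%E by rewrite /S; case: fintype.split => j; exact: sf_finite.
exists (SimpleFunction V mS fS) => t Dt; rewrite -h1// -h2// /sf_fun/= big_split_ord/=.
congr (_ + _); apply: eq_bigr => i _; rewrite /S /V.
- have -> : fintype.split (lshift (sf_size s2) i) = inl i by rewrite -[lshift _ _]/(unsplit (inl i)) unsplitK.
  by [].
- have -> : fintype.split (rshift (sf_size s1) i) = inr i by rewrite -[rshift _ _]/(unsplit (inr i)) unsplitK.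
  by [].
Qed.

Lemma simple_indic (A : set R) z : measurable A -> simple (fun t => rscale (\1_A t) z).
Proof.
move=> mA.
have m1 (i : 'I_1) : measurable (D `&` A) by exact: measurableI.
have f1 (i : 'I_1) : (mu (D `&` A) < +oo)%E.
  by apply: le_lt_trans D_fin; apply: le_measure; rewrite ?inE//; exact: measurableI.
exists (@SimpleFunction R H 1%N (fun=> D `&` A) (fun=> z) m1 f1) => t Dt.
by rewrite /sf_fun big_ord1/= indicI/= [\1_D t]indicE mem_set// mul1r.
Qed.

Lemma simple_sum (I : Type) (r : seq I) (G : I -> R -> H) : (forall i, simple (G i)) ->
  simple (fun t => \sum_(i <- r) G i t).
Proof.
move=> sG; elim: r => [|i r ih].
  by have [s hs] := simple0; exists s => t Dt; rewrite big_nil hs.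
by have [s hs] := simpleD (sG i) ih; exists s => t Dt; rewrite big_cons hs.
Qed.

Lemma simple_sfun (phi : {sfun g_sigma_algebraType R.-ocitv.-measurable >-> R}) z : simple (fun t => rscale (phi t) z).
Proof.
have fr : finite_set (range phi) by exact: fimfunP.
have [s hs] := simple_sum (finmap.enum_fset (fset_set (range phi)))
  (G := fun y t => rscale (\1_(phi @^-1` [set y]) t) (rscale y z))
  (fun y => simple_indic (rscale y z) (measurable_sfunP phi (measurable_set1 y))).
exists s => t Dt; rewrite hs// (fimfunE phi t) fsbig_finite//=.
rewrite /rscale rmorph_sum/= scaler_suml; apply: eq_bigr => y _.
by rewrite scalerA -rmorphM/= mulrC.
Qed.

(** Two stages: projection on the first [n] real coordinates, by dominated convergence since the
    tails are at most [rnorm (g t)], then a real simple function for each of these coordinates. *)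
Lemma rnorm_bochner_approx g (eps : R) : 0 < eps -> (forall m, measurable_fun D (crd m \o g)) ->
  (\int[mu]_(t in D) (rnorm (g t))%:E < +oo)%E ->
  exists s : @simple_function R H, (\int[mu]_(t in D) (rnorm (g t - sf_fun s t))%:E <= eps%:E)%E.
Proof.
move=> eps0 mg ig.
have irg : mu.-integrable D (EFin \o (fun t => rnorm (g t))).
  by apply: integrable_ge0_fin ig => [|t _]; [exact: measurable_rnorm|exact: rnorm_ge0].
pose P n t := rpartial e (crd^~ (g t)) n.
have mP n m : measurable_fun D (crd m \o P n).
  rewrite (_ : _ \o _ = if (m < n)%N then crd m \o g else cst 0).
    by case: ifP => _; [exact: mg|exact: measurable_cst].
  by apply/funext => t; rewrite /= crd_rpartial//; case: ifP.
have mgP n m : measurable_fun D (crd m \o (fun t => g t - P n t)).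
  rewrite (_ : _ \o _ = (fun t => crd m (g t) - crd m (P n t))).
    by apply: measurable_funB; [exact: mg|exact: mP].
  by apply/funext => t; rewrite /= crdB.
have tail_le x n : rnorm (x - rpartial e (crd^~ x) n) <= rnorm x.
  rewrite -(ler_pXn2r (n := 2)) ?nnegrE ?rnorm_ge0// (rnorm_sub_rpartial hdot he).
  by rewrite gerBl sumr_ge0// => k _; exact: sqr_ge0.
have tail0 x : rnorm (x - rpartial e (crd^~ x) n) @[n --> \oo] --> (0 : R).
  have [y [yl yE]] := synth_exists hdot he (@cvg_crd R H dot hdot e he x).
  have <- : y = x by apply: (crd_inj hdot he) => m; rewrite yE.
  apply/cvg_rnormP; rewrite (_ : (fun n => _) = rpartial e (crd^~ x))//.
  by apply/funext => n; congr rpartial; apply/funext => m; rewrite yE.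
have mrP n : measurable_fun D (fun t => rnorm (g t - P n t)) by apply: measurable_rnorm; exact: mgP.
have cP : (\int[mu]_(t in D) (rnorm (g t - P n t))%:E @[n --> \oo] --> 0)%E.
  have [] := @dominated_convergence _ _ R mu D mD
    (fun n t => (rnorm (g t - P n t))%:E) (fun=> 0%E) (EFin \o (fun t => rnorm (g t))).
  - by move=> n; have /measurable_EFinP := mrP n.
  - exact: measurable_cst.
  - by apply: aeW => t _; apply: cvg_EFin; [exact: nearW|exact: tail0].
  - exact: irg.
  - by apply: aeW => t n _; rewrite /= lee_fin ger0_norm ?rnorm_ge0// tail_le.
  by move=> _ _; rewrite integral0.
have e20 : 0 < eps / 2 by rewrite divr_gt0.
have [n nP] : exists n, (\int[mu]_(t in D) (rnorm (g t - P n t))%:E <= (eps / 2)%:E)%E.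
  move/fine_cvgP : cP => [F1 /cvgr0Pnorm_le/(_ _ e20) F2].
  have [N _ /(_ N (leqnn N))[N1 N2]] := filterI F1 F2.
  exists N; rewrite -(fineK N1) lee_fin; apply: le_trans N2; exact: ler_norm.
have icm m : mu.-integrable D (EFin \o (crd m \o g)).
  apply: le_integrable irg => //; first by have /measurable_EFinP := mg m.
  by move=> t _; rewrite /= lee_fin (le_trans (crd_le hdot he _ _))// (ger0_norm (rnorm_ge0 _))//.
(* The [n] coordinate errors then add up to less than [eps / 2]; [n.+1] keeps the quotient
   meaningful at [n = 0]. *)
pose del := eps / 2 / n.+1%:R.
have del0 : 0 < del by rewrite divr_gt0.
have /choice[phi phiP] : forall m, exists phi : {sfun g_sigma_algebraType R.-ocitv.-measurable >-> R},
    mu.-integrable D (EFin \o phi) /\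
    (\int[mu]_(t in D) (`|crd m (g t) - phi t|)%:E <= del%:E)%E.
  move=> m; have [h [ih _ hc]] := @approximation_sfun_integrable _ _ R mu D mD _ (icm m).
  move/fine_cvgP : hc => [F1 /cvgr0Pnorm_le/(_ _ del0) F2].
  have [N _ /(_ N (leqnn N))[N1 N2]] := filterI F1 F2.
  exists (h N); split; first exact: ih.
  rewrite -[X in (X <= _)%E](_ : \int[mu]_(z in D) `|(EFin \o (crd m \o g)) z - (h N z)%:E| = _)%E//.
  rewrite -(fineK N1) lee_fin; apply: le_trans N2; exact: ler_norm.
have [s sE] := simple_sum (index_iota 0 n) (G := fun m t => rscale (phi m t) (rbasis e m))
  (fun m => simple_sfun (phi m) (rbasis e m)).
exists s.
have mphi m : measurable_fun D (phi m : R -> R).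
  by have [/integrableP[/measurable_EFinP]] := phiP m.
have md m : measurable_fun D (fun t => `|crd m (g t) - phi m t|).
  by apply: measurableT_comp => //; apply: measurable_funB; [exact: mg|exact: mphi].
have mrPE : measurable_fun D (fun t => (rnorm (g t - P n t))%:E).
  by have /measurable_EFinP := mrP n.
have mdE m : measurable_fun D (fun t => (`|crd m (g t) - phi m t|)%:E).
  by have /measurable_EFinP := md m.
apply: (@le_trans _ _ (\int[mu]_(t in D) ((rnorm (g t - P n t))%:E +
    \sum_(0 <= m < n) (`|crd m (g t) - phi m t|)%:E))%E).
  apply: ge0_le_integral => //=.
  - by move=> t _; rewrite lee_fin rnorm_ge0.
  - by have /measurable_EFinP := measurable_rnorm (measurable_sub_sf s mg).
  - apply: emeasurable_funD; first exact: mrPE.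
    by apply: emeasurable_sum => m; exact: mdE.
  - move=> t Dt; rewrite sumEFin -EFinD lee_fin sE//.
    rewrite (_ : g t - _ = (g t - P n t) + (P n t - \sum_(i <- index_iota 0 n) rscale (phi i t) (rbasis e i))); last first.
      by rewrite addrA subrK.
    rewrite (le_trans (rnormD _ _))// lerD2l /P /rpartial -sumrB (le_trans (rnorm_sum _ _))//.
    apply: ler_sum => m _.
    rewrite -[X in rnorm X](_ : rscale (crd m (g t) - phi m t) (rbasis e m) = _).
      by rewrite rnormZ (rnorm_rbasis hdot he) mulr1.
    by rewrite /rscale rmorphB/= scalerBl.
rewrite ge0_integralD//=; last 3 first.
- by move=> t _; rewrite lee_fin rnorm_ge0.
- by move=> t _; apply: sume_ge0 => m _; rewrite lee_fin.
- by apply: emeasurable_sum => m; exact: mdE.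
rewrite ge0_integral_sum//=.
apply: (@le_trans _ _ ((eps / 2)%:E + \sum_(0 <= m < n) del%:E)%E).
  by apply: leeD => //; apply: lee_sum => m _; have [] := phiP m.
rewrite sumEFin -EFinD lee_fin sumr_const_nat subn0 /del -mulr_natl.
have n0 : 0 < n.+1%:R :> R by [].
rewrite (_ : _ + _ = eps / 2 * (1 + n%:R / n.+1%:R)); last by field; rewrite gt_eqF.
rewrite -[leRHS](_ : eps / 2 * 2 = eps); last by field.
rewrite ler_wpM2l// ?(ltW e20)// -[leRHS]/(1 + 1 : R) lerD2l ler_pdivrMr// mul1r ler_nat.
exact: leqnSn.
Qed.

Lemma bochner_exists g : (forall m, measurable_fun D (crd m \o g)) ->
  (\int[mu]_(t in D) (rnorm (g t))%:E < +oo)%E -> exists y, bochner_integral D g y.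
Proof.
move=> mg ig.
have h0 n : 0 < n.+1%:R^-1 :> R by rewrite invr_gt0.
have /choice[s sP] := fun n => rnorm_bochner_approx (h0 n) mg ig.
have mrn n : measurable_fun D (fun t => rnorm (g t - sf_fun (s n) t)).
  by apply: measurable_rnorm; exact: measurable_sub_sf.
have irn n : mu.-integrable D (EFin \o (fun t => rnorm (g t - sf_fun (s n) t))).
  by apply: integrable_ge0_fin (le_lt_trans (sP n) (ltry _)) => // t _; exact: rnorm_ge0.
have In n : \int[mu]_(t in D) rnorm (g t - sf_fun (s n) t) <= n.+1%:R^-1.
  by rewrite -lee_fin /Rintegral fineK ?sP//; exact: integrable_fin_num (irn n).
(* Pairing the difference [z] of the two integrals with [z] itself turns its squared norm into a
   scalar integral, at most [rnorm z] times the sum of the two errors. The integrals are therefore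
   Cauchy. *)
have diff n k : rnorm (sf_integral D (s n) - sf_integral D (s k)) <= n.+1%:R^-1 + k.+1%:R^-1.
  set z := sf_integral D (s n) - _.
  have [->|z0] := eqVneq (rnorm z) 0; first by rewrite addr_ge0// invr_ge0.
  have zp : 0 < rnorm z by rewrite lt_neqAle eq_sym z0 rnorm_ge0.
  rewrite -(ler_pM2r zp) -expr2 (rnorm_sqr hdot) {1}/z rdotBl !sf_rdot_integral.
  have isn := integrable_sf_rdot (s n) z; have isk := integrable_sf_rdot (s k) z.
  have <- : \int[mu]_(t in D) (rdot (sf_fun (s n) t) z - rdot (sf_fun (s k) t) z) =
    \int[mu]_(t in D) rdot (sf_fun (s n) t) z - \int[mu]_(t in D) rdot (sf_fun (s k) t) z.
    by apply: RintegralB.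
  have ib : mu.-integrable D (EFin \o (fun t => (rnorm (g t - sf_fun (s n) t) + rnorm (g t - sf_fun (s k) t)) * rnorm z)).
    by apply: integrable_on_scale; exact: integrable_on_add.
  apply: (@le_trans _ _ (\int[mu]_(t in D) ((rnorm (g t - sf_fun (s n) t) + rnorm (g t - sf_fun (s k) t)) * rnorm z))).
    apply: le_Rintegral => //.
      exact: integrable_on_sub.
    move=> t _; rewrite -rdotBl (le_trans (ler_norm _))// (le_trans (rdot_le hdot _ _))//.
    rewrite ler_wpM2r ?rnorm_ge0// (rnormB (g t)) [leRHS]addrC.
    rewrite (_ : sf_fun (s n) t - sf_fun (s k) t = (g t - sf_fun (s k) t) + (sf_fun (s n) t - g t)); last first.
      by rewrite [RHS]addrC addrA subrK.
    exact: rnormD.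
  rewrite RintegralZr//; last exact: integrable_on_add.
  by rewrite RintegralD// ler_wpM2r ?rnorm_ge0// lerD.
have cI : cauchy (sf_integral D (s n) @[n --> \oo]).
  apply/cauchy_ballP => eps eps0.
  have eE : eps = (complex.Re eps)%:C%C by rewrite RRe_real// gtr0_real.
  rewrite eE ltcR in eps0 *.
  have [N NP] : exists N : nat, N.+1%:R^-1 < complex.Re eps / 2.
    exists (Num.truncn (complex.Re eps / 2)^-1); rewrite invf_plt ?posrE ?divr_gt0//.
    exact: truncnS_gt.
  exists ((fun n => sf_integral D (s n)) @` [set n | (N <= n)%N],
          (fun n => sf_integral D (s n)) @` [set n | (N <= n)%N]).
    by split; exists N => // n /= Nn; exists n.
  move=> [_ _] [/= [n Nn <-] [k Nk <-]]; rewrite -ball_normE/= norm_rnorm ltcR.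
  apply: (le_lt_trans (diff n k)).
  have H1 (m : nat) : (N <= m)%N -> m.+1%:R^-1 <= N.+1%:R^-1 :> R.
    by move=> Nm; rewrite lef_pV2 ?posrE// ler_nat.
  by have := H1 n Nn; have := H1 k Nk; move: NP; set A := n.+1%:R^-1; set B := k.+1%:R^-1; set C := N.+1%:R^-1; lra.
move/cauchy_cvgP : cI => cI.
exists (lim (sf_integral D (s n) @[n --> \oo])); split.
  by apply/(vmeasurableP hdot he hsep _ mD).
exists s; split; last exact: cI.
apply: (@squeeze_cvge _ _ _ _ (cst 0%E) _ (fun n => (n.+1%:R^-1 : R)%:E)).
- apply: nearW => n; rewrite sP andbT; apply: integral_ge0 => t _.
  by rewrite lee_fin rnorm_ge0.
- exact: cvg_cst.
- by apply: cvg_EFin; [exact: nearW|exact: cvg_harmonic].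
Qed.

End Bochner.

(** * The kernel *)

Section ExpKernel.
Context {R : realType}.
Variables (c gamma : nat -> R) (kap : R).
Hypothesis c_gt0 : forall k, 0 < c k.
Hypothesis gamma_gt0 : forall k, 0 < gamma k.
Hypothesis kap_cvg : series (fun k => c k / gamma k) n @[n --> \oo] --> kap.
Notation mu := (@lebesgue_measure R).
Notation K := (exp_kernel c gamma).

Lemma expRN_le (x : R) : 0 < x -> expR (- x) <= x^-1.
Proof.
move=> x0; rewrite expRN lef_pV2 ?posrE ?expR_gt0//.
by rewrite (le_trans _ (expR_ge1Dx x))// lerDr.
Qed.

(** As [e^{- gamma_k tau} <= 1 / (gamma_k tau)], the series is majorized by that of [c_k / gamma_k],
    whether or not [Sum_k c_k] converges. *)
Lemma exp_kernel_cvg tau : 0 < tau ->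
  series (fun k => c k * expR (- (gamma k * tau))) n @[n --> \oo] --> K tau.
Proof.
move=> tau0.
suff [s [sl _]] : exists s, series (fun k => c k * expR (- (gamma k * tau))) n @[n --> \oo] --> s /\
    forall n, `|s - series (fun k => c k * expR (- (gamma k * tau))) n| <=
      tau^-1 * (kap - series (fun k => c k / gamma k) n).
  by apply: cvgP sl.
apply: majorized_series kap_cvg => k.
rewrite ger0_norm; last by rewrite mulr_ge0 ?expR_ge0// ltW.
rewrite mulrCA ler_wpM2l ?(ltW (c_gt0 k))//.
by rewrite (le_trans (expRN_le _)) ?mulr_gt0// invfM mulrC.
Qed.

Lemma exp_kernel_ge tau n : 0 < tau ->
  series (fun k => c k * expR (- (gamma k * tau))) n <= K tau.
Proof.
move=> tau0; apply: series_le_lim => [k|]; first by rewrite mulr_ge0 ?expR_ge0// ltW.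
by apply/cvg_ex; exists (K tau); exact: exp_kernel_cvg.
Qed.

Lemma exp_kernel_ge0 tau : 0 < tau -> 0 <= K tau.
Proof. by move=> /(exp_kernel_ge 0); apply: le_trans; rewrite /series/= big_geq. Qed.

Lemma bdd_meas_exp_sub t k : bdd_meas t (fun s => c k * expR (- (gamma k * (t - s)))).
Proof.
rewrite (_ : (fun _ => _) = fun s => (c k * expR (- (gamma k * t))) * expR (gamma k * s)).
  by apply: bdd_measZ; exact: bdd_meas_expRM.
by apply/funext => s; rewrite mulrBr opprB expRD; ring.
Qed.

Lemma prim_exp_sub t k x : 0 <= t -> bdd_meas t x ->
  prim (fun s => c k * expR (- (gamma k * (t - s))) * x s) t = c k * exp_conv (gamma k) x t.
Proof.
move=> t0 bx; rewrite /exp_conv mulrA -(primZ _ (lexx t)); last first.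
  by apply: bdd_meas_L1; apply: bdd_measM => //; exact: bdd_meas_expRM.
apply: eq_prim => s _; rewrite mulrBr opprB expRD mulNr; ring.
Qed.

Lemma measurable_kernel_sub (t : R) : measurable_fun `]0, t[ (fun s => K (t - s)).
Proof.
apply: (@measurable_fun_cvg _ _ R `]0, t[
  (fun n s => series (fun k => c k * expR (- (gamma k * (t - s)))) n)).
  move=> n; have [] // := @bdd_meas_sum R t n (fun k s => c k * expR (- (gamma k * (t - s)))).
  by move=> k; exact: bdd_meas_exp_sub.
move=> s /=; rewrite in_itv/= => /andP[s0 st]; apply: exp_kernel_cvg.
by rewrite subr_gt0.
Qed.

(** Tonelli: the terms have integrals at most [c_k / gamma_k] over []0, t[], and these sum to [kap].
    A singularity at [s = t] is thus integrable. *)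
Lemma L1_kernel_sub t : 0 < t -> L1 t (fun s => K (t - s)).
Proof.
move=> t0; apply: integrable_ge0_fin => //.
- exact: measurable_kernel_sub.
- by move=> s /=; rewrite in_itv/= => /andP[_ st]; rewrite exp_kernel_ge0// subr_gt0.
pose f k (s : R) : \bar R := (c k * expR (- (gamma k * (t - s))))%:E.
have f0 k s : (0 <= f k s)%E by rewrite lee_fin mulr_ge0 ?expR_ge0// ltW.
have -> : (\int[mu]_(s in `]0%R, t[) (K (t - s))%:E =
    \int[mu]_(s in `]0%R, t[) \sum_(0 <= k <oo) f k s)%E.
  apply: eq_integral => s; rewrite inE/= in_itv/= => /andP[_ st].
  rewrite nneseries_lim//; first by move=> k; have := f0 k s; rewrite lee_fin.
  by apply/cvg_ex; exists (K (t - s)); apply: exp_kernel_cvg; rewrite subr_gt0.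
rewrite integral_nneseries//; last first.
  move=> k; have [mb _] := bdd_meas_exp_sub t k; exact/measurable_EFinP.
have b0 k : 0 <= c k / gamma k by rewrite divr_ge0// ltW.
have cb : cvgn (series (fun k => c k / gamma k)) by apply/cvg_ex; exists kap.
apply: (@le_lt_trans _ _ (\sum_(0 <= k <oo) (c k / gamma k)%:E)%E); last exact/nneseries_ltyP.
apply: lee_nneseries => [k _ _|k _].
  by apply: integral_ge0 => s _; exact: f0.
have := prim_exp_sub k (ltW t0) (bdd_meas_cst t 1).
rewrite -[X in X = _](_ : prim (fun s => c k * expR (- (gamma k * (t - s)))) t = _); last first.
  by apply: eq_prim => s _; rewrite mulr1.
move=> E.
have := primEFin (lexx t) (bdd_meas_L1 (bdd_meas_exp_sub t k)); rewrite E => P.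
apply: (@le_trans _ _ (c k * exp_conv (gamma k) (fun=> 1) t)%:E); first by rewrite P.
rewrite lee_fin ler_wpM2l ?(ltW (c_gt0 k))//.
have := @exp_conv_le R t (gamma k) (fun=> 1) 1 0 t (gamma_gt0 k) (lexx _) ler01.
rewrite (ltW t0) lexx !mul0r expR0 !mul1r => /(_ isT (bdd_meas_cst t 1)) H.
by apply: le_trans (ler_norm _) (H _) => s _; rewrite mul0r expR0 mulr1 normr1.
Qed.

(** Dominated convergence with majorant [K (t - s) * M]. It identifies the termwise convolution of
    the scalar theory with the integral of the equation. *)
Lemma prim_kernel_conv t x : 0 < t -> bdd_meas t x ->
  prim (fun s => K (t - s) * x s) t = kconv c gamma x t.
Proof.
move=> t0 bx; have [mx [M xM]] := bx.
have c1 : prim (fun s => series (fun k => c k * expR (- (gamma k * (t - s)))) n * x s) t @[n --> \oo]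
    --> prim (fun s => K (t - s) * x s) t.
  apply: (@prim_cvg R t _ _ (fun s => K (t - s) * M)) => //.
  - move=> n; apply: bdd_meas_L1; apply: bdd_measM => //.
    by apply: bdd_meas_sum => k; exact: bdd_meas_exp_sub.
  - by apply: measurable_funM => //; exact: measurable_kernel_sub.
  - by apply: integrable_on_scale => //; exact: L1_kernel_sub.
  - move=> s /andP[_ st]; apply: cvgMr_tmp; apply: exp_kernel_cvg; by rewrite subr_gt0.
  - move=> n s /andP[s0 st]; rewrite normrM ler_pM// ?xM ?s0//.
    have E0 : 0 <= series (fun k => c k * expR (- (gamma k * (t - s)))) n.
      by apply: sumr_ge0 => k _; rewrite mulr_ge0 ?expR_ge0// ltW.
    by rewrite ger0_norm// exp_kernel_ge// subr_gt0.
apply: (cvg_unique (@Rhausdorff R) c1).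
rewrite (_ : (fun n => _) = series (fun k => c k * exp_conv (gamma k) x t)).
  by have := @kconv_cvg R c gamma kap t c_gt0 gamma_gt0 kap_cvg x t; rewrite (ltW t0) lexx; apply.
apply/funext => n; rewrite /series/=.
transitivity (prim (fun s => \sum_(0 <= k < n) c k * expR (- (gamma k * (t - s))) * x s) t).
  by apply: eq_prim => s _; rewrite mulr_suml.
rewrite (@prim_sum R t)//.
- by apply: eq_bigr => k _; rewrite prim_exp_sub// ltW.
- by rewrite (ltW t0) lexx.
- by move=> k; apply: bdd_meas_L1; apply: bdd_measM => //; exact: bdd_meas_exp_sub.
Qed.

End ExpKernel.

(** * Weak derivatives in coordinates *)

Section LimitsAtZero.
Context {R : realType}.
Variable T : R.
Hypothesis T_gt0 : 0 < T.
Notation mu := (@lebesgue_measure R).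

(** An interval []0, del'[] has positive measure and cannot lie in the exceptional set. Almost
    everywhere equal functions thus meet arbitrarily close to 0, which suffices to compare limits at
    0. *)
Lemma ae_on_ex (P : R -> Prop) (del : R) : ae_on T P -> 0 < del -> exists t, 0 < t < T /\ t < del /\ P t.
Proof.
move=> aeP del0; apply: contrapT => nP.
pose del' := Num.min del T.
have del'0 : 0 < del' by rewrite lt_min del0.
have negl : mu.-negligible (`]0, del'[%classic : set R).
  apply: negligibleS aeP => t /=; rewrite in_itv/= => /andP[t0].
  rewrite lt_min => /andP[tdel tT] Q; apply: nP; exists t; rewrite t0 tT; split=> //; split=> //.
  by apply: Q; rewrite in_itv/= t0.
have : mu `]0, del'[ = 0%E by apply: (measure_negligible _ negl).
rewrite lebesgue_measure_itv/= lte_fin del'0 -EFinB/= subr0 => -[] /eqP.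
by rewrite gt_eqF.
Qed.

Lemma ae_right_lim_unique (f w : R -> R) (l l' : R) : ae_on T (fun t => f t = w t) ->
  f t @[t --> 0^'+] --> l -> w t @[t --> 0^'+] --> l' -> l = l'.
Proof.
move=> fw fl wl; apply/eqP; rewrite -subr_eq0 -normr_le0; apply/ler_addgt0Pr => eps eps0.
have e20 : 0 < eps / 2 by rewrite divr_gt0.
have /cvgrPdist_le/(_ _ e20) F1 := fl.
have /cvgrPdist_le/(_ _ e20) F2 := wl.
have [del /= del0 H] := filterI F1 F2.
have [t [/andP[t0 tT] [tdel ft]]] := ae_on_ex fw del0.
have [] := H t; first by rewrite /= sub0r normrN gtr0_norm.
  exact: t0.
rewrite ft add0r => H1 H2; rewrite (_ : l - l' = (l - w t) - (l' - w t)); last by ring.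
apply: (le_trans (ler_normB _ _)); rewrite [leRHS](_ : eps = eps / 2 + eps / 2); last by field.
exact: lerD.
Qed.

(** By Cauchy-Schwarz, primitives of square-integrable functions are of order [sqrt t] at 0; this
    turns such bounds into initial values. *)
Lemma sqr_le_linear_cvg0 (f : R -> R) (C : R) :
  (forall t, 0 < t < T -> f t ^+ 2 <= C * t) -> f t @[t --> 0^'+] --> (0 : R).
Proof.
move=> fC; apply/cvgrPdist_le => eps eps0.
pose M := `|C| + 1; have M0 : 0 < M by rewrite ltr_wpDl.
near=> t.
have t0 : 0 < t by near: t; exact: nbhs_right_gt.
have tT : t < T by near: t; exact: nbhs_right_lt.
have te : t < eps ^+ 2 / M.
  by near: t; apply: nbhs_right_lt; rewrite divr_gt0 ?exprn_gt0.
rewrite sub0r normrN -(ler_pXn2r (n := 2)) ?nnegrE ?(ltW eps0)// real_normK ?num_real//.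
apply: (le_trans (fC t _)); first by rewrite t0.
apply: (@le_trans _ _ (M * t)).
  rewrite ler_wpM2r ?(ltW t0)// /M; apply: (le_trans (ler_norm C)); by rewrite lerDl.
by rewrite mulrC -ler_pdivlMr// ltW.
Unshelve. all: by end_near.
Qed.

End LimitsAtZero.

(** * Square-integrable functions and their weak derivatives *)

Section WeakDerivatives.
Context {R : realType} {H : completeNormedModType R[i]}.
Variable dot : {dot H for Num.conj}.
Hypothesis hdot : hilbert_dot dot.
Variable e : nat -> H.
Hypothesis he : orthonormal_basis dot e.
Hypothesis hsep : separable_space H.
Variable T : R.
Hypothesis T_gt0 : 0 < T.
Notation mu := (@lebesgue_measure R).
Notation crd := (crd dot e).
Implicit Types (u v g : R -> H) (phi : R -> R).

Lemma L1_dominated (h k : R -> R) : measurable_fun `]0, T[ h -> L1 T k ->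
  (forall t, 0 < t < T -> `|h t| <= k t) -> L1 T h.
Proof.
move=> mh ik hk; apply: le_integrable ik => //; first exact/measurable_EFinP.
move=> t /=; rewrite in_itv/= => tT; rewrite lee_fin.
by rewrite (le_trans (hk t tT))// ler_norm.
Qed.

Lemma L1_of_sqr (h : R -> R) : measurable_fun `]0, T[ h -> L1 T (fun t => h t ^+ 2) -> L1 T h.
Proof.
move=> mh ih; apply: (@L1_dominated _ (fun t => 1 + h t ^+ 2)) => //.
  by apply: L1D => //; exact: L1_cst.
move=> t _; rewrite -(real_normK (num_real (h t))).
by have := normr_ge0 (h t); move: (`|h t|) => z z0; nra.
Qed.

Lemma L1_sqr_dominated (h k : R -> R) : measurable_fun `]0, T[ h -> L1 T k ->
  (forall t, 0 < t < T -> h t ^+ 2 <= k t) -> L1 T (fun t => h t ^+ 2) /\ L1 T h.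
Proof.
move=> mh ik hk.
have i2 : L1 T (fun t => h t ^+ 2).
  apply: L1_dominated ik _; first exact: measurable_funX.
  by move=> t tT; rewrite ger0_norm ?sqr_ge0// hk.
by split=> //; exact: L1_of_sqr.
Qed.

Lemma vmeasurable_crd_oo g m : vmeasurable `]0, T[ g -> measurable_fun `]0, T[ (fun t => crd m (g t)).
Proof. by move=> mg; apply: (vmeasurable_crd hdot he m _ mg); exact: itv_oo_meas. Qed.

Lemma in_L2_sqr g : in_L2 T g -> L1 T (fun t => rnorm (g t) ^+ 2).
Proof.
move=> [mg ig]; apply: integrable_ge0_fin ig => //; last by move=> t _; exact: sqr_ge0.
by apply: (rnorm_measurable hdot he); [exact: itv_oo_meas|move=> m; exact: vmeasurable_crd_oo].
Qed.

Lemma crd_sqr_le m (x : H) : crd m x ^+ 2 <= rnorm x ^+ 2.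
Proof.
by rewrite -(real_normK (num_real (crd m x))) ler_pXn2r ?nnegrE ?rnorm_ge0// (crd_le hdot he).
Qed.

Lemma in_L2_crd g m : in_L2 T g -> L1 T (fun t => crd m (g t) ^+ 2) /\ L1 T (fun t => crd m (g t)).
Proof.
move=> g2; apply: L1_sqr_dominated (in_L2_sqr g2) _; last by move=> t _; exact: crd_sqr_le.
by apply: vmeasurable_crd_oo; have [] := g2.
Qed.

Lemma in_L2_rnorm g : in_L2 T g -> L1 T (fun t => rnorm (g t)).
Proof.
move=> g2; apply: L1_of_sqr (in_L2_sqr g2).
apply: (measurable_rnorm hdot he); first exact: itv_oo_meas.
by move=> m; apply: vmeasurable_crd_oo; have [] := g2.
Qed.

Lemma integral_rnorm_sqr g : (forall m, measurable_fun `]0, T[ (fun t => crd m (g t))) ->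
  (\int[mu]_(t in `]0%R, T[) ((rnorm (g t)) ^+ 2)%:E =
   \sum_(0 <= m <oo) \int[mu]_(t in `]0%R, T[) ((crd m (g t)) ^+ 2)%:E)%E.
Proof.
move=> mg; rewrite -integral_nneseries//.
- by apply: eq_integral => t _; exact: (rnorm_sqr_esum hdot he).
- move=> m; have /measurable_EFinP := measurable_funX 2 (mg m); exact.
- by move=> m t _; rewrite lee_fin sqr_ge0.
Qed.

Lemma in_L2_series g : in_L2 T g ->
  cvgn (series (fun m => prim (fun t => crd m (g t) ^+ 2) T)) /\
  limn (series (fun m => prim (fun t => crd m (g t) ^+ 2) T)) = prim (fun t => rnorm (g t) ^+ 2) T.
Proof.
move=> g2; have [mg ig] := g2.
have E : (\int[mu]_(t in `]0%R, T[) ((rnorm (g t)) ^+ 2)%:E =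
    \sum_(0 <= m <oo) (prim (fun t => crd m (g t) ^+ 2) T)%:E)%E.
  rewrite integral_rnorm_sqr; last by move=> m; exact: vmeasurable_crd_oo.
  by apply: eq_eseriesr => m _; rewrite (primEFin (lexx T))//; have [] := in_L2_crd m g2.
have p0 m : 0 <= prim (fun t => crd m (g t) ^+ 2) T by apply: prim_ge0 => t _; exact: sqr_ge0.
have cs : cvgn (series (fun m => prim (fun t => crd m (g t) ^+ 2) T)).
  by apply/nneseries_ltyP => //; rewrite -E.
split=> //; apply: EFin_inj; rewrite -nneseries_lim// -E (primEFin (lexx T))//; exact: in_L2_sqr.
Qed.

Lemma in_L2_of_series g (b : nat -> R) : (forall m, measurable_fun `]0, T[ (fun t => crd m (g t))) ->
  (forall m, L1 T (fun t => crd m (g t) ^+ 2)) ->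
  (forall m, prim (fun t => crd m (g t) ^+ 2) T <= b m) -> cvgn (series b) ->
  in_L2 T g /\ prim (fun t => rnorm (g t) ^+ 2) T <= limn (series b).
Proof.
move=> mg i2 gb cb.
have p0 m : 0 <= prim (fun t => crd m (g t) ^+ 2) T by apply: prim_ge0 => t _; exact: sqr_ge0.
have pb m : 0 <= prim (fun t => crd m (g t) ^+ 2) T <= b m by rewrite p0 gb.
have E : (\int[mu]_(t in `]0%R, T[) ((rnorm (g t)) ^+ 2)%:E =
    \sum_(0 <= m <oo) (prim (fun t => crd m (g t) ^+ 2) T)%:E)%E.
  rewrite integral_rnorm_sqr//.
  by apply: eq_eseriesr => m _; rewrite (primEFin (lexx T)).
have cs := le_cvg_series pb cb.
have g2 : in_L2 T g.
  split; first by apply/(vmeasurableP hdot he hsep _ (itv_oo_meas 0 T)).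
  by rewrite E; apply/nneseries_ltyP.
split=> //; have [_ <-] := in_L2_series g2; exact: le_lim_series.
Qed.

Lemma signC n : ((-1) ^+ n : R[i]) = (((-1) ^+ n : R)%:C)%C.
Proof. by rewrite rmorphXn/= rmorphN1. Qed.

Lemma weak_derivative_crd n u v phi m : weak_derivative T n u v -> test_function T phi ->
  prim (fun t => phi t * crd m (v t)) T =
  (-1) ^+ n * prim (fun t => derive1n n phi t * crd m (u t)) T.
Proof.
move=> wd /wd[y [/(bochner_crd hdot he (itv_oo_meas 0 T) (mu_itvoo_lty 0 T) m)[_ E1]
  /(bochner_crd hdot he (itv_oo_meas 0 T) (mu_itvoo_lty 0 T) m)[_]]].
rewrite signC -[X in crd m X]/(rscale _ _) crdZ E1 => E2.
transitivity (\int[mu]_(t in `]0, T[) crd m (rscale (phi t) (v t))).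
  by apply: eq_prim => t _; rewrite crdZ.
by rewrite -E2; congr (_ * _); apply: eq_prim => t _; rewrite crdZ.
Qed.

Lemma bochner_test phi v : test_function T phi -> in_L2 T v ->
  exists y, bochner_integral `]0, T[ (fun t => rscale (phi t) (v t)) y.
Proof.
move=> tphi v2; have bphi := test_bdd_meas T_gt0 tphi; have [mphi [M phiM]] := bphi.
have mcrd m : measurable_fun `]0, T[ (crd m \o (fun t => rscale (phi t) (v t))).
  rewrite (_ : _ \o _ = fun t => phi t * crd m (v t)).
    by apply: measurable_funM => //; apply: vmeasurable_crd_oo; have [] := v2.
  by apply/funext => t; rewrite /= crdZ.
apply: (bochner_exists hdot he hsep (itv_oo_meas 0 T) (mu_itvoo_lty 0 T) mcrd).
have i1 : L1 T (fun t => rnorm (rscale (phi t) (v t))).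
  apply: L1_dominated (L1Z M (in_L2_rnorm v2)) _.
    by apply: (measurable_rnorm hdot he) => //; exact: itv_oo_meas.
  move=> t tT; rewrite ger0_norm ?rnorm_ge0// rnormZ ler_wpM2r ?rnorm_ge0//.
  exact: phiM.
by rewrite (primEFin (lexx T))// ltry.
Qed.

(** The Bochner integrals exist because test functions are bounded and [u], [v] square integrable;
    their relation can then be checked on coordinates. *)
Lemma weak_derivativeP n u v : in_L2 T u -> in_L2 T v ->
  (forall phi m, test_function T phi -> prim (fun t => phi t * crd m (v t)) T =
    (-1) ^+ n * prim (fun t => derive1n n phi t * crd m (u t)) T) ->
  weak_derivative T n u v.
Proof.
move=> u2 v2 E phi tphi.
have [y By] := bochner_test (test_deriven n tphi) u2.
have [z Bz] := bochner_test tphi v2.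
exists y; split=> //; suff <- : z = (-1) ^+ n *: y by [].
apply: (crd_inj hdot he) => m.
have [_ Ey] := bochner_crd hdot he (itv_oo_meas 0 T) (mu_itvoo_lty 0 T) m By.
have [_ Ez] := bochner_crd hdot he (itv_oo_meas 0 T) (mu_itvoo_lty 0 T) m Bz.
rewrite signC -[X in _ = crd m X]/(rscale _ _) crdZ Ez Ey.
transitivity (prim (fun t => phi t * crd m (v t)) T).
  by apply: eq_prim => t _; rewrite crdZ.
by rewrite E//; congr (_ * _); apply: eq_prim => t _; rewrite crdZ.
Qed.

Lemma eq_ae_crd (g g' : R -> H) : (forall m, ae_on T (fun t => crd m (g t) = crd m (g' t))) ->
  ae_on T (fun t => g t = g' t).
Proof. by move=> /ae_on_all; apply: ae_onS => t _; exact: (crd_inj hdot he). Qed.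

Lemma weak_derivative_unique n u v v' : in_L2 T v -> in_L2 T v' ->
  weak_derivative T n u v -> weak_derivative T n u v' -> ae_on T (fun t => v t = v' t).
Proof.
move=> v2 v2' wv wv'; apply: eq_ae_crd => m.
have [_ i1] := in_L2_crd m v2; have [_ i1'] := in_L2_crd m v2'.
suff: ae_on T (fun t => crd m (v t) - crd m (v' t) = 0).
  by apply: ae_onS => t _ /eqP; rewrite subr_eq0 => /eqP.
apply: (fundamental_lemma T_gt0 (L1B i1 i1')).
move=> phi tphi; have bphi := test_bdd_meas T_gt0 tphi.
rewrite (_ : (fun t => _) = fun t => phi t * crd m (v t) - phi t * crd m (v' t)); last first.
  by apply/funext => t; rewrite mulrBr.
rewrite (primB (lexx T)); [|exact: L1M|exact: L1M].
by rewrite (weak_derivative_crd m wv tphi) (weak_derivative_crd m wv' tphi) subrr.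
Qed.

(** [gderive] is a choice, meaningless until one square-integrable candidate is known; the
    fundamental lemma then makes the choice agree with it almost everywhere. *)
Lemma gderiveP n u v : in_L2 T v -> weak_derivative T n u v ->
  [/\ in_L2 T (gderive T n u), weak_derivative T n u (gderive T n u)
    & ae_on T (fun t => gderive T n u t = v t)].
Proof.
move=> v2 wv.
have [] : [set w | in_L2 T w /\ weak_derivative T n u w] (gderive T n u).
  by apply: getPex; exists v.
by move=> d2 wd; split=> //; exact: weak_derivative_unique wd wv.
Qed.

Lemma initial_value_crd (g : R -> H) (x : H) (w : R -> R) (l : R) m : initial_value T g x ->
  ae_on T (fun t => crd m (g t) = w t) -> w t @[t --> 0^'+] --> l -> crd m x = l.
Proof.
move=> [h [gh hx]] gw wl.
apply: (@ae_right_lim_unique R T T_gt0 (fun t => crd m (h t)) w) => //.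
- by apply: ae_onS2 gh gw => t _ <- <-.
- exact: (crd_cvg hdot he).
Qed.

End WeakDerivatives.

(** * The evolution equation *)

Section ModeData.
Context {R : realType} {H : completeNormedModType R[i]}.
Variable dot : {dot H for Num.conj}.
Hypothesis hdot : hilbert_dot dot.
Variable e : nat -> H.
Hypothesis he : orthonormal_basis dot e.
Variable a : nat -> R.
Hypothesis a_ge1 : forall n, 1 <= a n.
Variables theta T kap : R.
Hypothesis theta01 : 0 <= theta <= 1.
Hypothesis T_gt0 : 0 < T.
Hypothesis kap_lt1 : kap < 1.
Variables (f : R -> H) (phi0 phi1 : H).
Hypothesis hf : in_L2_pow dot e a T (2 - theta) f.
Hypothesis h0 : op_pow_dom dot e a 2 phi0.
Hypothesis h1 : op_pow_dom dot e a 1 phi1.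
Notation crd := (crd dot e).
Notation al := (reig a).
Notation F := (fun t => op_pow dot e a (2 - theta) (f t)).

Definition mode_coupling m : R := al m `^ (2 * theta).

Lemma mode_coupling_ge0 m : 0 <= mode_coupling m.
Proof. exact: powR_ge0. Qed.

Lemma reig_ge0 m : 0 <= al m.
Proof. by rewrite (le_trans ler01)// reig_ge1. Qed.

Lemma reig_pow2 m : al m `^ 2 = al m ^+ 2.
Proof. by rewrite powR_mulrn// reig_ge0. Qed.

Lemma mode_coupling_le m : mode_coupling m <= al m ^+ 2.
Proof.
rewrite -reig_pow2 ler_powR ?reig_ge1//.
by move: theta01 => /andP[_]; lra.
Qed.

(** Recovered from [A^{2 - theta} f] and not taken as [crd m (f t)]: measurability and square
    integrability are assumed of the former. The two agree almost everywhere. *)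
Definition mode_source m t : R := (al m `^ (2 - theta))^-1 * crd m (F t).

(** As [theta <= 1], [al <= al^{2 - theta}]: the smoothness asked of [f] pays for the factor [al^2]
    of [data_bound]. *)
Lemma mode_source_sqr m t : mode_source m t ^+ 2 <= crd m (F t) ^+ 2 /\
  al m ^+ 2 * mode_source m t ^+ 2 <= crd m (F t) ^+ 2.
Proof.
have al1 := reig_ge1 a_ge1 m.
have P1 : al m <= al m `^ (2 - theta).
  by rewrite -[leLHS]powRr1 ?reig_ge0// ler_powR//; move: theta01 => /andP[_]; lra.
have P0 : 0 < al m `^ (2 - theta) by apply: reig_pow_gt0.
rewrite /mode_source; move: P1 P0; set P := _ `^ _ => P1 P0.
have K : al m ^+ 2 * (P^-1 * crd m (F t)) ^+ 2 <= crd m (F t) ^+ 2.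
  rewrite -exprMn mulrA exprMn ler_piMl ?sqr_ge0// -[leRHS](expr1n _ 2).
  rewrite ler_pXn2r ?nnegrE//; first by rewrite ler_pdivrMr// mul1r.
  by rewrite mulr_ge0 ?invr_ge0 ?(ltW P0)// reig_ge0.
split=> //; apply: le_trans K; rewrite ler_peMl ?sqr_ge0//.
by rewrite exprn_ege1.
Qed.

Lemma mode_source_ae m : ae_on T (fun t => mode_source m t = crd m (f t)).
Proof.
have [hd _] := hf; apply: ae_onS hd => t _ dt.
by rewrite /mode_source (op_powE hdot he)// mulKf// gt_eqF// reig_pow_gt0.
Qed.

Lemma L1_mode_source m : L1 T (mode_source m) /\ L1 T (fun t => mode_source m t ^+ 2).
Proof.
have [_ F2] := hf; have [i2 i1] := in_L2_crd hdot he m F2.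
split; first exact: L1Z.
suff -> : (fun t => mode_source m t ^+ 2) = (fun t => ((al m `^ (2 - theta))^-1) ^+ 2 * crd m (F t) ^+ 2).
  exact: L1Z.
by apply/funext => t; rewrite -exprMn.
Qed.

Definition mode_energy m : R := crd m (op_pow dot e a 1 phi1) ^+ 2 +
  crd m (op_pow dot e a 2 phi0) ^+ 2 + prim (fun t => crd m (F t) ^+ 2) T.

Definition data_energy : R := rnorm (op_pow dot e a 1 phi1) ^+ 2 +
  rnorm (op_pow dot e a 2 phi0) ^+ 2 + prim (fun t => rnorm (F t) ^+ 2) T.

Lemma mode_energy_scale C : series (fun m => C * mode_energy m) n @[n --> \oo] --> C * data_energy.
Proof.
rewrite (_ : series _ = fun n => C * (series (fun m => crd m (op_pow dot e a 1 phi1) ^+ 2) n +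
  series (fun m => crd m (op_pow dot e a 2 phi0) ^+ 2) n +
  series (fun m => prim (fun t => crd m (F t) ^+ 2) T) n)); last first.
  by apply/funext => n; rewrite /series/= -!big_split/= mulr_sumr.
apply: cvgMl_tmp; have [_ F2] := hf; have [c1 c2] := in_L2_series hdot he F2.
apply: cvgD; first by apply: cvgD; exact: parseval.
by rewrite -c2.
Qed.

Lemma mode_energy_scale_lim C : cvgn (series (fun m => C * mode_energy m)) /\
  limn (series (fun m => C * mode_energy m)) = C * data_energy.
Proof.
have c := @mode_energy_scale C.
by split; [apply/cvg_ex; exists (C * data_energy)|exact: cvg_lim c].
Qed.

Lemma rnorm_sqr_le_energy C (x : H) : (forall m, crd m x ^+ 2 <= C * mode_energy m) ->
  rnorm x ^+ 2 <= C * data_energy.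
Proof.
move=> xC; have [c <-] := mode_energy_scale_lim C.
rewrite (rnorm_sqrE hdot he); apply: le_lim_series c => m.
by rewrite sqr_ge0 xC.
Qed.

(** The coefficients [2], [2] and [4 T] of [data_bound] are replaced by the common bound
    [2 + 4 T]. *)
Definition energy_cst : R := (2 + 4 * T) / (1 - kap).

Lemma energy_cst_ge0 : 0 <= energy_cst.
Proof.
rewrite divr_ge0// ?subr_ge0 ?(ltW kap_lt1)// addr_ge0// mulr_ge0//.
exact: ltW.
Qed.

Lemma data_bound_le m :
  data_bound kap T (al m) (crd m phi0) (crd m phi1) (mode_source m) <= energy_cst * mode_energy m.
Proof.
have k0 : 0 < 1 - kap by rewrite subr_gt0.
rewrite /data_bound /energy_cst [leRHS]mulrAC ler_pM2r ?invr_gt0//.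
have [ig ig2] := L1_mode_source m.
have [_ F2] := hf; have [i2 i1] := in_L2_crd hdot he m F2.
have H1 : al m ^+ 2 * prim (fun s => mode_source m s ^+ 2) T <= prim (fun t => crd m (F t) ^+ 2) T.
  rewrite -(primZ _ (lexx T))//; apply: le_prim => //; first exact: L1Z.
  by move=> s _; have [] := mode_source_sqr m s.
rewrite /mode_energy (op_powE hdot he)// (op_powE hdot he)//.
rewrite reig_pow2 powRr1 ?reig_ge0//.
move: H1; set J := prim _ T; set G := prim _ T => H1.
have G0 : 0 <= G by apply: prim_ge0 => t _; exact: sqr_ge0.
have T0 := ltW T_gt0.
set A := (al m * _) ^+ 2; set B := (al m ^+ 2 * _) ^+ 2.
have A0 : 0 <= A by exact: sqr_ge0.
have B0 : 0 <= B by exact: sqr_ge0.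
rewrite (_ : _ * (_ + _) = 2 * A + 2 * B + 4 * T * (al m ^+ 2 * J)); last by rewrite /A /B; ring.
have := ler_wpM2l (mulr_ge0 (ler0n R 4) T0) H1.
have := mulr_ge0 T0 A0; have := mulr_ge0 T0 B0.
lra.
Qed.

End ModeData.

Section SquarePrimitives.
Context {R : realType}.

Lemma L1_eq (T : R) (z k : R -> R) : (forall t, 0 < t < T -> z t = k t) -> L1 T z -> L1 T k.
Proof.
move=> zk; apply: eq_integrable => //.
by move=> t; rewrite inE/= in_itv/= => /zk ->.
Qed.

Lemma bdd_meas_sub (T t : R) (z : R -> R) : t <= T -> bdd_meas T z -> bdd_meas t z.
Proof.
move=> tT [mz [M zM]]; split.
  apply: measurable_funS mz => //.
  by move=> s /=; rewrite !in_itv/= => /andP[-> st]; exact: lt_le_trans st tT.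
by exists M => s /andP[s0 st]; rewrite zM// s0 (lt_le_trans st tT).
Qed.

Lemma sqr_prim_le (T t : R) (k : R -> R) : 0 <= t <= T -> L1 T k -> L1 T (fun s => k s ^+ 2) ->
  prim k t ^+ 2 <= t * prim (fun s => k s ^+ 2) T.
Proof.
move=> /andP[t0 tT] ik ik2.
have ? : 0 <= prim (fun s => `|k s|) t by apply: prim_ge0.
apply: (@le_trans _ _ (prim (fun s => `|k s|) t ^+ 2)).
  rewrite -(real_normK (num_real (prim k t))) ler_pXn2r ?nnegrE//.
  exact: (prim_norm_le tT ik).
apply: (le_trans (prim_CS t0 tT ik ik2)); rewrite ler_wpM2l//.
by apply: prim_homo => // s _; exact: sqr_ge0.
Qed.

Lemma L1_sqr_bdd (T : R) (z : R -> R) : bdd_meas T z -> L1 T (fun t => z t ^+ 2).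
Proof.
move=> bz; apply: bdd_meas_L1.
by rewrite (_ : (fun _ => _) = fun t => z t * z t)//; exact: bdd_measM.
Qed.

End SquarePrimitives.

(** * Existence: summation of the modes *)

Section Existence.
Context {R : realType} {H : completeNormedModType R[i]}.
Variable dot : {dot H for Num.conj}.
Hypothesis hdot : hilbert_dot dot.
Variable e : nat -> H.
Hypothesis he : orthonormal_basis dot e.
Hypothesis hsep : separable_space H.
Variable a : nat -> R.
Hypothesis a_ge1 : forall n, 1 <= a n.
Variables (c gamma : nat -> R) (theta T kap : R).
Hypothesis c_gt0 : forall k, 0 < c k.
Hypothesis gamma_gt0 : forall k, 0 < gamma k.
Hypothesis kap_cvg : series (fun k => c k / gamma k) n @[n --> \oo] --> kap.
Hypothesis kap_lt1 : kap < 1.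
Hypothesis theta01 : 0 <= theta <= 1.
Hypothesis T_gt0 : 0 < T.
Variables (f : R -> H) (phi0 phi1 : H).
Hypothesis hf : in_L2_pow dot e a T (2 - theta) f.
Hypothesis h0 : op_pow_dom dot e a 2 phi0.
Hypothesis h1 : op_pow_dom dot e a 1 phi1.
Notation crd := (crd dot e).
Notation al := (reig a).
Notation be := (mode_coupling a theta).
Notation g := (mode_source dot e a theta f).
Notation E := (mode_energy dot e a theta T f phi0 phi1).
Notation N2 := (data_energy dot e a theta T f phi0 phi1).
Notation C0 := (energy_cst T kap).
Notation F := (fun t => op_pow dot e a (2 - theta) (f t)).

Lemma in_L2_modes (w : R -> H) (z : nat -> R -> R) C :
  (forall m t, 0 < t < T -> crd m (w t) = z m t) -> (forall m, L1 T (z m)) ->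
  (forall m, L1 T (fun t => z m t ^+ 2)) ->
  (forall m, prim (fun t => z m t ^+ 2) T <= C * E m) ->
  in_L2 T w /\ prim (fun t => rnorm (w t) ^+ 2) T <= C * N2.
Proof.
move=> wz i1 i2 zC.
have [cE <-] := mode_energy_scale_lim hdot he phi0 phi1 hf C.
apply: (in_L2_of_series hdot he hsep) => // m.
- by apply: L1_meas; apply: L1_eq (i1 m) => t tT; rewrite wz.
- by apply: L1_eq (i2 m) => t tT; rewrite wz.
- by rewrite (@eq_prim _ _ (fun t => z m t ^+ 2))// => t tT; rewrite wz.
Qed.

Variables (x y h : nat -> R -> R).
Hypothesis sol : forall m,
  scalar_sol c gamma T (al m) (be m) (crd m phi0) (crd m phi1) (g m) (x m) (y m) (h m).
Let r m t := rhs c gamma (al m) (be m) (g m) (x m) t.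

Let ig m : L1 T (g m). Proof. by have [] := L1_mode_source hdot he hf m. Qed.
Let ig2 m : L1 T (fun t => g m t ^+ 2). Proof. by have [] := L1_mode_source hdot he hf m. Qed.

Let energy_bound m t : 0 <= t <= T ->
  al m ^+ 4 * x m t ^+ 2 <= C0 * E m /\ y m t ^+ 2 <= C0 * E m.
Proof.
move=> tT.
have D := data_bound_le hdot he a_ge1 theta01 T_gt0 kap_lt1 hf h0 h1 m.
have [B1 B2] := scalar_sol_bound c_gt0 gamma_gt0 kap_cvg kap_lt1 T_gt0 (mode_coupling_ge0 a theta m)
  (mode_coupling_le a_ge1 theta01 m) (ig m) (sol m) (reig_ge1 a_ge1 m) tT (ig2 m).
by split; [exact: le_trans B1 D|exact: le_trans B2 D].
Qed.

Let x_sqr_le m t : 0 <= t <= T -> x m t ^+ 2 <= C0 * E m.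
Proof.
move=> /(energy_bound m)[B _]; apply: le_trans B.
by rewrite ler_peMl ?sqr_ge0// exprn_ege1// reig_ge1.
Qed.

Let r_sqr_le_g m t : 0 <= t <= T -> r m t ^+ 2 <= 2 * g m t ^+ 2 + 8 * (C0 * E m).
Proof.
move=> tT; have D := data_bound_le hdot he a_ge1 theta01 T_gt0 kap_lt1 hf h0 h1 m.
have B := scalar_rhs_bound c_gt0 gamma_gt0 kap_cvg kap_lt1 T_gt0 (mode_coupling_ge0 a theta m)
  (mode_coupling_le a_ge1 theta01 m) (ig m) (sol m) (reig_ge1 a_ge1 m) tT (ig2 m).
by apply: (le_trans B); rewrite lerD2l ler_wpM2l.
Qed.

Let r_sqr_le m t : 0 <= t <= T -> r m t ^+ 2 <= 2 * crd m (F t) ^+ 2 + 8 * (C0 * E m).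
Proof.
move=> tT; apply: (le_trans (r_sqr_le_g m tT)); rewrite lerD2r ler_wpM2l//.
by have [] := mode_source_sqr dot e a_ge1 theta01 f m t.
Qed.

Let E_cvg C : cvgn (series (fun m => C * E m)).
Proof. by have [] := mode_energy_scale_lim hdot he phi0 phi1 hf C. Qed.

Let u t := synth e (x ^~ t).
Let Y t := synth e (y ^~ t).
(** Built from [r] and not from [h]: [r] is square summable over the modes at every time of
    [[0, T]], while [h] is tied to it only almost everywhere. *)
Let v t := synth e (r ^~ t).

Let crd_u m t : 0 <= t <= T -> crd m (u t) = x m t.
Proof.
move=> tT; apply: (crd_synth hdot he); apply: (@le_cvg_series _ _ (fun k => C0 * E k)) => [k|]; last exact: E_cvg.
by rewrite sqr_ge0 x_sqr_le.
Qed.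

Let crd_Y m t : 0 <= t <= T -> crd m (Y t) = y m t.
Proof.
move=> tT; apply: (crd_synth hdot he); apply: (@le_cvg_series _ _ (fun k => C0 * E k)) => [k|]; last exact: E_cvg.
by rewrite sqr_ge0; have [] := energy_bound k tT.
Qed.

Let crd_v m t : 0 <= t <= T -> crd m (v t) = r m t.
Proof.
move=> tT; apply: (crd_synth hdot he).
apply: (@le_cvg_series _ _ (fun k => 2 * crd k (F t) ^+ 2 + 8 * (C0 * E k))) => [k|].
  by rewrite sqr_ge0 r_sqr_le.
have -> : series (fun k => 2 * crd k (F t) ^+ 2 + 8 * (C0 * E k)) =
    fun n => 2 * series (fun k => crd k (F t) ^+ 2) n + 8 * series (fun k => C0 * E k) n.
  by apply/funext => n; rewrite /series/= !mulr_sumr -big_split.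
apply: is_cvgD; apply: is_cvgMl_tmp; last exact: E_cvg.
exact: cvg_crd.
Qed.

Let dom_u t : 0 <= t <= T -> op_pow_dom dot e a 2 (u t).
Proof.
move=> tT; apply/op_pow_domP; apply: (@le_cvg_series _ _ (fun k => C0 * E k)) => [k|]; last exact: E_cvg.
rewrite sqr_ge0 crd_u// reig_pow2// exprMn -exprM.
by have [] := energy_bound k tT.
Qed.

Let crd_A2u m t : 0 <= t <= T -> crd m (op_pow dot e a 2 (u t)) = al m ^+ 2 * x m t.
Proof. by move=> tT; rewrite (op_powE hdot he)// ?reig_pow2// ?crd_u//; exact: dom_u. Qed.

Let A2u_sqr_le m t : 0 <= t <= T -> (al m ^+ 2 * x m t) ^+ 2 <= C0 * E m.
Proof. by move=> tT; rewrite exprMn -exprM; have [] := energy_bound m tT. Qed.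

Let rnorm_A2u t : 0 <= t <= T -> rnorm (op_pow dot e a 2 (u t)) ^+ 2 <= C0 * N2.
Proof.
move=> tT; apply: (rnorm_sqr_le_energy hdot he hf) => m.
by rewrite crd_A2u// A2u_sqr_le.
Qed.

Let bx m : bdd_meas T (x m). Proof. by have [] := scalar_sol_bdd (sol m). Qed.
Let by_ m : bdd_meas T (y m). Proof. by have [] := scalar_sol_bdd (sol m). Qed.

Let ir m : L1 T (r m). Proof. exact: (L1_rhs c_gt0 gamma_gt0 kap_cvg). Qed.

Let oo_cc (t : R) : 0 < t < T -> 0 <= t <= T.
Proof. by move=> /andP[t0 tT]; rewrite !ltW. Qed.

Let bdd_sqr_prim (z : R -> R) C : bdd_meas T z -> (forall t, 0 <= t <= T -> z t ^+ 2 <= C) ->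
  L1 T (fun t => z t ^+ 2) /\ prim (fun t => z t ^+ 2) T <= C * T.
Proof.
move=> bz zC.
have i2 := L1_sqr_bdd bz; split=> //; rewrite -prim_cst ?(ltW T_gt0)//; apply: le_prim => //.
- exact: L1_cst.
- by move=> s sT; apply: zC; exact: oo_cc.
Qed.

Let in_L2_bdd (w : R -> H) (z : nat -> R -> R) :
  (forall m t, 0 <= t <= T -> crd m (w t) = z m t) -> (forall m, bdd_meas T (z m)) ->
  (forall m t, 0 <= t <= T -> z m t ^+ 2 <= C0 * E m) ->
  in_L2 T w /\ prim (fun t => rnorm (w t) ^+ 2) T <= C0 * T * N2.
Proof.
move=> wz bz zC; apply: (in_L2_modes (z := z)) => m.
- by move=> t tT; apply: wz; exact: oo_cc.
- exact: bdd_meas_L1.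
- by have [] := bdd_sqr_prim (bz m) (zC m).
- by rewrite mulrAC; have [] := bdd_sqr_prim (bz m) (zC m).
Qed.

Let u2 : in_L2 T u. Proof. by have [] := in_L2_bdd crd_u bx x_sqr_le. Qed.

Let Y2 : in_L2 T Y.
Proof.
have [] // := in_L2_bdd crd_Y by_ _.
by move=> m t tT; have [] := energy_bound m tT.
Qed.

Let A2u2 : in_L2 T (fun t => op_pow dot e a 2 (u t)) /\
  prim (fun t => rnorm (op_pow dot e a 2 (u t)) ^+ 2) T <= C0 * T * N2.
Proof.
apply: (in_L2_bdd crd_A2u); first by move=> m; exact: bdd_measZ.
by move=> m t tT; exact: A2u_sqr_le.
Qed.

Let ir2 m : L1 T (fun t => r m t ^+ 2).
Proof.
have [] // := @L1_sqr_dominated _ T (r m) (fun t => 2 * g m t ^+ 2 + 8 * (C0 * E m)).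
- exact: L1_meas.
- by apply: L1D; [exact: L1Z|exact: L1_cst].
- by move=> t tT; apply: r_sqr_le_g; exact: oo_cc.
Qed.

Let prim_r_sqr m : prim (fun t => r m t ^+ 2) T <= (2 + 8 * C0 * T) * E m.
Proof.
have [_ F2] := hf; have [iF2 _] := in_L2_crd hdot he m F2.
have iC : L1 T (fun=> 8 * (C0 * E m)) by exact: L1_cst.
apply: (@le_trans _ _ (prim (fun t => 2 * crd m (F t) ^+ 2 + 8 * (C0 * E m)) T)).
  apply: le_prim => //; first by apply: L1D => //; exact: L1Z.
  by move=> t tT; apply: r_sqr_le; exact: oo_cc.
rewrite (primD (lexx T))//; last exact: L1Z.
rewrite (primZ _ (lexx T))// prim_cst ?(ltW T_gt0)//.
rewrite (mulrDl 2) (_ : 8 * C0 * T * E m = 8 * (C0 * E m) * T); last by ring.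
rewrite lerD2r ler_wpM2l// /mode_energy lerDr addr_ge0// sqr_ge0//.
Qed.

Let v2 : in_L2 T v /\ prim (fun t => rnorm (v t) ^+ 2) T <= (2 + 8 * C0 * T) * N2.
Proof.
apply: (in_L2_modes (z := r)) => // m t tT; apply: crd_v; exact: oo_cc.
Qed.

Let h_ae m : ae_on T (fun t => h m t = r m t). Proof. by have [] := sol m. Qed.
Let ih m : L1 T (h m). Proof. by have [] := sol m. Qed.
Let xE m t : 0 <= t <= T -> x m t = crd m phi0 + prim (y m) t.
Proof. by have [_ _ + _] := sol m; apply. Qed.
Let yE m t : 0 <= t <= T -> y m t = crd m phi1 + prim (h m) t.
Proof. by have [_ _ _] := sol m; apply. Qed.

Let wd1 : weak_derivative T 1 u Y.
Proof.
apply: (weak_derivativeP hdot he hsep T_gt0 u2 Y2) => phi m tphi.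
have iy := bdd_meas_L1 (by_ m).
rewrite expr1 mulN1r (@eq_prim _ _ (fun t => phi t * y m t)); last first.
  by move=> t /oo_cc tT; rewrite crd_Y.
rewrite -[LHS]opprK -(prim_test_parts T_gt0 tphi iy (@xE m))//.
by congr (- _); apply: eq_prim => t /oo_cc tT; rewrite crd_u.
Qed.

Let wd2 : weak_derivative T 2 u v.
Proof.
have [vL _] := v2.
apply: (weak_derivativeP hdot he hsep T_gt0 u2 vL) => phi m tphi.
have iy := bdd_meas_L1 (by_ m).
have bphi := test_bdd_meas T_gt0 tphi.
rewrite sqrrN expr1n mul1r.
have -> : prim (fun t => phi t * crd m (v t)) T = prim (fun t => phi t * h m t) T.
  rewrite (@eq_prim _ _ (fun t => phi t * r m t)); last by move=> t /oo_cc tT; rewrite crd_v.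
  apply: prim_ae => //; [exact: L1M|exact: L1M|].
  by apply: ae_onS (h_ae m) => t _ ->.
have -> : prim (fun t => derive1n 2 phi t * crd m (u t)) T = prim (fun t => derive1n 2 phi t * x m t) T.
  by apply: eq_prim => t /oo_cc tT; rewrite crd_u.
have P1 := prim_test_parts T_gt0 (test_derive tphi) iy (@xE m).
have P2 := prim_test_parts T_gt0 tphi (ih m) (@yE m).
by rewrite [RHS]P1 P2 opprK.
Qed.

(** [x m t - crd m phi0] is a primitive of [y m], so Cauchy-Schwarz yields a factor [t] times a
    bound summable over the modes; the limit thus holds in the norm of [H]. *)
Let initial_u : initial_value T u phi0.
Proof.
exists u; split; first exact: ae_onW.
apply/cvg_rnormP; apply: (sqr_le_linear_cvg0 T_gt0 (C := C0 * T * N2)) => t tT.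
have tT' := oo_cc tT; have /andP[t0 tT0] := tT'.
rewrite [leRHS]mulrAC; apply: (rnorm_sqr_le_energy hdot he hf) => m.
rewrite crdB crd_u// xE// opprD addNKr sqrrN.
have [iy2 py] := bdd_sqr_prim (by_ m) (fun t tT => proj2 (energy_bound m tT)).
apply: (le_trans (sqr_prim_le tT' (bdd_meas_L1 (by_ m)) iy2)); apply: (le_trans (ler_wpM2l t0 py)).
by lra.
Qed.

Let initial_Y : Y t @[t --> 0^'+] --> phi1.
Proof.
apply/cvg_rnormP; apply: (sqr_le_linear_cvg0 T_gt0 (C := (2 + 8 * C0 * T) * N2)) => t tT.
have tT' := oo_cc tT; have /andP[t0 tT0] := tT'.
rewrite [leRHS]mulrAC; apply: (rnorm_sqr_le_energy hdot he hf) => m.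
rewrite crdB crd_Y// yE// opprD addNKr sqrrN.
rewrite (prim_ae tT0 (ih m) (ir m) (h_ae m)).
apply: (le_trans (sqr_prim_le tT' (ir m) (ir2 m))); apply: (le_trans (ler_wpM2l t0 (prim_r_sqr m))).
by lra.
Qed.

(** Since [2 theta <= 2], [A^{2 theta} u] is dominated in norm by [A^2 u], which is bounded in time;
    times an integrable kernel it is Bochner integrable, even if [K] is singular at 0. *)
Let memory_integral t : 0 < t < T -> exists I, bochner_integral `]0, t[
    (fun s => rscale (exp_kernel c gamma (t - s)) (op_pow dot e a (2 * theta) (u s))) I /\
  forall m, crd m I = be m * kconv c gamma (x m) t.
Proof.
move=> /andP[t0 tT].
have st (s : R) : 0 < s < t -> 0 <= s <= T.
  by move=> /andP[s0 st]; rewrite (ltW s0) ltW// (lt_trans st).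
have le2 : 2 * theta <= 2 by move: theta01 => /andP[_]; lra.
have mK := measurable_kernel_sub c_gt0 gamma_gt0 kap_cvg (t := t).
have GE m s : 0 < s < t ->
    crd m (rscale (exp_kernel c gamma (t - s)) (op_pow dot e a (2 * theta) (u s))) =
    exp_kernel c gamma (t - s) * (be m * x m s).
  move=> /st sT; rewrite crdZ (op_powE hdot he) ?crd_u//.
  exact: op_pow_dom_le le2 (dom_u sT).
have bx' m : bdd_meas t (fun s => be m * x m s).
  by apply: bdd_measZ; apply: bdd_meas_sub (ltW tT) _.
have mG m : measurable_fun `]0, t[
    (crd m \o (fun s => rscale (exp_kernel c gamma (t - s)) (op_pow dot e a (2 * theta) (u s)))).
  apply: (@L1_meas _ t); apply: L1_eq (L1M (bx' m) (L1_kernel_sub c_gt0 gamma_gt0 kap_cvg t0)) => s stt.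
  by rewrite /= GE// mulrC.
have iG : L1 t (fun s => rnorm (rscale (exp_kernel c gamma (t - s)) (op_pow dot e a (2 * theta) (u s)))).
  apply: (@L1_dominated _ t _ (fun s => exp_kernel c gamma (t - s) * Num.sqrt (C0 * N2))).
  - exact: (measurable_rnorm hdot he (itv_oo_meas 0 t)).
  - by apply: integrable_on_scale => //; exact: (L1_kernel_sub c_gt0 gamma_gt0 kap_cvg).
  - move=> s stt; have sT := st s stt.
    have K0 : 0 <= exp_kernel c gamma (t - s).
      by move: stt => /andP[_ stt]; apply: (exp_kernel_ge0 c_gt0 gamma_gt0 kap_cvg); rewrite subr_gt0.
    rewrite ger0_norm ?rnorm_ge0// rnormZ (ger0_norm K0) ler_wpM2l//.
    apply: (le_trans (rnorm_op_pow_le hdot he a_ge1 le2 (dom_u sT))).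
    by rewrite -[leLHS]ger0_norm ?rnorm_ge0// -sqrtr_sqr ler_sqrt ?rnorm_A2u// (le_trans _ (rnorm_A2u sT))// sqr_ge0.
have [I BI] : exists I, bochner_integral `]0, t[
    (fun s => rscale (exp_kernel c gamma (t - s)) (op_pow dot e a (2 * theta) (u s))) I.
  apply: (bochner_exists hdot he hsep (itv_oo_meas 0 t) (mu_itvoo_lty 0 t) mG).
  by rewrite (primEFin (lexx t))// ltry.
exists I; split=> // m.
have [_ ->] := bochner_crd hdot he (itv_oo_meas 0 t) (mu_itvoo_lty 0 t) m BI.
transitivity (prim (fun s => be m * (exp_kernel c gamma (t - s) * x m s)) t).
  by apply: eq_prim => s stt; rewrite GE// mulrCA.
have bxt : bdd_meas t (x m) by apply: bdd_meas_sub (ltW tT) _.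
rewrite (primZ _ (lexx t)); first by rewrite (prim_kernel_conv c_gt0 gamma_gt0 kap_cvg).
by apply: L1_eq (L1M bxt (L1_kernel_sub c_gt0 gamma_gt0 kap_cvg t0)) => s _; rewrite mulrC.
Qed.

(** In the constant, [2 + 8 * C0 * T] comes from [u''] and [C0 * T] from [A^2 u]. *)
Lemma modes_solution : is_solution dot e a (exp_kernel c gamma) theta T f phi0 phi1 u /\
  norm_W22 dot e a T u <= Num.sqrt (2 + 9 * C0 * T) * Num.sqrt N2.
Proof.
have [vL vN] := v2; have [AL AN] := A2u2.
have [D2 _ D2v] := gderiveP hdot he T_gt0 vL wd2.
have [D1 _ D1Y] := gderiveP hdot he T_gt0 Y2 wd1.
split.
  split.
  - split=> //; last by exists v.
    by split=> //; apply: ae_onW => t /oo_cc; exact: dom_u.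
  - have := ae_on_all (mode_source_ae hdot he a_ge1 hf); apply: ae_onS2 D2v => t tT vE gE.
    have [I [BI IE]] := memory_integral tT.
    exists I; split=> //; apply: (crd_inj hdot he) => m; have tT' := oo_cc tT.
    rewrite crdB crdD vE crd_v// crd_A2u// IE -gE /r /rhs; ring.
  - exact: initial_u.
  - by exists Y.
have iD := in_L2_sqr hdot he D2; have iA := in_L2_sqr hdot he AL.
have C00 : 0 <= C0 by exact: energy_cst_ge0.
have T0 := ltW T_gt0.
rewrite -sqrtrM; last by rewrite addr_ge0// (mulr_ge0 (mulr_ge0 (ler0n R 9) C00) T0).
rewrite /norm_W22 -[fine _]/(prim (fun t => rnorm (gderive T 2 u t) ^+ 2 +
  rnorm (op_pow dot e a 2 (u t)) ^+ 2) T) ler_wsqrtr// (primD (lexx T))//.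
rewrite (prim_ae (lexx T) iD (in_L2_sqr hdot he vL)); last first.
  by apply: ae_onS D2v => t _ ->.
apply: (le_trans (lerD vN AN)).
by lra.
Qed.

End Existence.

(** * Uniqueness: from a solution back to its modes *)

Section Uniqueness.
Context {R : realType} {H : completeNormedModType R[i]}.
Variable dot : {dot H for Num.conj}.
Hypothesis hdot : hilbert_dot dot.
Variable e : nat -> H.
Hypothesis he : orthonormal_basis dot e.
Hypothesis hsep : separable_space H.
Variable T : R.
Hypothesis T_gt0 : 0 < T.
Notation crd := (crd dot e).

Lemma ae_on_sub (t : R) (P : R -> Prop) : t <= T -> ae_on T P -> ae_on t P.
Proof.
move=> tT; apply: ae_imp => s PT; rewrite in_itv/= => /andP[s0 st]; apply: PT.
by rewrite in_itv/= s0 (lt_le_trans st).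
Qed.

Lemma prim_cvg_right0 (k : R -> R) (C : R) : L1 T k -> L1 T (fun s => k s ^+ 2) ->
  C + prim k t @[t --> 0^'+] --> C.
Proof.
move=> ik ik2; rewrite -[X in _ --> X]addr0; apply: cvgD; first exact: cvg_cst.
apply: (sqr_le_linear_cvg0 T_gt0 (C := prim (fun s => k s ^+ 2) T)) => t /andP[t0 tT].
by rewrite mulrC sqr_prim_le// !ltW.
Qed.

(** Supplies the factor [T ^+ 3] in front of the squared slope in [slope_le]. *)
Lemma prim_sqr_id : prim (fun t : R => 3 * t ^+ 2) T = T ^+ 3.
Proof.
rewrite -[RHS]subr0 -[X in _ - X](_ : (0 : R) ^+ 3 = 0); last by rewrite expr0n.
apply: (@prim_FTC R (fun t => t ^+ 3)); first exact: ltW.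
  by move=> t; apply: cvgMl_tmp; exact: exprn_continuous.
move=> t; apply: DeriveDef; first exact: exprn_derivable.
by rewrite exp_derive /GRing.scale/= mulr1.
Qed.

Lemma in_L2_synth (y : nat -> R -> R) (b : nat -> R) : (forall m, bdd_meas T (y m)) ->
  (forall m t, 0 <= t <= T -> y m t ^+ 2 <= b m) -> cvgn (series b) ->
  in_L2 T (fun t => synth e (y ^~ t)) /\
  forall m t, 0 <= t <= T -> crd m (synth e (y ^~ t)) = y m t.
Proof.
move=> by_ yb cb.
have yE m t : 0 <= t <= T -> crd m (synth e (y ^~ t)) = y m t.
  move=> tT; apply: (crd_synth hdot he).
  by apply: (@le_cvg_series _ _ b) => // k; rewrite sqr_ge0 yb.
split=> //.
have oc (t : R) : 0 < t < T -> 0 <= t <= T by move=> /andP[t0 tT]; rewrite !ltW.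
have cT : cvgn (series (fun m => T * b m)).
  rewrite (_ : series _ = fun n => T * series b n); first exact: is_cvgMl_tmp.
  by apply/funext => n; rewrite /series/= mulr_sumr.
have [] // := @in_L2_of_series _ _ dot hdot e he hsep T (fun t => synth e (y ^~ t)) (fun m => T * b m).
- move=> m; apply: L1_meas; apply: L1_eq (bdd_meas_L1 (by_ m)) => t /oc tT; by rewrite yE.
- by move=> m; apply: L1_eq (L1_sqr_bdd (by_ m)) => t /oc tT; rewrite yE.
- move=> m; rewrite (@eq_prim _ _ (fun t => y m t ^+ 2)); last by move=> t /oc tT; rewrite yE.
  rewrite mulrC -prim_cst ?(ltW T_gt0)//; apply: le_prim => //.
  + exact: L1_sqr_bdd.
  + exact: L1_cst.
  + by move=> t /oc; exact: yb.
Qed.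

(** The coordinate of [w] and the double primitive of that of [v] have the same second weak
    derivative, so [dubois_reymond2] leaves an affine function between them. *)
Lemma weak_derivative2_primitive (w v : R -> H) m : in_L2 T w -> in_L2 T v ->
  weak_derivative T 2 w v -> exists P Q : R,
  ae_on T (fun t => crd m (w t) = P + prim (fun s => Q + prim (fun r => crd m (v r)) s) t).
Proof.
move=> w2 v2 wd.
have [_ iw] := in_L2_crd hdot he m w2; have [_ iv] := in_L2_crd hdot he m v2.
pose d := prim (fun r => crd m (v r)); pose z := prim d.
have id : L1 T d by apply: bdd_meas_L1; exact: prim_bdd_meas.
have iz : L1 T z by apply: bdd_meas_L1; exact: prim_bdd_meas.
have [phi tphi|P [Q PQ]] := @dubois_reymond2 _ T T_gt0 (fun t => crd m (w t) - z t) (L1B iw iz).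
  have bphi2 := test_bdd_meas T_gt0 (test_deriven 2 tphi).
  rewrite (_ : (fun t => _) = fun t => derive1n 2 phi t * crd m (w t) - derive1n 2 phi t * z t); last first.
    by apply/funext => t; rewrite mulrBr.
  rewrite (primB (lexx T)); [|exact: L1M|exact: L1M].
  have := weak_derivative_crd hdot he m wd tphi; rewrite sqrrN expr1n mul1r => <-.
  have P1 := @prim_test_parts _ T T_gt0 _ 0 z d (test_derive tphi) id.
  have P2 := @prim_test_parts _ T T_gt0 _ 0 d (fun t => crd m (v t)) tphi iv.
  have -> : prim (fun t => derive1n 2 phi t * z t) T = prim (fun t => phi t * crd m (v t)) T.
    by rewrite [LHS]P1 ?P2 ?opprK// => t _; rewrite add0r.
  by rewrite subrr.
exists P, Q; apply: ae_onS PQ => t /andP[t0 tT] E.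
rewrite (primD (ltW tT))//; last exact: L1_cst.
rewrite prim_cst ?(ltW t0)// addrA -E subrK//.
Qed.

(* Integrating (Q t)^2 against the bounds on the other terms controls the
   slopes of the modes, which makes the first derivative an L^2 function. *)
Lemma slope_le (w d : R -> R) (P Q : R) : L1 T w -> L1 T (fun t => w t ^+ 2) ->
  L1 T d -> L1 T (fun t => d t ^+ 2) ->
  ae_on T (fun t => w t = P + prim (fun s => Q + prim d s) t) ->
  Q ^+ 2 * T ^+ 3 <= 9 * (prim (fun t => w t ^+ 2) T + T * P ^+ 2 +
                          T ^+ 4 * prim (fun t => d t ^+ 2) T).
Proof.
move=> iw iw2 id id2 wE; have T0 := ltW T_gt0.
pose z := prim (prim d); set J := prim (fun t => d t ^+ 2) T.
have bd := prim_bdd_meas id; have id1 := bdd_meas_L1 bd.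
have bz : bdd_meas T z by exact: prim_bdd_meas.
have oc (t : R) : 0 < t < T -> 0 <= t <= T by move=> /andP[t0 tT]; rewrite !ltW.
have J0 : 0 <= J by apply: prim_ge0 => t _; exact: sqr_ge0.
have d_le t : 0 <= t <= T -> prim d t ^+ 2 <= T * J.
  move=> tT; apply: (le_trans (sqr_prim_le tT id id2)); rewrite ler_wpM2r//.
  by have /andP[] := tT.
have pd_le : prim (fun t => prim d t ^+ 2) T <= T * J * T.
  rewrite -prim_cst//; apply: le_prim => //.
  - exact: L1_sqr_bdd.
  - exact: L1_cst.
  - by move=> t /oc; exact: d_le.
have z_le t : 0 <= t <= T -> z t ^+ 2 <= T ^+ 3 * J.
  move=> tT; apply: (le_trans (sqr_prim_le tT id1 (L1_sqr_bdd bd))).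
  rewrite (_ : T ^+ 3 * J = T * (T * J * T)); last by ring.
  apply: ler_pM => //; try by have /andP[] := tT.
  by apply: prim_ge0 => s _; exact: sqr_ge0.
have wE' : ae_on T (fun t => Q * t = w t - P - z t).
  apply: ae_onS wE => t /andP[t0 tT] ->.
  rewrite (primD (ltW tT))//; last exact: L1_cst.
  by rewrite prim_cst ?(ltW t0)//; rewrite /z; ring.
have bt : bdd_meas T (fun t => t).
  split; first exact: measurable_id.
  by exists T => t /andP[t0 tT]; rewrite ger0_norm ltW.
have iQ : L1 T (fun t => 3 * (Q * t) ^+ 2).
  by apply: L1Z; apply: L1_sqr_bdd; exact: bdd_measZ.
have iwPz : L1 T (fun t => w t ^+ 2 + P ^+ 2 + z t ^+ 2).
  apply: L1D; last exact: L1_sqr_bdd.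
  by apply: L1D => //; exact: L1_cst.
have mw := L1_meas iw; have [mz _] := bz.
(* The square of a sum of three terms is at most 3 times the sum of the squares; the other factor 3
   makes the integral of [3 (Q t)^2] equal to [Q^2 T^3]. *)
have sub_le t : 3 * (w t - P - z t) ^+ 2 <= 9 * (w t ^+ 2 + P ^+ 2 + z t ^+ 2).
  have := sqr_ge0 (w t + P); have := sqr_ge0 (w t + z t); have := sqr_ge0 (P - z t).
  set A := w t; set B := z t; nra.
have ih : L1 T (fun t => 3 * (w t - P - z t) ^+ 2).
  apply: (@L1_dominated _ T _ (fun t => 9 * (w t ^+ 2 + P ^+ 2 + z t ^+ 2))).
  - apply: measurable_funM => //; apply: measurable_funX; apply: measurable_funB => //.
    by apply: measurable_funB.
  - exact: L1Z.
  - by move=> t _; rewrite ger0_norm ?sub_le// mulr_ge0// sqr_ge0.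
have -> : Q ^+ 2 * T ^+ 3 = prim (fun t => 3 * (Q * t) ^+ 2) T.
  rewrite -prim_sqr_id -(primZ _ (lexx T)); last by apply: L1Z; exact: L1_sqr_bdd.
  by apply: eq_prim => t _; ring.
rewrite (prim_ae (lexx T) iQ ih); last by apply: ae_onS wE' => t _ ->.
apply: (le_trans (le_prim (lexx T) ih (L1Z 9 iwPz) (fun t _ => sub_le t))).
rewrite (primZ _ (lexx T))// ler_wpM2l//.
have iP : L1 T (fun=> P ^+ 2) by exact: L1_cst.
rewrite (primD (lexx T)); [|exact: L1D|exact: L1_sqr_bdd].
rewrite (primD (lexx T))// prim_cst// (mulrC (P ^+ 2)) lerD2l.
rewrite (_ : T ^+ 4 * J = T ^+ 3 * J * T); last by ring.
rewrite -prim_cst//; apply: le_prim => //.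
- exact: L1_sqr_bdd.
- exact: L1_cst.
- by move=> t /oc; exact: z_le.
Qed.

Variable a : nat -> R.
Hypothesis a_ge1 : forall n, 1 <= a n.
Variables (c gamma : nat -> R) (theta kap : R).
Hypothesis c_gt0 : forall k, 0 < c k.
Hypothesis gamma_gt0 : forall k, 0 < gamma k.
Hypothesis kap_cvg : series (fun k => c k / gamma k) n @[n --> \oo] --> kap.
Hypothesis kap_lt1 : kap < 1.
Hypothesis theta01 : 0 <= theta <= 1.
Variables (f : R -> H) (phi0 phi1 : H).
Hypothesis hf : in_L2_pow dot e a T (2 - theta) f.
Notation al := (reig a).
Notation be := (mode_coupling a theta).
Notation g := (mode_source dot e a theta f).

Lemma memory_crd (w : R -> H) (x : R -> R) m t I : 0 < t <= T ->
  ae_on T (fun s => op_pow_dom dot e a 2 (w s)) -> ae_on T (fun s => crd m (w s) = x s) ->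
  bdd_meas T x ->
  bochner_integral `]0, t[
    (fun s => rscale (exp_kernel c gamma (t - s)) (op_pow dot e a (2 * theta) (w s))) I ->
  crd m I = be m * kconv c gamma x t.
Proof.
move=> /andP[t0 tT] dw wx bx BI.
have le2 : 2 * theta <= 2 by move: theta01 => /andP[_]; lra.
have [iI ->] := bochner_crd hdot he (itv_oo_meas 0 t) (mu_itvoo_lty 0 t) m BI.
have bxt := bdd_meas_sub tT bx.
have iK : L1 t (fun s => exp_kernel c gamma (t - s) * x s).
  by apply: L1_eq (L1M bxt (L1_kernel_sub c_gt0 gamma_gt0 kap_cvg t0)) => s _; rewrite mulrC.
rewrite -(prim_kernel_conv c_gt0 gamma_gt0 kap_cvg t0 bxt) -(primZ _ (lexx t))//.
apply: (prim_ae (lexx t) iI); first exact: L1Z.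
apply: ae_on_sub tT _; apply: ae_onS2 dw wx => s _ ds <-.
rewrite crdZ (op_powE hdot he); last exact: op_pow_dom_le le2 ds.
by rewrite mulrCA.
Qed.

(** The second initial condition is about [gderive T 1 w], which is under control only once a
    square-integrable first derivative is known. The bound on the slopes makes the [y k] square
    summable, their synthesis is that derivative, and then [Q m] can be identified with
    [crd m phi1]. *)
Lemma solution_modes (w : R -> H) m :
  is_solution dot e a (exp_kernel c gamma) theta T f phi0 phi1 w ->
  exists x y h, scalar_sol c gamma T (al m) (be m) (crd m phi0) (crd m phi1) (g m) x y h /\
    ae_on T (fun t => crd m (w t) = x t).
Proof.
move=> [[w2 [dw Aw2] [v [v2 wd]]] weq iv0 iv1].
have [D2 wD _] := gderiveP hdot he T_gt0 v2 wd.
set D := gderive T 2 w in D2 wD weq.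
have /choice[P /choice[Q PQ]] : forall k, exists P Q : R, ae_on T (fun t =>
    crd k (w t) = P + prim (fun s => Q + prim (fun r => crd k (D r)) s) t).
  by move=> k; exact: weak_derivative2_primitive.
pose d k t := crd k (D t).
pose y k t := Q k + prim (d k) t.
pose x k t := P k + prim (y k) t.
have id k : L1 T (d k) by have [] := in_L2_crd hdot he k D2.
have id2 k : L1 T (fun t => d k t ^+ 2) by have [] := in_L2_crd hdot he k D2.
have by_ k : bdd_meas T (y k) by apply: bdd_measD; [exact: bdd_meas_cst|exact: prim_bdd_meas].
have bx k : bdd_meas T (x k).
  by apply: bdd_measD; [exact: bdd_meas_cst|apply: prim_bdd_meas; exact: bdd_meas_L1].
(* The values at 0 come first: they enter the bound on the slopes, and as coordinates of [phi0] they
   are square summable. *)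
have PE k : crd k phi0 = P k.
  apply: (initial_value_crd hdot he T_gt0 iv0 (PQ k)).
  exact: (@prim_cvg_right0 (y k) (P k) (bdd_meas_L1 (by_ k)) (L1_sqr_bdd (by_ k))).
pose S k := prim (fun t => crd k (w t) ^+ 2) T + crd k phi0 ^+ 2 + prim (fun t => d k t ^+ 2) T.
have T0 := ltW T_gt0.
(* The coefficients [1], [T] and [T ^+ 4] of [slope_le] are bounded by their sum. *)
pose Cq := 9 * (1 + T + T ^+ 4) / T ^+ 3.
have QS k : Q k ^+ 2 <= Cq * S k.
  rewrite /Cq mulrAC ler_pdivlMr ?exprn_gt0//.
  have [iw2 iw] := in_L2_crd hdot he k w2.
  apply: (le_trans (slope_le iw iw2 (id k) (id2 k) (PQ k))).
  rewrite -[leRHS]mulrA ler_wpM2l// /S PE.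
  set A := prim (fun t => crd k (w t) ^+ 2) T; set J := prim (fun t => d k t ^+ 2) T.
  have A0 : 0 <= A by apply: prim_ge0 => t _; exact: sqr_ge0.
  have J0 : 0 <= J by apply: prim_ge0 => t _; exact: sqr_ge0.
  have P0 := sqr_ge0 (P k); set B := P k ^+ 2 in P0 *.
  have T4 : 0 <= T ^+ 4 by exact: exprn_ge0.
  have := mulr_ge0 T0 A0; have := mulr_ge0 T4 A0; have := mulr_ge0 T4 P0; have := mulr_ge0 T0 J0.
  by move: (T ^+ 4) => T4'; nra.
have yS k t : 0 <= t <= T -> y k t ^+ 2 <= (2 * Cq + 2 * T) * S k.
  move=> tT; have H1 := sqr_prim_le tT (id k) (id2 k).
  have H2 : prim (d k) t ^+ 2 <= T * S k.
    apply: (le_trans H1); apply: ler_pM; try by have /andP[] := tT.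
      by apply: prim_ge0 => s _; exact: sqr_ge0.
    by rewrite /S lerDr addr_ge0 ?sqr_ge0//; apply: prim_ge0 => s _; exact: sqr_ge0.
  have := QS k; rewrite /y; move: H2; set p := prim _ t; have := sqr_ge0 (Q k - p).
  rewrite (_ : (2 * Cq + 2 * T) * S k = 2 * (Cq * S k) + 2 * (T * S k)); last by ring.
  by set A := Cq * S k; set B := T * S k; nra.
have cS : cvgn (series (fun k => (2 * Cq + 2 * T) * S k)).
  rewrite (_ : series _ = fun n => (2 * Cq + 2 * T) * (
      series (fun k => prim (fun t => crd k (w t) ^+ 2) T) n + series (fun k => crd k phi0 ^+ 2) n +
      series (fun k => prim (fun t => d k t ^+ 2) T) n)); last first.
    by apply/funext => n; rewrite /series/= -!big_split/= mulr_sumr.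
  apply: is_cvgMl_tmp; apply: is_cvgD; last by have [] := in_L2_series hdot he D2.
  apply: is_cvgD; first by have [] := in_L2_series hdot he w2.
  exact: cvg_crd.
have [Y2 YE] := in_L2_synth by_ yS cS.
have oc (t : R) : 0 < t < T -> 0 <= t <= T by move=> /andP[t0 tT]; rewrite !ltW.
have wd1 : weak_derivative T 1 w (fun t => synth e (y ^~ t)).
  apply: (weak_derivativeP hdot he hsep T_gt0 w2 Y2) => phi k tphi.
  rewrite expr1 mulN1r (@eq_prim _ _ (fun t => phi t * y k t)); last first.
    by move=> t /oc tT; rewrite YE.
  rewrite -[LHS]opprK -(@prim_test_parts _ T T_gt0 _ (P k) (x k) (y k) tphi (bdd_meas_L1 (by_ k)))//.
  congr (- _); have bphi := test_bdd_meas T_gt0 (test_derive tphi).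
  have [_ iw] := in_L2_crd hdot he k w2.
  apply: prim_ae (lexx T) _ _ _; [exact: L1M (bdd_meas_L1 (bx k))|exact: L1M iw|].
  by apply: ae_onS (PQ k) => t _ ->.
have [_ _ dY] := gderiveP hdot he T_gt0 Y2 wd1.
have QE : crd m phi1 = Q m.
  apply: (@initial_value_crd _ _ _ hdot _ he _ T_gt0 _ _ (y m) _ _ iv1).
    by apply: ae_onS dY => t /oc tT ->; rewrite YE.
  exact: prim_cvg_right0.
exists (x m), (y m), (d m); split; last exact: PQ.
split=> //; [|by move=> t _; rewrite PE|by move=> t _; rewrite QE].
have gE := mode_source_ae hdot he a_ge1 hf m.
apply: ae_onS2 (ae_onS2 (fun _ _ A B => conj A B) dw (PQ m))
  (ae_onS2 (fun _ _ A B => conj A B) weq gE).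
move=> t /andP[t0 tT] [dwt wxt] [[I [BI IE]] gt].
rewrite /rhs gt -IE crdB crdD (memory_crd _ dw (PQ m) (bx m) BI) ?t0 ?ltW//.
rewrite (op_powE hdot he)// reig_pow2// wxt /x /y /d; ring.
Qed.

Lemma solution_unique (w w' : R -> H) :
  is_solution dot e a (exp_kernel c gamma) theta T f phi0 phi1 w ->
  is_solution dot e a (exp_kernel c gamma) theta T f phi0 phi1 w' ->
  ae_on T (fun t => w t = w' t).
Proof.
move=> sw sw'; apply: (eq_ae_crd hdot he) => m.
have [x [y [h [s wx]]]] := solution_modes m sw.
have [x' [y' [h' [s' wx']]]] := solution_modes m sw'.
have [ig _] := L1_mode_source hdot he hf m.
apply: ae_onS2 wx wx' => t /andP[t0 tT] -> ->.
apply: (scalar_sol_unique c_gt0 gamma_gt0 kap_cvg kap_lt1 (mode_coupling_ge0 a theta m)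
  (mode_coupling_le a_ge1 theta01 m) _ ig s s'); last by rewrite !ltW.
by rewrite (lt_le_trans ltr01)// reig_ge1.
Qed.

End Uniqueness.

(** * Well-posedness with an explicit constant *)

Section WellPosedness.
Context {R : realType} {H : completeNormedModType R[i]}.
Variable dot : {dot H for Num.conj}.
Hypothesis hdot : hilbert_dot dot.
Hypothesis hsep : separable_space H.
Variables (e : nat -> H) (a c gamma : nat -> R) (theta T : R).
Hypothesis he : orthonormal_basis dot e.
Hypothesis a_ge1 : forall n, 1 <= a n.
Hypothesis c_gt0 : forall k, 0 < c k.
Hypothesis gamma_gt0 : forall k, 0 < gamma k.
Hypothesis kap_lt1 : (\sum_(0 <= k <oo) (c k / gamma k)%:E < 1)%E.
Hypothesis theta01 : 0 <= theta <= 1.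
Hypothesis T_gt0 : 0 < T.

Lemma well_posed : exists d : R, 0 < d /\
  forall (f : R -> H) (phi0 phi1 : H), in_L2_pow dot e a T (2 - theta) f ->
    op_pow_dom dot e a 2 phi0 -> op_pow_dom dot e a 1 phi1 ->
  exists u : R -> H,
    [/\ is_solution dot e a (exp_kernel c gamma) theta T f phi0 phi1 u,
        forall w : R -> H,
          is_solution dot e a (exp_kernel c gamma) theta T f phi0 phi1 w ->
          ae_on T (fun t => w t = u t)
      & norm_W22 dot e a T u <=
        d * (norm_L2 T (fun t => op_pow dot e a (2 - theta) (f t)) +
             rnorm (op_pow dot e a 2 phi0) + rnorm (op_pow dot e a 1 phi1))].
Proof.
have b0 k : 0 <= c k / gamma k by rewrite divr_ge0// ltW.
have cb : cvgn (series (fun k => c k / gamma k)).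
  by apply/nneseries_ltyP => //; exact: lt_trans kap_lt1 (ltry 1).
set kap := limn (series (fun k => c k / gamma k)).
have kap_cvg : series (fun k => c k / gamma k) n @[n --> \oo] --> kap by exact: cb.
have kap1 : kap < 1 by rewrite -lte_fin -nneseries_lim.
have C0 := energy_cst_ge0 T_gt0 kap1.
(* Fixed before the data are introduced: it depends on [kap] and [T] only. *)
exists (Num.sqrt (2 + 9 * energy_cst T kap * T)); split.
  by rewrite sqrtr_gt0 ltr_wpDr// (mulr_ge0 (mulr_ge0 (ler0n R 9) C0) (ltW T_gt0)).
move=> f phi0 phi1 hf h0 h1.
have /choice[s sP] : forall m, exists s : (R -> R) * (R -> R) * (R -> R),
    scalar_sol c gamma T (reig a m) (mode_coupling a theta m) (crd dot e m phi0) (crd dot e m phi1)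
      (mode_source dot e a theta f m) s.1.1 s.1.2 s.2.
  move=> m; have [ig _] := L1_mode_source hdot he hf m.
  have [x [y [h sxyh]]] := scalar_sol_exists c_gt0 gamma_gt0 kap_cvg (reig a m)
    (crd dot e m phi0) (crd dot e m phi1) (mode_coupling_ge0 a theta m) ig.
  by exists (x, y, h).
have [su nu] := modes_solution hdot he hsep a_ge1 c_gt0 gamma_gt0 kap_cvg kap1 theta01 T_gt0 hf h0 h1 sP.
eexists; split; first exact: su.
  by move=> w sw; apply: (solution_unique hdot he hsep T_gt0 a_ge1 c_gt0 gamma_gt0 kap_cvg kap1 theta01 hf sw su).
apply: (le_trans nu); rewrite ler_wpM2l ?sqrtr_ge0//.
set n := norm_L2 _ _; set r0 := rnorm (op_pow _ _ _ _ phi0); set r1 := rnorm _.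
have n0 : 0 <= n by exact: sqrtr_ge0.
have r00 : 0 <= r0 by exact: rnorm_ge0.
have r10 : 0 <= r1 by exact: rnorm_ge0.
(* [data_energy] is the sum of the squares of [n], [r0] and [r1], hence at most the square of their
   sum. *)
rewrite -[leRHS]ger0_norm ?addr_ge0// -sqrtr_sqr ler_wsqrtr//.
rewrite /data_energy -/r0 -/r1 (_ : prim _ T = n ^+ 2); last first.
  by rewrite sqr_sqrtr//; apply: prim_ge0 => t _; exact: sqr_ge0.
by nra.
Qed.

End WellPosedness.

Theorem theorem2p2 (R : realType) (H : completeNormedModType R[i])
  (dot : {dot H for Num.conj}) (hdot : hilbert_dot dot)
  (hsep : separable_space H)
  (A : unbounded_operator H)
  (hsa : self_adjoint dot A) (hpos : positive_operator dot A)
  (hinv : has_compact_inverse A)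
  (e : nat -> H) (a : nat -> R)
  (he : orthonormal_basis dot e)
  (heig : forall n, op_dom A (e n) /\ A (e n) = rscale (a n) (e n))
  (ha1 : 1 <= a 0%N) (hamono : forall n, a n <= a n.+1)
  (hainf : a n @[n --> \oo] --> +oo)
  (c gamma : nat -> R)
  (hc : forall k, 0 < c k)
  (hgamma0 : 0 < gamma 0%N) (hgamma : forall k, gamma k < gamma k.+1)
  (hgammainf : gamma k @[k --> \oo] --> +oo)
  (theta T : R) (htheta : 0 <= theta <= 1) (hT : 0 < T) :
  ((\sum_(0 <= k <oo) (c k / gamma k)%:E < 1)%E ->
   (\sum_(0 <= k <oo) (c k)%:E < +oo)%E ->
   exists d : R, 0 < d /\
   forall (f : R -> H) (phi0 phi1 : H),
     in_L2_pow dot e a T (2 - theta) f ->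
     op_pow_dom dot e a 2 phi0 -> op_pow_dom dot e a 1 phi1 ->
   exists u : R -> H,
     [/\ is_solution dot e a (exp_kernel c gamma) theta T f phi0 phi1 u,
         forall w : R -> H,
           is_solution dot e a (exp_kernel c gamma) theta T f phi0 phi1 w ->
           ae_on T (fun t => w t = u t)
       & norm_W22 dot e a T u <=
         d * (norm_L2 T (fun t => op_pow dot e a (2 - theta) (f t)) +
              rnorm (op_pow dot e a 2 phi0) +
              rnorm (op_pow dot e a 1 phi1))])
  /\
  ((\sum_(0 <= k <oo) (c k / gamma k)%:E < 1)%E ->
   (\sum_(0 <= k <oo) (c k)%:E = +oo)%E ->
   0 < theta ->
   exists d : R, 0 < d /\
   forall (f : R -> H) (phi0 phi1 : H),
     in_L2_pow dot e a T (2 - theta) f ->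
     op_pow_dom dot e a (2 + theta) phi0 -> op_pow_dom dot e a (1 + theta) phi1 ->
   exists u : R -> H,
     [/\ is_solution dot e a (exp_kernel c gamma) theta T f phi0 phi1 u,
         forall w : R -> H,
           is_solution dot e a (exp_kernel c gamma) theta T f phi0 phi1 w ->
           ae_on T (fun t => w t = u t)
       & norm_W22 dot e a T u <=
         d * (norm_L2 T (fun t => op_pow dot e a (2 - theta) (f t)) +
              rnorm (op_pow dot e a (2 + theta) phi0) +
              rnorm (op_pow dot e a (1 + theta) phi1))]).
Proof.
have a_ge1 n : 1 <= a n by elim: n => // n ih; exact: le_trans ih (hamono n).
have gamma_gt0 k : 0 < gamma k by elim: k => // k ih; exact: lt_trans ih (hgamma k).
split=> kap_lt1; last first.
  move=> _ _; have theta0 : 0 <= theta by have /andP[] := htheta.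
  have [d [d0 dP]] := well_posed hdot hsep he a_ge1 hc gamma_gt0 kap_lt1 htheta hT.
  have l2 : 2 <= 2 + theta by rewrite lerDl.
  have l1 : 1 <= 1 + theta by rewrite lerDl.
  exists d; split=> // f phi0 phi1 hf h0 h1.
  have [u [su uu nu]] := dP f phi0 phi1 hf (op_pow_dom_le a_ge1 l2 h0) (op_pow_dom_le a_ge1 l1 h1).
  exists u; split=> //; apply: (le_trans nu); rewrite (ler_pM2l d0) !lerD//.
    exact: (rnorm_op_pow_le hdot he a_ge1 l2).
  exact: (rnorm_op_pow_le hdot he a_ge1 l1).
by move=> _; exact: (well_posed hdot hsep he a_ge1 hc gamma_gt0 kap_lt1 htheta hT).
Qed.
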